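(* Let $V$ be a non-zero finite dimensional $\mathbb{F}_q$-vector space, let $i\colon V'\hookrightarrow V$ be the inclusion of a non-zero $\mathbb{F}_q$-subspace, let $\pi\colon V^*\to V'^*$ be the projection dual to $i$, and set $r'':=\dim V-\dim V'$. Then the following diagram commutes: its three rows are $\Omega_{V'}\xrightarrow{g_{V'}}\Omega_{V'^*}\xrightarrow{f_{V'}}\Omega_{V'}$, then $Q_{V'}\xrightarrow{g_{V'}}P_{V'^*}\xrightarrow{f_{V'}}Q_{V'}$, then $Q_V\xrightarrow{g_V}P_{V^*}\xrightarrow{f_V}Q_V$; the vertical morphisms from the first to the second row are the inclusions $\Omega_{V'}\hookrightarrow Q_{V'}$, $\Omega_{V'^*}\hookrightarrow P_{V'^*}$, $\Omega_{V'}\hookrightarrow Q_{V'}$; and the vertical morphisms from the second to the third row are, from left to right, $i_*\colon Q_{V'}\to Q_V$, $\pi^*\colon P_{V'^*}\to P_{V^*}$, and $i_*\circ\operatorname{Frob}_{q^{r''}}\colon Q_{V'}\to Q_V$. In particular $g_V\circ i_*=\pi^*\circ g_{V'}$ and $f_V\circ\pi^*=i_*\circ\operatorname{Frob}_{q^{r''}}\circ f_{V'}$.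
   Context: $\mathbb{F}_q$ is a finite field with $q$ elements; $\operatorname{Frob}_{q^n}$ is the $q^n$-th power Frobenius morphism on any scheme over $\mathbb{F}_q$. For a non-zero finite dimensional $\mathbb{F}_q$-vector space $V$: $S_V$ is the symmetric algebra of $V$, $K_V$ its field of quotients, $R_V\subset K_V$ the $\mathbb{F}_q$-subalgebra generated by all $\frac1v$ for $v\in V\setminus\{0\}$, $RS_V$ the subalgebra of $K_V$ generated by $R_V$ and $S_V$, graded with each $v$ in degree $1$ and $\frac1v$ in degree $-1$; $P_V:=\operatorname{Proj}S_V$, $Q_V:=\operatorname{Proj}R_V$ (formed after inverting the sign of the grading), and $\Omega_V:=\operatorname{Spec}RS_{V,0}$ (degree $0$ part), which is an open dense subscheme of both $P_V$ and $Q_V$. Let $\mathcal{L}$ be an invertible sheaf on an $\mathbb{F}_q$-scheme $S$. A linear map $V\to\Gamma(S,\mathcal{L})$ is an $\mathbb{F}_q$-linear map. A reciprocal map $\rho\colon V\setminus\{0\}\to\Gamma(S,\mathcal{L})$ is a map with $\rho(\alpha v)=\alpha^{-1}\rho(v)$ for all $v\in V\setminus\{0\}$, $\alpha\in\mathbb{F}_q^\times$, and $\rho(v)\rho(v')=\rho(v+v')(\rho(v)+\rho(v'))$ in $\Gamma(S,\mathcal{L}^2)$ for all $v,v'\in V\setminus\{0\}$ with $v+v'\ne0$. Such a map is fiberwise non-zero (resp. fiberwise injective, resp. fiberwise invertible) if for every $s\in S$ its composite with $\Gamma(S,\mathcal{L})\to\mathcal{L}\otimes k(s)$ is not identically zero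 (resp. injective, resp. non-zero at every element). $P_V$ represents the functor sending $S$ to isomorphism classes of pairs $(\mathcal{L},\lambda)$ with $\lambda\colon V\to\Gamma(S,\mathcal{L})$ fiberwise non-zero linear, with $\Omega_V\subset P_V$ the subfunctor of fiberwise injective ones. $Q_V$ represents the functor sending $S$ to isomorphism classes of pairs $(\mathcal{L},\rho)$ with $\rho\colon V\setminus\{0\}\to\Gamma(S,\mathcal{L})$ fiberwise non-zero reciprocal (universal map $v\mapsto\frac1v$), with $\Omega_V\subset Q_V$ the subfunctor of fiberwise invertible ones. With $r=\dim V$ and the pairing $\langle\ ,\ \rangle\colon V^*\times V\to\mathbb{F}_q$, the morphism $g_V\colon Q_V\to P_{V^*}$ is $(\mathcal{L},\rho)\mapsto(\mathcal{L},g_V(\rho))$ with $g_V(\rho)(\ell)=\sum_{v\in V\setminus\{0\},\langle\ell,v\rangle=1}\rho(v)$ for $\ell\in V^*$, and $f_V\colon P_{V^*}\to Q_V$ is $(\mathcal{L},\lambda)\mapsto(\mathcal{L}^{q^{r-1}},f_V(\lambda))$ with $f_V(\lambda)(v)=\prod_{\ell\in V^*,\langle\ell,v\rangle=1}\lambda(\ell)$ for $v\in V\setminus\{0\}$; they restrict to morphisms $g_V\colon\Omega_V\to\Omega_{V^*}$ and $f_V\colon\Omega_{V^*}\to\Omega_V$. The morphism $i_*\colon Q_{V'}\to Q_V$ is induced by extension by zero of reciprocal maps ($i_*\rho(v)=\rho(v)$ if $v\in V'$, and $0$ otherwise), and $\pi^*\colon P_{V'^*}\to P_{V^*}$ is induced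 by pullback of linear maps, $\lambda\mapsto\lambda\circ\pi$. *)

(* Defs.v *)
From HB Require Import structures.
From mathcomp Require Import all_boot all_order all_algebra all_fingroup all_solvable.
From mathcomp Require Import all_field.
From mathcomp Require Import boolp classical_sets functions topology_structure.
From mathcomp Require Import mpoly.

Set Implicit Arguments.
Unset Strict Implicit.
Unset Printing Implicit Defensive.

Import GRing.Theory.
Local Open Scope classical_set_scope.
Local Open Scope ring_scope.

Record opens (T : topologicalType) := Opens {
  oset :> set T;
  oset_open : open oset }.

Lemma opens_ext (T : topologicalType) (U W : opens T) :
  oset U = oset W -> U = W.
Proof.
case: U W => [U oU] [W oW] /= eUW; move: oU oW; rewrite eUW => oU oW.
by congr Opens; apply: Prop_irrelevance.
Qed.

Definition otop (T : topologicalType) : opens T := Opens openT.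

Definition ocap (T : topologicalType) (U W : opens T) : opens T :=
  Opens (openI (oset_open U) (oset_open W)).

Lemma opre_open (S T : topologicalType) (f : S -> T) (cf : continuous f)
  (U : opens T) : open (f @^-1` U).
Proof. by move/continuousP: cf; apply; exact: oset_open. Qed.

Definition opre (S T : topologicalType) (f : S -> T) (cf : continuous f)
  (U : opens T) : opens S := Opens (opre_open cf U).

Record rspace (k : fieldType) := RSpace {
  rpt :> topologicalType;
  rO : opens rpt -> comPzRingType;
  rres : forall U W : opens rpt, W `<=` U -> {rmorphism rO U -> rO W};
  rstr : forall U : opens rpt, {rmorphism k -> rO U} }.

Arguments rres {k X U W} : rename.
Arguments rstr {k X} U : rename.

(* Stalks are not formed; this says that the germ of s at x is a unit of the
   stalk at x. *)
Definition unit_at (k : fieldType) (X : rspace k) (x : X) (U : opens X)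
    (s : rO U) : Prop :=
  exists (W : opens X) (h : W `<=` U) (t : rO W), oset W x /\ rres h s * t = 1.

Record is_lrs (k : fieldType) (X : rspace k) : Prop := IsLrs {
  lrs_res_id : forall (U : opens X) (h : U `<=` U) (s : rO U), rres h s = s;
  lrs_res_comp : forall (U W Z : opens X) (h : W `<=` U) (h' : Z `<=` W)
    (h'' : Z `<=` U) (s : rO U), rres h' (rres h s) = rres h'' s;
  lrs_res_str : forall (U W : opens X) (h : W `<=` U) (a : k),
    rres h (rstr U a) = rstr W a;
  lrs_sep : forall (U : opens X) (s t : rO U),
    (forall x, oset U x -> exists (W : opens X) (h : W `<=` U),
       oset W x /\ rres h s = rres h t) -> s = t;
  lrs_glue : forall (U : opens X) (I : Type) (W : I -> opens X)
    (h : forall i, W i `<=` U) (s : forall i, rO (W i)),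
    (forall x, oset U x -> exists i, oset (W i) x) ->
    (forall i j (Z : opens X) (hi : Z `<=` W i) (hj : Z `<=` W j),
       rres hi (s i) = rres hj (s j)) ->
    exists t : rO U, forall i, rres (h i) t = s i;
  (* The next two fields say that the stalks are local rings. *)
  lrs_unit0 : forall (x : X) (U : opens X), ~ unit_at x (0 : rO U);
  lrs_unitD : forall (x : X) (U : opens X) (s t : rO U),
    unit_at x (s + t) -> unit_at x s \/ unit_at x t }.

Record lrs (k : fieldType) := Lrs {
  lspace :> rspace k;
  lspaceP : is_lrs lspace }.

Record lhom (k : fieldType) (X Y : lrs k) := LHom {
  hpt :> X -> Y;
  hcont : continuous hpt;
  hO : forall U : opens Y, {rmorphism rO U -> rO (opre hcont U)};
  hnat : forall (U W : opens Y) (h : W `<=` U)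
    (h' : opre hcont W `<=` opre hcont U) (s : rO U),
    hO W (rres h s) = rres h' (hO U s);
  hstr : forall (U : opens Y) (a : k), hO U (rstr U a) = rstr (opre hcont U) a;
  hlocal : forall (x : X) (U : opens Y) (s : rO U),
    unit_at x (hO U s) -> unit_at (hpt x) s }.

Arguments hcont {k X Y} f : rename.
Arguments hO {k X Y} f U : rename.
Arguments hnat {k X Y} f {U W} h h' s : rename.
Arguments hstr {k X Y} f : rename.
Arguments hlocal {k X Y} f {x U s} : rename.

Lemma rmorph_ext (R S : pzRingType) (f g : {rmorphism R -> S}) :
  f =1 g -> f = g.
Proof.
case: f g => [f cf] [g cg] /= /funext e; move: cf; rewrite {}e => cf.
congr GRing.RMorphism.Pack.
case: cf cg => [[[a1 a2]] [[b1 b2]]] [[[a1' a2']] [[b1' b2']]].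
rewrite (Prop_irrelevance a1 a1') (Prop_irrelevance a2 a2').
by rewrite (Prop_irrelevance b1 b1') (Prop_irrelevance b2 b2').
Qed.

Lemma lhom_ext (k : fieldType) (X Y : lrs k) (f g : lhom X Y) :
  (forall x, f x = g x) ->
  (forall (U : opens Y) (s : rO U) (W : opens X)
     (h : W `<=` opre (hcont f) U) (h' : W `<=` opre (hcont g) U),
     rres h (hO f U s) = rres h' (hO g U s)) ->
  f = g.
Proof.
case: f => f cf fO fn fs fl; case: g => g cg gO gn gs gl /= /funext efg.
move: cf fO fn fs fl; rewrite {}efg => cf fO fn fs fl.
have ec : cf = cg by apply: Prop_irrelevance.
move: fO fn fs fl; rewrite {}ec => fO fn fs fl eO.
have efO : fO = gO.
  apply: functional_extensionality_dep => U.
  apply: rmorph_ext => t.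
  have := eO U t (opre cg U) (@subset_refl _ _) (@subset_refl _ _).
  by rewrite !(lrs_res_id (lspaceP X)).
move: fn fs fl; rewrite {}efO => fn fs fl.
by congr LHom; apply: Prop_irrelevance.
Qed.

Section Comp.
Variables (k : fieldType) (X Y Z : lrs k) (g : lhom Y Z) (f : lhom X Y).

Lemma lcomp_cont : continuous (g \o f).
Proof.
by move=> x; apply: continuous_comp; [exact: (hcont f) | exact: (hcont g)].
Qed.

Lemma lcomp_sub (U : opens Z) :
  opre lcomp_cont U `<=` opre (hcont f) (opre (hcont g) U).
Proof. by []. Qed.

Definition lcomp_O (U : opens Z) : {rmorphism rO U -> rO (opre lcomp_cont U)} :=
  rres (@lcomp_sub U) \o (hO f (opre (hcont g) U) \o hO g U).

Program Definition lcomp : lhom X Z := @LHom k X Z (g \o f) lcomp_cont lcomp_O _ _ _.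
Next Obligation.
move=> U W h h' s; rewrite /lcomp_O /=.
have h1 : opre (hcont g) W `<=` opre (hcont g) U by move=> x; apply: h.
have h2 : opre (hcont f) (opre (hcont g) W) `<=`
  opre (hcont f) (opre (hcont g) U) by move=> x; apply: h.
rewrite (hnat g h h1) (hnat f h1 h2).
have h3 : opre lcomp_cont W `<=` opre (hcont f) (opre (hcont g) U).
  by move=> x; apply: h.
by rewrite !(lrs_res_comp (lspaceP X) _ _ h3).
Qed.
Next Obligation.
by move=> U a; rewrite /lcomp_O /= !hstr (lrs_res_str (lspaceP X)).
Qed.
Next Obligation.
move=> x U s [W [h [t [Wx e]]]].
apply: (hlocal g); apply: (hlocal f).
have h' : W `<=` opre (hcont f) (opre (hcont g) U) by [].
exists W, h', t; split=> //; rewrite -e; congr (_ * _).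
by rewrite /lcomp_O /= (lrs_res_comp (lspaceP X)).
Qed.
End Comp.

Section Frobenius.
Variables (k : finFieldType) (n : nat).

Lemma powq_nmod (R : comPzRingType) (i : {rmorphism k -> R}) :
  Algebra.nmod_morphism (fun a : R => a ^+ (#|k| ^ n)).
Proof.
have q0 : (0 < #|k| ^ n)%N by rewrite expn_gt0 (ltnW (finNzRing_gt1 k)).
split; first by rewrite expr0n; case: (_ ^ _)%N q0.
move=> x y.
have [e|ne] := eqVneq (1 : R) 0.
  have z (t : R) : t = 0 by rewrite -[t]mulr1 e mulr0.
  by rewrite (z (_ ^+ _)) [RHS]z.
pose nz := GRing.PzSemiRing_isNonZero.Build R ne.
pose S : comNzRingType := HB.pack R nz.
have [p pr chp] := finPcharP k.
have chR : p \in [pchar S].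
  by rewrite inE pr /= -(rmorph_nat (i : {rmorphism k -> S})) (pcharf0 chp) rmorph0.
rewrite [LHS](@exprDn_pchar S) //.
rewrite pnatX; apply/orP; left.
have := abelem_pgroup (fin_ring_pchar_abelem chp).
rewrite /pgroup cardsT; apply: sub_in_pnat => r _.
by rewrite inE => /eqP ->.
Qed.

Lemma powq_monoid (R : comPzRingType) :
  GRing.monoid_morphism (fun a : R => a ^+ (#|k| ^ n)).
Proof. by split=> [|x y]; rewrite ?expr1n ?exprMn. Qed.

Variable X : lrs k.

Definition powq (U : opens X) (s : rO U) : rO U := s ^+ (#|k| ^ n).

HB.instance Definition _ (U : opens X) := GRing.isNmodMorphism.Build
  (rO U) (rO U) (@powq U) (powq_nmod (rstr U)).
HB.instance Definition _ (U : opens X) := GRing.isMonoidMorphism.Build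
  (rO U) (rO U) (@powq U) (@powq_monoid (rO U)).

Lemma id_cont : continuous (id : X -> X).
Proof. by move=> x A. Qed.

Lemma frob_sub (U : opens X) : opre id_cont U `<=` U.
Proof. by []. Qed.

Definition frob_O (U : opens X) : {rmorphism rO U -> rO (opre id_cont U)} :=
  @rres _ _ _ _ (@frob_sub U) \o @powq U.

Program Definition frob : lhom X X := @LHom k X X id id_cont frob_O _ _ _.
Next Obligation.
move=> U W h h' s; rewrite /frob_O /= /powq -rmorphXn.
rewrite !(lrs_res_comp (lspaceP X)) //; by apply: subset_trans h.
Qed.
Next Obligation.
move=> U a; rewrite /frob_O /= /powq -rmorphXn (lrs_res_str (lspaceP X)).
congr (rstr _ _); elim: n => [|m IH]; first by rewrite expn0 expr1.
by rewrite expnSr exprM IH expf_card.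
Qed.
Next Obligation.
move=> x U s [W [h [t [Wx e]]]].
have h' : W `<=` U by [].
have : rres h' s * (rres h' s ^+ (#|k| ^ n).-1 * t) = 1.
  rewrite mulrA -exprS prednK ?expn_gt0 ?(ltnW (finNzRing_gt1 k)) //.
  rewrite -[RHS]e; congr (_ * _).
  by rewrite /frob_O /= /powq (lrs_res_comp (lspaceP X)) rmorphXn.
by exists W, h'; exists (rres h' s ^+ (#|k| ^ n).-1 * t).
Qed.
End Frobenius.

(* The canonical map from (U, O_X|U) to Spec O_X(U) is an isomorphism: it is
   bijective, the loci D(b) where b is invertible form a basis of the topology,
   and O_X(D(b)) is the localization O_X(U)[1/b]. *)
Definition prime_of (R : comPzRingType) (p : set R) : Prop :=
  [/\ p 0, (forall a b, p a -> p b -> p (a + b)), (forall a b, p b -> p (a * b)),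
      ~ p 1 & forall a b, p (a * b) -> p a \/ p b].

Record affine_open (k : fieldType) (X : lrs k) (U : opens X) : Prop :=
  AffineOpen {
  aff_surj : forall p : set (rO U), prime_of p ->
    exists2 x, oset U x & p = [set b | ~ unit_at x b];
  aff_inj : forall x y, oset U x -> oset U y ->
    (forall b : rO U, unit_at x b <-> unit_at y b) -> x = y;
  aff_basis : forall (W : opens X) x, W `<=` U -> oset W x ->
    exists2 b : rO U, unit_at x b & forall y, unit_at y b -> oset W y;
  aff_frac : forall (b : rO U) (W : opens X) (h : W `<=` U),
    (forall x, oset W x <-> unit_at x b) -> forall s : rO W,
    exists (c : rO U) (n : nat), rres h c = s * rres h b ^+ n;
  aff_ker : forall (b : rO U) (W : opens X) (h : W `<=` U),
    (forall x, oset W x <-> unit_at x b) -> forall c : rO U,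
    rres h c = 0 -> exists n : nat, b ^+ n * c = 0 }.

Definition is_scheme (k : fieldType) (X : lrs k) : Prop :=
  forall x : X, exists2 U : opens X, oset U x & affine_open U.

Record omod (k : fieldType) (X : lrs k) := OMod {
  msec : forall U : opens X, lmodType (rO U);
  mres : forall U W : opens X, W `<=` U -> msec U -> msec W;
  mresD : forall (U W : opens X) (h : W `<=` U) (s t : msec U),
    mres h (s + t) = mres h s + mres h t;
  mresZ : forall (U W : opens X) (h : W `<=` U) (a : rO U) (s : msec U),
    mres h (a *: s) = rres h a *: mres h s;
  mres_id : forall (U : opens X) (h : U `<=` U) (s : msec U), mres h s = s;
  mres_comp : forall (U W Z : opens X) (h : W `<=` U) (h' : Z `<=` W)
    (h'' : Z `<=` U) (s : msec U), mres h' (mres h s) = mres h'' s;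
  msep : forall (U : opens X) (s t : msec U),
    (forall x, oset U x -> exists (W : opens X) (h : W `<=` U),
       oset W x /\ mres h s = mres h t) -> s = t;
  mglue : forall (U : opens X) (I : Type) (W : I -> opens X)
    (h : forall i, W i `<=` U) (s : forall i, msec (W i)),
    (forall x, oset U x -> exists i, oset (W i) x) ->
    (forall i j (Z : opens X) (hi : Z `<=` W i) (hj : Z `<=` W j),
       mres hi (s i) = mres hj (s j)) ->
    exists t : msec U, forall i, mres (h i) t = s i }.

Arguments msec {k X} L U : rename.
Arguments mres {k X} L {U W} h s : rename.

Section Modules.
Variables (k : fieldType) (X : lrs k).
Implicit Types L M : omod X.

Definition generates L (U : opens X) (e : msec L U) : Prop :=
  forall (W : opens X) (h : W `<=` U) (s : msec L W),
    exists! a : rO W, s = a *: mres L h e.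

Definition invertible L : Prop :=
  forall x : X, exists (U : opens X) (e : msec L U), oset U x /\ generates e.

(* The image of s in the fibre L_x / m_x L_x = L (x) k(x) is zero. *)
Definition zero_at L (x : X) (U : opens X) (s : msec L U) : Prop :=
  exists (W : opens X) (h : W `<=` U) (n : nat)
         (a : 'I_n -> rO W) (t : 'I_n -> msec L W),
    [/\ oset W x, (forall i, ~ unit_at x (a i)) &
        mres L h s = \sum_i a i *: t i].

(* M is the m-th tensor power of the invertible sheaf L, by means of the
   m-linear map mu: if e trivializes L then e (x) ... (x) e trivializes M. *)
Record tensor_power (m : nat) L M
    (mu : forall U : opens X, ('I_m -> msec L U) -> msec M U) : Prop :=
  TensorPower {
  tp_linear : forall (U : opens X) (i : 'I_m) (f : 'I_m -> msec L U)
    (a : rO U) (s t : msec L U),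
    mu U (fun j => if j == i then a *: s + t else f j) =
    a *: mu U (fun j => if j == i then s else f j) +
    mu U (fun j => if j == i then t else f j);
  tp_res : forall (U W : opens X) (h : W `<=` U) (f : 'I_m -> msec L U),
    mres M h (mu U f) = mu W (fun i => mres L h (f i));
  tp_gen : forall (U : opens X) (e : msec L U),
    generates e -> generates (mu U (fun=> e)) }.

End Modules.

(* (L, l) is the pullback under x of the pair (M, m), for M invertible and
   families m, l of global sections indexed by D.  An O_Y-linear map
   theta : M -> x_* L is adjoint to an isomorphism x^* M -> L if and only if it
   sends local trivializations to local trivializations. *)
Definition is_pullback (k : fieldType) (X Y : lrs k) (x : lhom X Y)
    (M : omod Y) (L : omod X) (J : Type) (D : set J)
    (m : J -> msec M (otop Y)) (l : J -> msec L (otop X)) : Prop :=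
  exists theta : forall U : opens Y, msec M U -> msec L (opre (hcont x) U),
  [/\ (forall (U : opens Y) (a : rO U) (s t : msec M U),
         theta U (a *: s + t) = hO x U a *: theta U s + theta U t),
      (forall (U W : opens Y) (h : W `<=` U)
         (h' : opre (hcont x) W `<=` opre (hcont x) U) (s : msec M U),
         theta W (mres M h s) = mres L h' (theta U s)),
      (forall (U : opens Y) (e : msec M U),
         generates e -> generates (theta U e)) &
      (forall (h : otop X `<=` opre (hcont x) (otop Y)) (j : J), D j ->
         mres L h (theta (otop Y) (m j)) = l j)].

(* Linear and reciprocal maps to the global sections of L.  A map on
   V \ {0} is represented by a map on V whose value at 0 is never used. *)
Section Pairs.
Variables (k : finFieldType) (X : lrs k) (L : omod X) (V : vectType k).
Notation Gamma := (msec L (otop X)).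

Definition linear_map (lam : V -> Gamma) : Prop :=
  forall (a : k) (v w : V), lam (a *: v + w) = rstr _ a *: lam v + lam w.

Definition pair2 (s t : Gamma) : 'I_2 -> Gamma :=
  fun i => if i == ord0 then s else t.

Definition reciprocal_map (rho : V -> Gamma) : Prop :=
  (forall (a : k) (v : V), a != 0 -> v != 0 ->
     rho (a *: v) = rstr _ a^-1 *: rho v) /\
  (forall (M : omod X) mu, @tensor_power k X 2 L M mu ->
   forall v w : V, v != 0 -> w != 0 -> v + w != 0 ->
     mu _ (pair2 (rho v) (rho w)) =
     mu _ (pair2 (rho (v + w)) (rho v + rho w))).

Definition lin_fiberwise_nonzero (lam : V -> Gamma) : Prop :=
  forall x : X, exists v : V, ~ zero_at x (lam v).

Definition lin_fiberwise_injective (lam : V -> Gamma) : Prop :=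
  forall (x : X) (v w : V), zero_at x (lam v - lam w) -> v = w.

Definition rec_fiberwise_nonzero (rho : V -> Gamma) : Prop :=
  forall x : X, exists2 v : V, v != 0 & ~ zero_at x (rho v).

Definition rec_fiberwise_invertible (rho : V -> Gamma) : Prop :=
  forall (x : X) (v : V), v != 0 -> ~ zero_at x (rho v).

End Pairs.

(* gA is the ring A and gH d its part A_d of degree d.  For Spec of an ungraded
   ring every gH d is A itself. *)
Record gring (k K : fieldType) (i : {rmorphism k -> K}) := Gring {
  gA : set K;
  gH : nat -> set K;
  gA_1 : gA 1;
  gA_B : forall a b, gA a -> gA b -> gA (a - b);
  gA_M : forall a b, gA a -> gA b -> gA (a * b);
  gH_A : forall d, gH d `<=` gA;
  gH_k : forall a, gH 0 (i a);
  gH_0 : forall d, gH d 0;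
  gH_B : forall d a b, gH d a -> gH d b -> gH d (a - b);
  gH_M : forall d e a b, gH d a -> gH e b -> gH (d + e) (a * b) }.

Record prime_ideal (K : fieldType) (A p : set K) : Prop := PrimeIdeal {
  pi_sub : p `<=` A;
  pi_0 : p 0;
  pi_B : forall a b, p a -> p b -> p (a - b);
  pi_M : forall a b, A a -> p b -> p (a * b);
  pi_1 : ~ p 1;
  pi_prime : forall a b, A a -> A b -> p (a * b) -> p a \/ p b }.

(* The primes p of A with Q p, in the topology with basis the sets
   D(f) = {p | f \notin p} for homogeneous f. *)
Section ZSpace.
Variables (k K : fieldType) (i : {rmorphism k -> K}) (G : gring i).
Variable Q : set (set K).

Record zpt := ZPt {
  zp : set K;
  zp_prime : prime_ideal (gA G) zp;
  zp_Q : Q zp }.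

Lemma zpt_ext (x y : zpt) : zp x = zp y -> x = y.
Proof.
case: x y => [p pp pq] [q qp qq] /= e; move: pp pq; rewrite e => pp pq.
by congr ZPt; apply: Prop_irrelevance.
Qed.

HB.instance Definition _ := gen_eqMixin zpt.
HB.instance Definition _ := gen_choiceMixin zpt.

Definition zD (f : K) : set zpt := [set x | ~ zp x f].

Definition zopen : set_system zpt := [set U | forall x, U x ->
  exists d f, [/\ gH G d f, zD f x & zD f `<=` U]].

Lemma gH_1 : gH G 0 1.
Proof. by rewrite -(rmorph1 i); apply: gH_k. Qed.

Lemma zDM d e f g x : gH G d f -> gH G e g -> zD f x -> zD g x -> zD (f * g) x.
Proof.
move=> fd ge fx gx fgx; case: (pi_prime (zp_prime x) _ _ fgx) => //.
- exact: gH_A fd.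
- exact: gH_A ge.
Qed.

Lemma zDMl d e f g x : gH G d f -> gH G e g -> zD (f * g) x -> zD f x.
Proof.
move=> fd ge fgx fx; apply: fgx; rewrite mulrC; apply: (pi_M (zp_prime x)) => //.
exact: gH_A ge.
Qed.

Lemma zD_neq0 f x : zD f x -> f != 0.
Proof. by move=> fx; apply/eqP => f0; apply: fx; rewrite f0; apply: pi_0 (zp_prime x). Qed.

Lemma zopenT : zopen setT.
Proof.
move=> x _; exists 0%N, 1; split=> //; first exact: gH_1.
exact: pi_1 (zp_prime x).
Qed.

Lemma zopenI : setI_closed zopen.
Proof.
move=> U W oU oW x [/oU [d [f [fd fx fU]]] /oW [e [g [ge gx gW]]]].
exists (d + e)%N, (f * g); split; first exact: gH_M.
  exact: zDM fd ge fx gx.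
move=> y fgy; split; [apply: fU; exact: zDMl fd ge fgy|apply: gW].
by rewrite mulrC in fgy; exact: zDMl ge fd fgy.
Qed.

Lemma zopen_bigU (I : Type) (F : I -> set zpt) :
  (forall j, zopen (F j)) -> zopen (\bigcup_j F j).
Proof.
move=> oF x [j _ /oF [d [f [fd fx fF]]]]; exists d, f; split=> // y /fF Fy.
by exists j.
Qed.

HB.instance Definition _ :=
  isOpenTopological.Build zpt zopenT zopenI zopen_bigU.

Lemma zopenE (U : set zpt) : open U = zopen U.
Proof. by []. Qed.

End ZSpace.

(* Sections of O(m): functions on U with values in K (which contains all
   localizations of A) that are locally a constant fraction a/b with
   a in A_(d+m), b in A_d, and b outside of the prime. *)
Section ZSheaf.
Variables (k K : fieldType) (i : {rmorphism k -> K}) (G : gring i).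
Variable Q : set (set K).
Notation T := (zpt G Q).
Notation dom U := {x : T | oset U x}.

Lemma dom_ext (U : opens T) (x y : dom U) : sval x = sval y -> x = y.
Proof. by move=> e; apply: eq_sig_hprop e => z; exact: Prop_irrelevance. Qed.

Definition zlocal (m : nat) (U : opens T) (s : dom U -> K) : Prop :=
  forall x : dom U, exists W : opens T, oset W (sval x) /\ exists d a b,
    [/\ gH G (d + m) a, gH G d b &
     forall y : dom U, oset W (sval y) -> zD b (sval y) /\ s y = a / b].

Definition zpred m U : {pred dom U -> K} := fun s => `[< zlocal m s >].
Arguments zpred : clear implicits.

Lemma zpredP m U (s : dom U -> K) : reflect (zlocal m s) (s \in zpred m U).
Proof. exact: asboolP. Qed.

Lemma zpred_sub m U : zmod_closed (zpred m U).
Proof.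
split=> [|s t /zpredP sl /zpredP tl]; apply/zpredP => x.
  exists (otop T); split=> //; exists 0%N, 0, 1; split.
  - exact: gH_0.
  - exact: gH_1.
  - move=> y _; split; last by rewrite mul0r.
    exact: pi_1 (zp_prime (sval y)).
have [W [Wx [d [a [b [ad bd Ws]]]]]] := sl x.
have [Z [Zx [e [a' [b' [ae be Zt]]]]]] := tl x.
exists (ocap W Z); split=> //; exists (d + e)%N, (a * b' - a' * b), (b * b').
split; first 1 last.
- exact: gH_M.
- move=> y [/Ws [by_ sy] /Zt [b'y ty]]; split; first exact: zDM bd be by_ b'y.
  have b0 := zD_neq0 by_; have b'0 := zD_neq0 b'y.
  have -> : (s - t) y = s y - t y by [].
  by rewrite sy ty -mulNr addf_div // mulNr.
- apply: gH_B.
    by rewrite addnAC; apply: gH_M.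
  by rewrite -addnA mulrC; apply: gH_M.
Qed.

HB.instance Definition _ m U :=
  GRing.isZmodClosed.Build (dom U -> K) (zpred m U) (zpred_sub m U).

Record zsec m (U : opens T) := ZSec {
  zval :> dom U -> K;
  zval_in : zval \in zpred m U }.

HB.instance Definition _ m U := [isSub for @zval m U].
HB.instance Definition _ m U := [Choice of zsec m U by <:].
HB.instance Definition _ m U := [SubChoice_isSubZmodule of zsec m U by <:].

Lemma zlocal1 (U : opens T) : zlocal 0 (fun _ : dom U => 1).
Proof.
move=> x; exists (otop T); split=> //; exists 0%N, 1, 1; split.
- exact: gH_1.
- exact: gH_1.
- move=> y _; split; last by rewrite divr1.
  exact: pi_1 (zp_prime (sval y)).
Qed.

Lemma zlocalM m n (U : opens T) (s t : dom U -> K) :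
  zlocal m s -> zlocal n t -> zlocal (m + n) (fun x => s x * t x).
Proof.
move=> sl tl x.
have [W [Wx [d [a [b [ad bd Ws]]]]]] := sl x.
have [Z [Zx [e [a' [b' [ae be Zt]]]]]] := tl x.
exists (ocap W Z); split=> //; exists (d + e)%N, (a * a'), (b * b'); split.
- by rewrite addnACA; apply: gH_M.
- exact: gH_M.
move=> y [/Ws [by_ ->] /Zt [b'y ->]]; split; last by rewrite mulf_div.
exact: zDM bd be by_ b'y.
Qed.

Definition zone (U : opens T) : zsec 0 U := ZSec (asboolT (@zlocal1 U)).
Definition zmul m n (U : opens T) (s : zsec m U) (t : zsec n U) :
  zsec (m + n) U := ZSec (asboolT (zlocalM (asboolW (zval_in s)) (asboolW (zval_in t)))).

Lemma zsec_ext m (U : opens T) (s t : zsec m U) : zval s =1 zval t -> s = t.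
Proof. by move=> /funext e; apply: val_inj. Qed.

Lemma zsec_app m (U : opens T) (s t : zsec m U) : s = t -> zval s =1 zval t.
Proof. by move=> ->. Qed.

Lemma zvalD m (U : opens T) (s t : zsec m U) x : (s + t) x = s x + t x.
Proof. by []. Qed.
Lemma zvalN m (U : opens T) (s : zsec m U) x : (- s) x = - s x.
Proof. by []. Qed.

Section Ring.
Variable U : opens T.
Implicit Types s t u : zsec 0 U.

Definition zmul0 s t : zsec 0 U := zmul s t.
Lemma zmulA : associative zmul0.
Proof. by move=> s t u; apply: zsec_ext => x; rewrite /= mulrA. Qed.
Lemma zmulC : commutative zmul0.
Proof. by move=> s t; apply: zsec_ext => x; rewrite /= mulrC. Qed.
Lemma zmul1 : left_id (zone U) zmul0.
Proof. by move=> s; apply: zsec_ext => x; rewrite /= mul1r. Qed.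
Lemma zmulDl : left_distributive zmul0 +%R.
Proof. by move=> s t u; apply: zsec_ext => x; rewrite /= mulrDl. Qed.

HB.instance Definition _ := GRing.Zmodule_isComPzRing.Build (zsec 0 U)
  zmulA zmulC zmul1 zmulDl.

Lemma zval1 x : (1 : zsec 0 U) x = 1.
Proof. by []. Qed.
Lemma zvalM s t x : (s * t) x = s x * t x.
Proof. by []. Qed.

Variable m : nat.
Implicit Types v w : zsec m U.

Definition zscale s v : zsec m U := zmul s v.
Lemma zscaleA s t v : zscale s (zscale t v) = zscale (s * t) v.
Proof. by apply: zsec_ext => x; rewrite /= mulrA. Qed.
Lemma zscale1 : left_id 1 zscale.
Proof. by move=> v; apply: zsec_ext => x; rewrite /= mul1r. Qed.
Lemma zscaleDr : right_distributive zscale +%R.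
Proof. by move=> s v w; apply: zsec_ext => x; rewrite /= mulrDr. Qed.
Lemma zscaleDl v : {morph zscale^~ v : s t / s + t}.
Proof. by move=> s t; apply: zsec_ext => x; rewrite /= mulrDl. Qed.

HB.instance Definition _ := GRing.Zmodule_isLmodule.Build (zsec 0 U) (zsec m U)
  zscaleA zscale1 zscaleDr zscaleDl.

Lemma zvalZ s v x : (s *: v) x = s x * v x.
Proof. by []. Qed.
End Ring.

Section Res.
Variables (m : nat) (U W : opens T) (h : W `<=` U).

Definition zsub (x : dom W) : dom U := exist _ (sval x) (h (svalP x)).

Lemma zlocal_res (s : dom U -> K) : zlocal m s -> zlocal m (s \o zsub).
Proof.
move=> sl x; have [Z [Zx [d [a [b [ad bd Zs]]]]]] := sl (zsub x).
by exists Z; split=> //; exists d, a, b; split=> // y /(Zs (zsub y)).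
Qed.

Definition zres (s : zsec m U) : zsec m W := ZSec (asboolT (zlocal_res (asboolW (zval_in s)))).

Lemma zres_nmod : Algebra.nmod_morphism zres.
Proof. by split=> [|s t]; apply: zsec_ext. Qed.

HB.instance Definition _ := GRing.isNmodMorphism.Build (zsec m U) (zsec m W)
  zres zres_nmod.
End Res.

Section ResRing.
Variables (U W : opens T) (h : W `<=` U).

Definition zres0 : zsec 0 U -> zsec 0 W := zres h.

Lemma zres0_monoid : GRing.monoid_morphism zres0.
Proof. by split=> [|s t]; apply: zsec_ext. Qed.

HB.instance Definition _ := GRing.isNmodMorphism.Build (zsec 0 U) (zsec 0 W)
  zres0 (zres_nmod 0 h).
HB.instance Definition _ := GRing.isMonoidMorphism.Build (zsec 0 U) (zsec 0 W)
  zres0 zres0_monoid.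
End ResRing.

Section Const.
Variable U : opens T.

Lemma zlocal_const (a : k) : zlocal 0 (fun _ : dom U => i a).
Proof.
move=> x; exists (otop T); split=> //; exists 0%N, (i a), 1; split.
- exact: gH_k.
- exact: gH_1.
- move=> y _; split; last by rewrite divr1.
  exact: pi_1 (zp_prime (sval y)).
Qed.

Definition zconst (a : k) : zsec 0 U := ZSec (asboolT (zlocal_const a)).

Lemma zconst_nmod : Algebra.nmod_morphism zconst.
Proof. by split=> [|s t]; apply: zsec_ext => x; rewrite /= ?rmorph0 ?rmorphD. Qed.
Lemma zconst_monoid : GRing.monoid_morphism zconst.
Proof. by split=> [|s t]; apply: zsec_ext => x; rewrite /= ?rmorph1 ?rmorphM. Qed.

HB.instance Definition _ := GRing.isNmodMorphism.Build k (zsec 0 U)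
  zconst zconst_nmod.
HB.instance Definition _ := GRing.isMonoidMorphism.Build k (zsec 0 U)
  zconst zconst_monoid.
End Const.

Definition zrspace : rspace k := @RSpace k T (zsec 0)
  (fun U W h => @zres0 U W h) (fun U => @zconst U).

Lemma zsep m (U : opens T) (s t : zsec m U) :
  (forall x, oset U x -> exists (W : opens T) (h : W `<=` U),
    oset W x /\ zres h s = zres h t) -> s = t.
Proof.
move=> e; apply: zsec_ext => -[x Ux].
have [W [h [Wx /zsec_app/(_ (exist _ x Wx))]]] := e x Ux.
by rewrite /= (_ : zsub h _ = exist _ x Ux) //; exact: dom_ext.
Qed.

Lemma zglue m (U : opens T) (I : Type) (W : I -> opens T)
    (h : forall j, W j `<=` U) (s : forall j, zsec m (W j)) :
  (forall x, oset U x -> exists j, oset (W j) x) ->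
  (forall j l (Z : opens T) (hj : Z `<=` W j) (hl : Z `<=` W l),
     zres hj (s j) = zres hl (s l)) ->
  exists t : zsec m U, forall j, zres (h j) t = s j.
Proof.
move=> cov comp.
pose c (x : dom U) := cid (cov (sval x) (svalP x)).
pose f (x : dom U) := s (sval (c x)) (exist _ (sval x) (svalP (c x))).
have sE j l x (Wj : oset (W j) x) (Wl : oset (W l) x) :
    s j (exist _ x Wj) = s l (exist _ x Wl).
  have hj : ocap (W j) (W l) `<=` W j by move=> y [].
  have hl : ocap (W j) (W l) `<=` W l by move=> y [].
  have Wx : oset (ocap (W j) (W l)) x by [].
  have /zsec_app/(_ (exist _ x Wx)) := comp j l _ hj hl.
  rewrite /= (_ : zsub hj _ = exist _ x Wj); last exact: dom_ext.
  by rewrite (_ : zsub hl _ = exist _ x Wl) //; exact: dom_ext.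
have fE j x (Wj : oset (W j) (sval x)) : f x = s j (exist _ (sval x) Wj).
  exact: sE.
have fl : zlocal m f.
  move=> x; have [j Wj] := cov _ (svalP x).
  have [Z [Zx [d [a [b [ad bd Zs]]]]]] := asboolW (zval_in (s j)) (exist _ (sval x) Wj).
  exists (ocap Z (W j)); split=> //; exists d, a, b; split=> // y [Zy Wy].
  by rewrite (fE j y Wy); exact: (Zs (exist _ (sval y) Wy)).
exists (ZSec (asboolT fl)) => j; apply: zsec_ext => x /=.
have Wx : oset (W j) (sval (zsub (h j) x)) by exact: svalP x.
by rewrite (fE j _ Wx); congr (zval _ _); exact: dom_ext.
Qed.

(* The unit criterion: the germ at x of a section a/b is a unit if and only if
   a is outside of x. *)
Lemma zunitP (x : T) (U : opens T) (Ux : oset U x) (s : zsec 0 U) d a b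
    (W : opens T) : gH G d a -> gH G d b -> oset W x ->
  (forall y : dom U, oset W (sval y) -> zD b (sval y) /\ zval s y = a / b) ->
  @unit_at k zrspace x U s <-> zD a x.
Proof.
move=> ad bd Wx Ws; split.
  move=> [Z [h [t [Zx e]]]] ax.
  have [Y [Yx [d' [a' [b' [ad' bd' Yt]]]]]] := asboolW (zval_in t) (exist _ x Zx).
  have [by_ sx] := Ws (zsub h (exist _ x Zx)) Wx.
  have [b'y tx] := Yt (exist _ x Zx) Yx.
  have /zsec_app/(_ (exist _ x Zx)) := e.
  rewrite zvalM zval1 tx.
  have -> : rres h s (exist _ x Zx) = a / b by exact: sx.
  have b0 := zD_neq0 by_; have b'0 := zD_neq0 b'y.
  rewrite mulf_div => /(canRL (divfK (mulf_neq0 b0 b'0))); rewrite mul1r => e'.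
  have := zDM bd bd' by_ b'y; apply; rewrite -e' mulrC.
  apply: (pi_M (zp_prime x)) => //.
  by have := gH_A ad'; rewrite ?addn0.
move=> ax.
have oZ : open ([set y | oset U y] `&` [set y | oset W y] `&` zD a).
  apply: openI; first by apply: openI; exact: oset_open.
  by rewrite zopenE => y ay; exists d, a; split.
pose Z := Opens oZ.
have h : Z `<=` U by move=> y [[]].
have tl : zlocal 0 (fun _ : dom Z => b / a).
  move=> y; exists Z; split; first exact: svalP.
  exists d, b, a; split=> //; first by rewrite addn0.
  by move=> z [_ az].
exists Z, h, (ZSec (asboolT tl) : rO (r := zrspace) Z); split=> //.
apply: zsec_ext => y; rewrite zvalM zval1 /=.
have [[_ Wy] ay] := svalP y.
have [by_ ->] := Ws (zsub h y) Wy.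
by rewrite mulrA divfK ?divff ?(zD_neq0 ay) ?(zD_neq0 by_).
Qed.

Lemma zrspaceP : is_lrs zrspace.
Proof.
split.
- by move=> U h s; apply: zsec_ext => x /=; congr (zval s _); exact: dom_ext.
- move=> U W Z h h' h'' s; apply: zsec_ext => x /=; congr (zval s _).
  exact: dom_ext.
- by move=> U W h a; apply: zsec_ext.
- exact: (@zsep 0).
- exact: (@zglue 0).
- move=> x U u.
  have Ux : oset U x by case: u => W [h [t [Wx _]]]; exact: h.
  have /(@zunitP x U Ux (0 : zsec 0 U) 0 0 1 (otop T)) := u.
  case; rewrite //.
  - exact: gH_0.
  - exact: gH_1.
  - by move=> y _; split; [exact: pi_1 (zp_prime (sval y))|rewrite mul0r].
  - exact: pi_0 (zp_prime x).
- move=> x U s t u.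
  have Ux : oset U x by case: u => W [h [t' [Wx _]]]; exact: h.
  have [W [Wx [d [a [b [ad bd Ws]]]]]] := asboolW (zval_in s) (exist _ x Ux).
  have [Z [Zx [e [a' [b' [ae be Zt]]]]]] := asboolW (zval_in t) (exist _ x Ux).
  rewrite addn0 in ad; rewrite addn0 in ae.
  rewrite (zunitP Ux ad bd Wx Ws) (zunitP Ux ae be Zx Zt).
  have st : zD (a * b' - (- a') * b) x.
    apply/(@zunitP x U Ux (s + t) (d + e) _ (b * b') (ocap W Z)) => //.
    - apply: gH_B; first exact: gH_M.
      rewrite mulrC; apply: gH_M => //.
      by rewrite -[- a']sub0r; apply: gH_B => //; exact: gH_0.
    - exact: gH_M.
    - move=> y [/Ws [by_ sy] /Zt [b'y ty]]; split; first exact: zDM bd be by_ b'y.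
      rewrite zvalD sy ty mulNr opprK addf_div //; first exact: zD_neq0 by_.
      exact: zD_neq0 b'y.
  apply: contrapT => /not_orP [na na'].
  have {}na : zp x a by apply: contrapT.
  have {}na' : zp x a' by apply: contrapT.
  apply: st; apply: (pi_B (zp_prime x)); rewrite mulrC.
    by apply: (pi_M (zp_prime x)) => //; exact: gH_A be.
  rewrite mulrN -sub0r; apply: (pi_B (zp_prime x)); first exact: pi_0 (zp_prime x).
  by apply: (pi_M (zp_prime x)) => //; exact: gH_A bd.
Qed.

Definition zspace : lrs k := Lrs zrspaceP.

Lemma zres_id m (U : opens T) (h : U `<=` U) (s : zsec m U) : zres h s = s.
Proof. by apply: zsec_ext => x /=; congr (zval s _); exact: dom_ext. Qed.

Lemma zres_comp m (U W Z : opens T) (h : W `<=` U) (h' : Z `<=` W)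
  (h'' : Z `<=` U) (s : zsec m U) : zres h' (zres h s) = zres h'' s.
Proof. by apply: zsec_ext => x /=; congr (zval s _); exact: dom_ext. Qed.

Lemma zresD m (U W : opens T) (h : W `<=` U) (s t : zsec m U) :
  zres h (s + t) = zres h s + zres h t.
Proof. by apply: zsec_ext. Qed.

Lemma zresZ m (U W : opens T) (h : W `<=` U) (a : zsec 0 U) (s : zsec m U) :
  zres h (a *: s) = zres0 h a *: zres h s.
Proof. by apply: zsec_ext. Qed.

Definition twist (m : nat) : omod zspace := @OMod k zspace (zsec m)
  (@zres m) (@zresD m) (@zresZ m) (@zres_id m) (@zres_comp m) (@zsep m) (@zglue m).

End ZSheaf.

Section SpecProj.
Variables (k K : fieldType) (i : {rmorphism k -> K}).

Record subalg (A : set K) : Prop := Subalg {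
  sa_k : forall a, A (i a);
  sa_B : forall a b, A a -> A b -> A (a - b);
  sa_M : forall a b, A a -> A b -> A (a * b) }.

Definition gen_alg (X : set K) : set K :=
  [set x | forall A, subalg A -> X `<=` A -> A x].

Lemma gen_alg_subalg X : subalg (gen_alg X).
Proof.
split.
- by move=> a A sA _; apply: sa_k.
- by move=> a b xa xb A sA XA; apply: sa_B => //; [apply: xa|apply: xb].
- by move=> a b xa xb A sA XA; apply: sa_M => //; [apply: xa|apply: xb].
Qed.

Lemma sub_gen_alg X : X `<=` gen_alg X.
Proof. by move=> x Xx A _; apply. Qed.

Variables (A : set K) (sA : subalg A).

Lemma sa_1 : A 1.
Proof. by rewrite -(rmorph1 i); apply: sa_k. Qed.
Lemma sa_0 : A 0.
Proof. by rewrite -(rmorph0 i); apply: sa_k. Qed.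
Lemma sa_N a : A a -> A (- a).
Proof. by move=> Aa; rewrite -[- a]sub0r; apply: sa_B => //; exact: sa_0. Qed.
Lemma sa_D a b : A a -> A b -> A (a + b).
Proof. by move=> Aa Ab; rewrite -[b]opprK; apply: sa_B => //; exact: sa_N. Qed.
Lemma sa_X a n : A a -> A (a ^+ n).
Proof.
by move=> Aa; elim: n => [|n IH]; [exact: sa_1|rewrite exprS; apply: sa_M].
Qed.

Definition spec_gring : gring i := @Gring k K i A (fun=> A)
  sa_1 (sa_B sA) (sa_M sA) (fun _ => @subset_refl _ A) (sa_k sA)
  (fun=> sa_0) (fun=> sa_B sA) (fun _ _ => sa_M sA).

Definition Spec : lrs k := zspace spec_gring setT.

Variable G : gring i.

Definition proj_prime : set (set K) := [set p |
  (forall (n : nat) (c : nat -> K), (forall d, gH G d (c d)) ->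
     p (\sum_(d < n) c d) -> forall d, (d < n)%N -> p (c d)) /\
  ~ (forall d, (0 < d)%N -> gH G d `<=` p)].

Definition Proj : lrs k := zspace G proj_prime.

End SpecProj.

Record nzvect (k : fieldType) := NZVect {
  nzv :> vectType k;
  nzvP : (0 < \dim {: nzv})%N }.

Section Rings.
Variables (k : fieldType) (V : vectType k).
Notation n := (\dim {: V}).

(* Sym V as the polynomial ring in a basis of V. *)
Definition Sym := {mpoly k[n]}.
Definition KV := {fraction Sym}.
HB.instance Definition _ := GRing.Field.on KV.

Definition KV_const : {rmorphism k -> KV} := @tofrac Sym \o @mpolyC n k.

Definition lin (v : V) : Sym := \sum_(j < n) coord (vbasis {: V}) j v *: 'X_j.
Definition vec (v : V) : KV := tofrac (lin v).

Definition hdeg (e : int) : set KV := [set x | x = 0 \/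
  exists (d d' : nat) (f g : Sym),
  [/\ f \is d.-homog, g \is d'.-homog, g != 0, x = tofrac f / tofrac g
    & e = d%:Z - d'%:Z]].

Definition SV : set KV := [set x | exists f : Sym, x = tofrac f].
Definition RV : set KV :=
  gen_alg KV_const [set x | exists2 v : V, v != 0 & x = (vec v)^-1].
Definition RSV : set KV := gen_alg KV_const (SV `|` RV).
Definition RSV0 : set KV := RSV `&` hdeg 0.

Lemma hdeg_0 e : hdeg e 0.
Proof. by left. Qed.

Lemma hdeg_k a : hdeg 0 (KV_const a).
Proof.
right; exists 0%N, 0%N, (mpolyC n a), 1; split.
- by rewrite -[mpolyC n a]mulr1 mul_mpolyC; apply: dhomogZ; apply: dhomog1.
- exact: dhomog1.
- exact: oner_neq0.
- by rewrite tofrac1 divr1.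
- by [].
Qed.

Lemma hdeg_B e x y : hdeg e x -> hdeg e y -> hdeg e (x - y).
Proof.
have hN z : hdeg e z -> hdeg e (- z).
  case=> [->|[d [d' [f [g [fd gd g0 -> ->]]]]]]; first by rewrite oppr0; left.
  right; exists d, d', (- f), g; split=> //; first by rewrite rpredN.
  by rewrite tofracN mulNr.
move=> hx /hN; move: (- y) => {}y.
case: hx => [->|[d [d' [f [g [fd gd g0 -> ->]]]]]]; first by rewrite add0r.
case=> [->|[c [c' [h [l [hc lc l0 -> ec]]]]]].
  by rewrite addr0; right; exists d, d', f, g.
have ed : (d + c' = c + d')%N.
  apply/eqP; rewrite -eqz_nat !PoszD eq_sym.
  by move/eqP: ec; rewrite subr_eq addrAC eq_sym subr_eq.
right; exists (d + c')%N, (d' + c')%N, (f * l + h * g), (g * l); split.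
- by apply: rpredD; [apply: dhomogM|rewrite ed; apply: dhomogM].
- exact: dhomogM.
- by rewrite mulf_neq0.
- by rewrite addf_div ?tofrac_eq0 // tofracD !tofracM.
- by rewrite !PoszD opprD addrACA subrr addr0.
Qed.

Lemma hdeg_M e e' x y : hdeg e x -> hdeg e' y -> hdeg (e + e') (x * y).
Proof.
case=> [->|[d [d' [f [g [fd gd g0 -> ->]]]]]]; first by rewrite mul0r; left.
case=> [->|[c [c' [h [l [hc lc l0 -> ->]]]]]]; first by rewrite mulr0; left.
right; exists (d + c)%N, (d' + c')%N, (f * h), (g * l); split.
- exact: dhomogM.
- exact: dhomogM.
- by rewrite mulf_neq0.
- by rewrite mulf_div !tofracM.
- by rewrite !PoszD opprD addrACA.
Qed.

Lemma hdeg_V e x : hdeg e x -> hdeg (- e) x^-1.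
Proof.
case=> [->|[d [d' [f [g [fd gd g0 -> ->]]]]]]; first by rewrite invr0; left.
have [->|f0] := eqVneq f 0; first by left; rewrite tofrac0 mul0r invr0.
by right; exists d', d, g, f; split=> //; rewrite ?invf_div // opprB.
Qed.

Lemma hdeg_tofrac d f : f \is d.-homog -> hdeg d%:Z (tofrac f).
Proof.
move=> fd; right; exists d, 0%N, f, 1; split=> //.
- exact: dhomog1.
- exact: oner_neq0.
- by rewrite tofrac1 divr1.
- by rewrite subr0.
Qed.

Lemma lin_homog v : lin v \is 1.-homog.
Proof.
by apply: rpred_sum => j _; apply: dhomogZ; rewrite dhomogX /= mdeg1.
Qed.

Lemma hdeg_vec v : hdeg 1 (vec v).
Proof. exact: (hdeg_tofrac (lin_homog v)). Qed.

Lemma vec_neq0 v : v != 0 -> vec v != 0.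
Proof.
move=> v0; rewrite tofrac_eq0; apply: contra v0 => /eqP l0.
rewrite (coord_vbasis (memvf v)) big1 // => j _.
have /(congr1 (fun p : Sym => p@_U_(j))) := l0; rewrite mcoeff0 /lin raddf_sum /=.
rewrite (bigD1 j) //= mcoeffZ mcoeffXU eqxx mulr1 big1 ?addr0 => [->|l lj].
  by rewrite scale0r.
by rewrite mcoeffZ mcoeffXU (negbTE lj) mulr0.
Qed.

Lemma SV_subalg : subalg KV_const SV.
Proof.
split=> [a|_ _ [f ->] [g ->]|_ _ [f ->] [g ->]].
- by exists (mpolyC n a).
- by exists (f - g); rewrite tofracB.
- by exists (f * g); rewrite tofracM.
Qed.

Lemma RV_subalg : subalg KV_const RV.
Proof. exact: gen_alg_subalg. Qed.

Lemma RSV_subalg : subalg KV_const RSV.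
Proof. exact: gen_alg_subalg. Qed.

Lemma RSV0_subalg : subalg KV_const RSV0.
Proof.
split=> [a|a b [Ra ha] [Rb hb]|a b [Ra ha] [Rb hb]].
- by split; [exact: sa_k RSV_subalg a|exact: hdeg_k].
- by split; [exact: (sa_B RSV_subalg)|exact: hdeg_B].
- by split; [exact: (sa_M RSV_subalg)|rewrite -[0]addr0; exact: hdeg_M].
Qed.

(* A as a graded ring, elements of degree sg * d in K_V being put in degree d. *)
Section Graded.
Variables (sg : int) (A : set KV) (sA : subalg KV_const A).

Definition gpart (d : nat) : set KV := A `&` hdeg (sg * d%:Z).

Lemma gpart_k a : gpart 0 (KV_const a).
Proof. by split; [exact: sa_k|rewrite mulr0; exact: hdeg_k]. Qed.
Lemma gpart_0 d : gpart d 0.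
Proof. by split; [exact: (sa_0 sA)|exact: hdeg_0]. Qed.
Lemma gpart_B d a b : gpart d a -> gpart d b -> gpart d (a - b).
Proof. by move=> [Aa ha] [Ab hb]; split; [exact: (sa_B sA)|exact: hdeg_B]. Qed.
Lemma gpart_M d e a b : gpart d a -> gpart e b -> gpart (d + e) (a * b).
Proof.
move=> [Aa ha] [Ab hb]; split; first exact: (sa_M sA).
by rewrite PoszD mulrDr; apply: hdeg_M.
Qed.

(* Homogeneous decompositions, written as polynomials evaluated at 1. *)
Definition gpoly (p : {poly KV}) := forall d, gpart d p`_d.

Lemma gpolyB p q : gpoly p -> gpoly q -> gpoly (p - q).
Proof. by move=> pA qA d; rewrite coefB; apply: gpart_B. Qed.

Lemma gpolyM p q : gpoly p -> gpoly q -> gpoly (p * q).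
Proof.
move=> pA qA d; rewrite coefM; elim/big_ind: _ => [|x y hx hy|j _].
- exact: gpart_0.
- rewrite -[y]opprK; apply: gpart_B => //.
  by rewrite -sub0r; apply: gpart_B => //; exact: gpart_0.
- by rewrite -[in gpart d](subnKC (ltnSE (ltn_ord j))); apply: gpart_M.
Qed.

Lemma gpolyZXn d a : gpart d a -> gpoly (a *: 'X^d).
Proof.
move=> ha e; rewrite coefZ coefXn; case: eqP => [->|_]; rewrite ?mulr1 ?mulr0 //.
exact: gpart_0.
Qed.

Lemma gdec_subalg :
  subalg KV_const [set a | exists2 p, gpoly p & a = p.[1]].
Proof.
split.
- move=> a; exists (KV_const a *: 'X^0); last by rewrite hornerZ hornerXn mulr1.
  by apply: gpolyZXn; exact: gpart_k.
- move=> _ _ [p pA ->] [q qA ->]; exists (p - q); first exact: gpolyB.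
  by rewrite hornerD hornerN.
- move=> _ _ [p pA ->] [q qA ->]; exists (p * q); first exact: gpolyM.
  by rewrite hornerM.
Qed.

Definition graded : gring KV_const := @Gring k KV KV_const A gpart
  (sa_1 sA) (sa_B sA) (sa_M sA) (fun d => @subIsetl _ _ _)
  gpart_k gpart_0 gpart_B gpart_M.
End Graded.

Definition Sgr : gring KV_const := graded 1 SV_subalg.
Definition Rgr : gring KV_const := graded (-1) RV_subalg.

Lemma SV_dec a : SV a -> exists2 p, gpoly 1 SV p & a = p.[1].
Proof.
move=> [f ->]; rewrite (pihomog_partitionE (mf := mdeg) (leqnn (mmeasure mdeg f))).
rewrite raddf_sum /=; apply: (big_ind (fun a => exists2 p, gpoly 1 SV p & a = p.[1])) => [|y z yS zS|d _].
- exact: (sa_0 (gdec_subalg 1 SV_subalg)).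
- exact: (sa_D (gdec_subalg 1 SV_subalg)).
- exists (tofrac (pihomog mdeg d f) *: 'X^d).
    apply: (gpolyZXn SV_subalg); split; first by eexists.
    by rewrite mul1r; apply: hdeg_tofrac; exact: pihomogP.
  by rewrite hornerZ hornerXn expr1n mulr1.
Qed.

Lemma RV_dec a : RV a -> exists2 p, gpoly (-1) RV p & a = p.[1].
Proof.
move=> Ra; apply: (Ra [set a | exists2 p, gpoly (-1) RV p & a = p.[1]]).
  exact: gdec_subalg RV_subalg.
move=> x [v v0 ->]; exists ((vec v)^-1 *: 'X^1).
  apply: (gpolyZXn RV_subalg); split; first by apply: sub_gen_alg; exists v.
  by rewrite mulr1; apply: hdeg_V; exact: hdeg_vec.
by rewrite hornerZ hornerXn expr1n mulr1.
Qed.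

Definition PV : lrs k := Proj Sgr.
Definition QV : lrs k := Proj Rgr.
Definition OmegaV : lrs k := Spec RSV0_subalg.

End Rings.

(* The open immersions of Omega into P and Q: a prime q of RS_0 is sent to the
   contraction to S or R of the ideal of RS generated by q; sections, being
   functions with values in K_V, are composed with this map. *)
Section Immersion.
Variables (k : fieldType) (V : vectType k).
Notation K := (KV V).
Notation RS := (@RSV k V).
Notation RS0 := (@RSV0 k V).
Notation hdeg := (@hdeg k V).
Let sRS := @RSV_subalg k V.

Variables (sg : int) (sg2 : sg * sg = 1) (A : set K) (sA : subalg (@KV_const k V) A).
Variable u : K.
Hypotheses (ARS : A `<=` RS) (Au : A u) (hu : hdeg sg u) (u0 : u != 0)
  (RSu : RS u^-1).
Hypothesis Adec : forall a, A a ->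
  exists2 p : {poly K}, forall d, gpart sg A d p`_d & a = p.[1].
Notation G := (graded sg sA).

Lemma hdeg_un d : hdeg (sg * d%:Z) (u ^+ d).
Proof.
elim: d => [|d IH]; first by rewrite mulr0 expr0 -(rmorph1 (@KV_const k V)); exact: hdeg_k.
by rewrite exprS -add1n PoszD mulrDr mulr1; exact: hdeg_M.
Qed.

Lemma hdeg_div d a : hdeg (sg * d%:Z) a -> hdeg 0 (a / u ^+ d).
Proof.
by move=> ha; rewrite -(subrr (sg * d%:Z)); apply/hdeg_M/hdeg_V/hdeg_un.
Qed.

Lemma RS0_div d a : RS a -> hdeg (sg * d%:Z) a -> RS0 (a / u ^+ d).
Proof.
move=> Ra ha; split; last exact: hdeg_div.
by rewrite -exprVn; apply: (sa_M sRS) => //; apply: (sa_X sRS).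
Qed.

Lemma un0 d : u ^+ d != 0.
Proof. exact: expf_neq0. Qed.

Lemma div_un a b d : a / u ^+ d / (b / u ^+ d) = a / b.
Proof. by rewrite -mulf_div (divff (invr_neq0 (un0 d))) mulr1. Qed.

Lemma hdeg_denom (c : nat -> K) m : (forall d, hdeg (sg * d%:Z) (c d)) ->
  exists (g : Sym V) (N : nat), [/\ g != 0, g \is N.-homog &
    forall d, (d < m)%N -> exists2 h : Sym V, c d * tofrac g = tofrac h &
      h = 0 \/ exists2 D : nat, h \is D.-homog & D%:Z = sg * d%:Z + N%:Z].
Proof.
move=> hc; elim: m => [|m [g [N [g0 gN IH]]]].
  by exists 1, 0%N; split=> //; [exact: oner_neq0|exact: dhomog1].
have [cm0|[d [d' [f [l [fd ld l0 cE eE]]]]]] := hc m.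
  exists g, N; split=> // d; rewrite ltnS leq_eqVlt => /predU1P [->|]; last exact: IH.
  by exists 0; [rewrite cm0 mul0r tofrac0|left].
exists (l * g), (d' + N)%N; split.
- by rewrite mulf_neq0.
- exact: dhomogM.
move=> e; rewrite ltnS leq_eqVlt => /predU1P [->|em].
  exists (f * g).
    have lF : tofrac l != 0 by rewrite tofrac_eq0.
    by rewrite cE 2!tofracM mulrA (divfK lF).
  right; exists (d + N)%N; first exact: dhomogM.
  by rewrite eE !PoszD addrA subrK.
have [h hE hh] := IH e em; exists (l * h); first by rewrite !tofracM mulrCA hE.
case: hh => [->|[D hD DE]]; first by left; rewrite mulr0.
right; exists (d' + D)%N; first exact: dhomogM.
by rewrite !PoszD DE addrCA.
Qed.

Lemma hdeg_indep (p : {poly K}) :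
  (forall d, hdeg (sg * d%:Z) p`_d) -> p.[1] = 0 -> p = 0.
Proof.
move=> hp p1; have [g [N [g0 gN H]]] := hdeg_denom (size p) hp.
have /choice [h hP] : forall d : 'I_(size p), exists h : Sym V,
    p`_d * tofrac g = tofrac h /\
    (h = 0 \/ exists2 D : nat, h \is D.-homog & D%:Z = sg * d%:Z + N%:Z).
  by move=> d; have [h h1 h2] := H d (ltn_ord d); exists h.
have sh : \sum_d h d = 0.
  apply/eqP; rewrite -tofrac_eq0 raddf_sum /=; apply/eqP.
  under eq_bigr => d _ do rewrite -(proj1 (hP d)).
  rewrite -mulr_suml; move: p1; rewrite horner_coef.
  by under eq_bigr => d _ do rewrite expr1n mulr1; move=> ->; rewrite mul0r.
suff h0 d : h d = 0.
  apply/polyP => d; rewrite coef0; have [dp|] := ltnP d (size p); last first.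
    by move=> ?; rewrite nth_default.
  have [e _] := hP (Ordinal dp); move: e; rewrite h0 tofrac0 => /eqP.
  by rewrite mulf_eq0 tofrac_eq0 (negbTE g0) orbF => /eqP.
have [//|[D hD DE]] := proj2 (hP d).
move/(congr1 (pihomog mdeg D)): sh; rewrite raddf_sum raddf0 (bigD1 d) //=.
rewrite (pihomog_dE hD) big1 ?addr0 // => e ed.
have [->|[E hE EE]] := proj2 (hP e); first exact: raddf0.
apply: pihomog_ne0 hE; apply: contra ed => /eqP ED; apply/eqP/val_inj => /=.
move: EE; rewrite ED DE => /addIr /(congr1 ( *%R sg)).
by rewrite !mulrA sg2 !mul1r => -[].
Qed.

Lemma hdeg_inj (p q : {poly K}) : (forall d, hdeg (sg * d%:Z) p`_d) ->
  (forall d, hdeg (sg * d%:Z) q`_d) -> p.[1] = q.[1] -> p = q.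
Proof.
move=> hp hq e; apply/eqP; rewrite -subr_eq0; apply/eqP/hdeg_indep.
  by move=> d; rewrite coefB; apply: hdeg_B.
by rewrite hornerD hornerN e subrr.
Qed.

Definition shift (N : nat) (p : {poly K}) : {poly K} := (u ^+ N) *: p * 'X^N.

Lemma shift1 N p : (shift N p).[1] = p.[1] * u ^+ N.
Proof. by rewrite hornerM hornerXn expr1n mulr1 hornerZ mulrC. Qed.

Lemma coef_shift N p d :
  (shift N p)`_d = if (d < N)%N then 0 else u ^+ N * p`_(d - N).
Proof. by rewrite coefMXn coefZ. Qed.

Lemma shift_prop (Pr : nat -> K -> Prop) N (p : {poly K}) : (forall d, Pr d 0) ->
  (forall d x, Pr d x -> Pr (d + N)%N (u ^+ N * x)) ->
  (forall d, Pr d p`_d) -> forall d, Pr d (shift N p)`_d.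
Proof.
move=> P0 PN Pp d; rewrite coef_shift; case: ltnP => // Nd.
by rewrite -{1}(subnK Nd); apply: PN.
Qed.

Notation RSpoly := (gpoly sg RS).

Lemma RSpoly_shift N p : RSpoly p -> RSpoly (shift N p).
Proof.
apply: (@shift_prop (fun d x => gpart sg RS d x)).
  by move=> d; exact: (gpart_0 sg sRS).
move=> d x hx; rewrite addnC; apply: (gpart_M sRS) => //.
by split; [apply: (sa_X sRS); exact: ARS|exact: hdeg_un].
Qed.

Definition RSdecset : set K :=
  [set a | exists N, exists2 p, RSpoly p & a * u ^+ N = p.[1]].

Lemma RSpoly_const a : RS0 a -> RSpoly a%:P.
Proof.
move=> [Ra ha] d; rewrite coefC; case: eqP => [->|_]; last exact: (gpart_0 sg sRS).
by split; rewrite ?mulr0.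
Qed.

Lemma RSpolyM p q : RSpoly p -> RSpoly q -> RSpoly (p * q).
Proof. exact: (gpolyM sRS). Qed.

Lemma RSdecset_subalg : subalg (@KV_const k V) RSdecset.
Proof.
split.
- move=> a; exists 0%N, (@KV_const k V a)%:P; last by rewrite mulr1 hornerC.
  by apply: RSpoly_const; exact: (sa_k (@RSV0_subalg k V)).
- move=> a b [N [p pR aE]] [M [q qR bE]]; exists (N + M)%N, (shift M p - shift N q).
    by move=> d; rewrite coefB; apply: (gpart_B sRS); exact: RSpoly_shift.
  rewrite hornerD hornerN !shift1 -aE -bE exprD mulrBl !mulrA; congr (_ - _).
  by rewrite mulrAC.
- move=> a b [N [p pR aE]] [M [q qR bE]]; exists (N + M)%N, (p * q).
    exact: RSpolyM.
  by rewrite hornerM -aE -bE exprD mulrACA.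
Qed.

Lemma hdeg_RSdec e a : RS a -> hdeg e a -> RSdecset a.
Proof.
move=> Ra ha; have eE : e = sg * (sg * e) by rewrite mulrA sg2 mul1r.
move: ha; rewrite {}eE; case: (sg * e) => m ha.
  exists 0%N, (a *: 'X^m); last by rewrite hornerZ hornerXn expr1n.
  move=> d; rewrite coefZ coefXn; case: eqP => [->|_]; rewrite ?mulr1 ?mulr0 //.
  exact: (gpart_0 sg sRS).
exists m.+1, (a * u ^+ m.+1)%:P; last by rewrite hornerC.
apply: RSpoly_const; split.
  by apply: (sa_M sRS) => //; apply: (sa_X sRS); exact: ARS.
rewrite -(subrr (sg * m.+1%:Z)) addrC.
by apply: hdeg_M (hdeg_un _); move: ha; rewrite NegzE mulrN.
Qed.

Lemma RSdec a : RS a -> RSdecset a.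
Proof.
apply; first exact: RSdecset_subalg.
have SR : @SV k V `|` @RV k V `<=` RS by exact: sub_gen_alg.
move=> x [[f ->]|].
  rewrite (pihomog_partitionE (mf := mdeg) (leqnn (mmeasure mdeg f))) raddf_sum /=.
  apply: big_ind => [|y z yR zR|d _].
  - exact: (sa_0 RSdecset_subalg).
  - exact: (sa_D RSdecset_subalg).
  - apply: (@hdeg_RSdec d%:Z); last by apply: hdeg_tofrac; exact: pihomogP.
    by apply: SR; left; eexists.
apply; first exact: RSdecset_subalg.
move=> y [v v0 yE]; apply: (@hdeg_RSdec (- 1)).
  by apply: SR; right; apply: sub_gen_alg; exists v.
by rewrite yE; apply: hdeg_V; exact: hdeg_vec.
Qed.

Definition extend (q : set K) : set K := [set x | exists s : seq (K * K),
  (forall c, c \in s -> RS c.1 /\ q c.2) /\ x = \sum_(c <- s) c.1 * c.2].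

Section Prime.
Variables (q : set K) (qP : prime_ideal RS0 q).

Lemma prime_sum (I : eqType) (r : seq I) (F : I -> K) :
  (forall j, j \in r -> q (F j)) -> q (\sum_(j <- r) F j).
Proof.
move=> qF; rewrite big_seq; apply: big_ind => [|x y qx qy|j /qF //].
  exact: pi_0 qP.
rewrite -[y]opprK -[- y]sub0r; apply: (pi_B qP) => //; apply: (pi_B qP) => //.
exact: pi_0 qP.
Qed.

Definition qpoly (p : {poly K}) := forall d, q (p`_d / u ^+ d).

Lemma qpoly_hdeg p : qpoly p -> forall d, hdeg (sg * d%:Z) p`_d.
Proof.
move=> qp d; have [_ h0] := pi_sub qP (qp d).
by rewrite -[p`_d](divfK (un0 d)) -[sg * d]add0r; apply/hdeg_M/hdeg_un.
Qed.

Lemma qpoly_shift N p : qpoly p -> qpoly (shift N p).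
Proof.
apply: (@shift_prop (fun d x => q (x / u ^+ d))).
  by move=> d; rewrite mul0r; exact: pi_0 qP.
by move=> d x qx; rewrite exprD [_ * u ^+ N]mulrC -mulf_div divff ?un0 // mul1r.
Qed.

Lemma qD a b : q a -> q b -> q (a + b).
Proof.
move=> qa qb; rewrite -[b]opprK -[- b]sub0r; apply: (pi_B qP) => //.
by apply: (pi_B qP) => //; exact: pi_0 qP.
Qed.

Lemma extend_dec x : extend q x ->
  exists N, exists2 p, qpoly p & x * u ^+ N = p.[1].
Proof.
case=> s [sP ->]; elim: s sP => [|c s IH] sP.
  exists 0%N, 0; last by rewrite big_nil mul0r horner0.
  by move=> d; rewrite coef0 mul0r; exact: pi_0 qP.
have [|N [p pq pE]] := IH; first by move=> c' c's; apply: sP; rewrite inE c's orbT.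
have [Rc qc] := sP c (mem_head _ _).
have [M [r rR rE]] := RSdec Rc.
exists (M + N)%N, (shift N (r * c.2%:P) + shift M p).
  move=> d; rewrite coefD mulrDl; apply: qD.
    apply: qpoly_shift => e; rewrite coefMC mulrAC; apply: (pi_M qP) => //.
    by have [] := rR e; apply: RS0_div.
  exact: qpoly_shift.
rewrite big_cons mulrDl hornerD !shift1 hornerM hornerC -rE -pE exprD.
by congr (_ + _); [rewrite !mulrA; congr (_ * _); rewrite mulrAC|rewrite mulrAC mulrA].
Qed.

(* A sum of homogeneous components is in the extension of q if and only if,
   divided by powers of u, the components are in q. *)
Lemma extendP (p : {poly K}) : RSpoly p -> extend q p.[1] <-> qpoly p.
Proof.
move=> pR; split.
  move=> /extend_dec [N [r rq]]; rewrite -shift1 => e.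
  have sE : shift N p = r.
    apply: hdeg_inj e => d; last exact: qpoly_hdeg.
    by have [] := RSpoly_shift N pR d.
  move=> d; have := rq (N + d)%N; rewrite -sE coef_shift ltnNge leq_addr /=.
  by rewrite addKn exprD -mulf_div divff ?un0 // mul1r.
move=> pq; exists [seq (u ^+ d, p`_d / u ^+ d) | d <- iota 0 (size p)]; split.
  move=> _ /mapP [d _ ->] /=; split; last exact: pq.
  by apply: (sa_X sRS); exact: ARS.
rewrite big_map horner_coef -(big_mkord xpredT (fun d => p`_d * 1 ^+ d)) /index_iota.
rewrite subn0; apply: eq_bigr => d _.
by rewrite expr1n mulr1 mulrC divfK ?un0.
Qed.

Lemma extend_hdeg d a : RS a -> hdeg (sg * d%:Z) a ->
  extend q a <-> q (a / u ^+ d).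
Proof.
move=> Ra ha; have aR : RSpoly (a *: 'X^d).
  move=> e; rewrite coefZ coefXn; case: eqP => [->|_]; rewrite ?mulr1 ?mulr0 //.
  exact: (gpart_0 sg sRS).
have := extendP aR; rewrite hornerZ hornerXn expr1n mulr1 => ->; split=> [/(_ d)|qa e].
  by rewrite coefZ coefXn eqxx mulr1.
rewrite coefZ coefXn; case: eqP => [->|_]; rewrite ?mulr1 // mulr0 mul0r.
exact: pi_0 qP.
Qed.

Lemma qpoly_prime (p r : {poly K}) : RSpoly p -> RSpoly r -> qpoly (p * r) ->
  qpoly p \/ qpoly r.
Proof.
move=> pR rR prq; apply: contrapT => /not_orP [/existsNP [d0 pd] /existsNP [e0 re]].
have [d /asboolP qd dmin] : {d : nat | `[< ~ q (p`_d / u ^+ d) >] &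
    forall d', `[< ~ q (p`_d' / u ^+ d') >] -> (d <= d')%N}.
  have ex : exists d, `[< ~ q (p`_d / u ^+ d) >] by exists d0; exact/asboolP.
  by exists (ex_minn ex); case: ex_minnP.
have [e /asboolP qe emin] : {d : nat | `[< ~ q (r`_d / u ^+ d) >] &
    forall d', `[< ~ q (r`_d' / u ^+ d') >] -> (d <= d')%N}.
  have ex : exists d, `[< ~ q (r`_d / u ^+ d) >] by exists e0; exact/asboolP.
  by exists (ex_minn ex); case: ex_minnP.
have p0 c : RS0 (p`_c / u ^+ c) by have [] := pR c; exact: RS0_div.
have r0 c : RS0 (r`_c / u ^+ c) by have [] := rR c; exact: RS0_div.
have small (f : nat -> K) c l : (forall d', `[< ~ q (f d') >] -> (c <= d')%N) ->
    (l < c)%N -> q (f l).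
  move=> fmin lc; apply: contrapT => ql; have /fmin := asboolT ql.
  by rewrite leqNgt lc.
have := prq (d + e)%N; rewrite coefM.
have dd : (d < (d + e).+1)%N by rewrite ltnS leq_addr.
rewrite (bigD1 (Ordinal dd)) //= addKn mulrDl exprD -mulf_div => qs.
have rest : q ((\sum_(j < (d + e).+1 | j != Ordinal dd)
    p`_j * r`_(d + e - j)) / (u ^+ d * u ^+ e)).
  rewrite mulr_suml; apply: big_ind => [||j jd]; [exact: pi_0 qP|exact: qD|].
  have -> : u ^+ d * u ^+ e = u ^+ j * u ^+ (d + e - j).
    by rewrite -!exprD subnKC // -ltnS.
  rewrite -mulf_div.
  have [lt|gt|eq] := ltngtP j d.
  - rewrite mulrC; apply: (pi_M qP) => //.
    exact: (small (fun c => p`_c / u ^+ c) d j dmin).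
  - apply: (pi_M qP) => //; apply: (small (fun c => r`_c / u ^+ c) e _ emin).
    by rewrite ltn_subLR ?ltn_add2r // -ltnS.
  - by case/eqP: jd; apply: val_inj.
have := pi_B qP qs rest; rewrite addrK => /(pi_prime qP) [] //.
Qed.

Definition contract : set K := A `&` extend q.

Lemma contract_hdeg d a : gpart sg A d a -> contract a <-> q (a / u ^+ d).
Proof.
move=> [Aa ha]; rewrite -(extend_hdeg (ARS Aa) ha); split; [by case|by []].
Qed.

Lemma A_RSpoly (p : {poly K}) : gpoly sg A p -> RSpoly p.
Proof. by move=> pA d; have [/ARS] := pA d. Qed.

Lemma extendD x y : extend q x -> extend q y -> extend q (x + y).
Proof.
move=> [s [sP ->]] [t [tP ->]]; exists (s ++ t); split; last by rewrite big_cat.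
by move=> c; rewrite mem_cat => /orP [/sP|/tP].
Qed.

Lemma extendM x y : RS x -> extend q y -> extend q (x * y).
Proof.
move=> Rx [s [sP ->]]; exists [seq (x * c.1, c.2) | c <- s]; split.
  by move=> _ /mapP [c /sP [Rc qc] ->]; split=> //; apply: (sa_M sRS).
by rewrite big_map mulr_sumr; apply: eq_bigr => c _; rewrite mulrA.
Qed.

Lemma contract_prime : prime_ideal A contract.
Proof.
split.
- by move=> a [].
- split; first exact: (sa_0 sA).
  by exists [::]; split=> //; rewrite big_nil.
- move=> a b [Aa xa] [Ab xb]; split; first exact: (sa_B sA).
  apply: extendD => //; rewrite -mulN1r; apply: extendM => //.
  by apply: (sa_N sRS); exact: (sa_1 sRS).
- move=> a b Aa [Ab xb]; split; first exact: (sa_M sA).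
  by apply: extendM => //; exact: ARS.
- have g1 : gpart sg A 0 1.
    by rewrite -(rmorph1 (@KV_const k V)); exact: gpart_k.
  by move=> /(contract_hdeg g1); rewrite expr0 divr1; exact: pi_1 qP.
- move=> a b Aa Ab [_ xab].
  have [p pA aE] := Adec Aa; have [r rA bE] := Adec Ab.
  have pR := A_RSpoly pA; have rR := A_RSpoly rA.
  have : qpoly (p * r).
    by apply/extendP; [exact: RSpolyM|rewrite hornerM -aE -bE].
  by case/(qpoly_prime pR rR) => [/(extendP pR)|/(extendP rR)];
    rewrite -?aE -?bE; [left|right].
Qed.

Lemma contract_proj : proj_prime G contract.
Proof.
split.
  move=> n c cA [_ xs] d dn.
  have pA e : gpart sg A e (\poly_(j < n) c j)`_e.
    by rewrite coef_poly; case: ifP => _; [exact: cA|exact: (gpart_0 sg sA)].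
  have /(extendP (A_RSpoly pA)) : extend q (\poly_(j < n) c j).[1].
    rewrite horner_poly (eq_bigr (fun j : 'I_n => c j)) // => j _.
    by rewrite expr1n mulr1.
  move=> /(_ d); rewrite coef_poly dn => qd.
  exact/(contract_hdeg (cA d)).
have gu : gpart sg A 1 u by split=> //; rewrite mulr1.
move=> /(_ 1%N isT u gu) /(contract_hdeg gu).
by rewrite expr1 divff //; exact: pi_1 qP.
Qed.

End Prime.

Notation X := (Spec (@RSV0_subalg k V)).
Notation Y := (Proj G).

Definition imm_pt (x : X) : Y :=
  ZPt (G := G) (contract_prime (zp_prime x)) (contract_proj (zp_prime x)).

Lemma imm_pt_mem (x : X) d a : gH G d a ->
  zp (imm_pt x) a <-> zp x (a / u ^+ d).
Proof. exact: (contract_hdeg (zp_prime x)). Qed.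

Lemma imm_pt_zD (x : X) d a : gH G d a -> zD a (imm_pt x) <-> zD (a / u ^+ d) x.
Proof. by move=> /(imm_pt_mem x) H; split=> n /H. Qed.

Lemma gH_RS0 d a : gH G d a -> RS0 (a / u ^+ d).
Proof. by case=> Aa ha; apply: RS0_div => //; exact: ARS. Qed.

Lemma imm_cont : continuous imm_pt.
Proof.
apply/continuousP => U oU; rewrite zopenE => x Ux.
have [d [f [fd fx fU]]] := oU _ Ux.
exists 0%N, (f / u ^+ d); split.
- exact: gH_RS0.
- exact/(imm_pt_zD x fd).
- by move=> y /(imm_pt_zD y fd) /fU.
Qed.

Section Sheaf.
Variable U : opens Y.
Notation dom W := {x | oset W x}.

Definition imm_dom (x : dom (opre imm_cont U)) : dom U :=
  exist _ (imm_pt (sval x)) (svalP x).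

Lemma imm_local (s : dom U -> K) : zlocal 0 s -> zlocal 0 (s \o imm_dom).
Proof.
move=> sl x; have [W [Wx [d [a [b [ad bd Ws]]]]]] := sl (imm_dom x).
rewrite addn0 in ad.
exists (opre imm_cont W); split=> //; exists 0%N, (a / u ^+ d), (b / u ^+ d).
split; [exact: gH_RS0|exact: gH_RS0|].
move=> y Wy; have [by_ sy] := Ws (imm_dom y) Wy; split.
  exact/(imm_pt_zD _ bd).
by rewrite /= sy div_un.
Qed.

Definition imm_sec (s : zsec (G := G) 0 U) :
    zsec (G := spec_gring (@RSV0_subalg k V)) (Q := setT) 0 (opre imm_cont U) :=
  ZSec (asboolT (imm_local (asboolW (zval_in s)))).

Lemma imm_nmod : Algebra.nmod_morphism imm_sec.
Proof. by split=> [|s t]; apply: zsec_ext. Qed.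
Lemma imm_monoid : GRing.monoid_morphism imm_sec.
Proof. by split=> [|s t]; apply: zsec_ext. Qed.

HB.instance Definition _ := GRing.isNmodMorphism.Build
  (zsec (G := G) 0 U) _ imm_sec imm_nmod.
HB.instance Definition _ := GRing.isMonoidMorphism.Build
  (zsec (G := G) 0 U) _ imm_sec imm_monoid.
End Sheaf.

Program Definition immersion : lhom X Y :=
  @LHom k X Y imm_pt imm_cont (fun U => @imm_sec U) _ _ _.
Next Obligation.
move=> U W h h' s; apply: zsec_ext => x /=; congr (zval s _); exact: dom_ext.
Qed.
Next Obligation. by move=> U a; apply: zsec_ext. Qed.
Next Obligation.
move=> x U s us.
have Ux : oset U (imm_pt x) by case: us => W [h [t [Wx _]]]; exact: h.
have [W [Wx [d [a [b [ad bd Ws]]]]]] :=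
  asboolW (zval_in (s : zsec _ _)) (exist _ (imm_pt x) Ux).
rewrite addn0 in ad; apply/(zunitP Ux ad bd Wx Ws)/(imm_pt_zD x ad).
apply/(@zunitP _ _ _ (spec_gring (@RSV0_subalg k V)) setT x (opre imm_cont U)
  Ux (imm_sec s) 0 (a / u ^+ d) (b / u ^+ d) (opre imm_cont W)) => //.
- exact: gH_RS0.
- exact: (gH_RS0 bd).
- move=> y Wy; have [by_ sy] := Ws (imm_dom y) Wy; split.
    exact/(imm_pt_zD _ bd).
  by rewrite /= sy div_un.
Qed.

End Immersion.

Section Inclusions.
Variables (k : fieldType) (V : nzvect k).

Definition v0 : V := vpick {: V}.

Lemma v0_neq0 : v0 != 0.
Proof. by rewrite vpick0 -dimv_eq0 -lt0n; exact: nzvP. Qed.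

Lemma SV_RSV : @SV k V `<=` @RSV k V.
Proof. by move=> a Sa; apply: sub_gen_alg; left. Qed.

Lemma RV_RSV : @RV k V `<=` @RSV k V.
Proof. by move=> a Ra; apply: sub_gen_alg; right. Qed.

Lemma SV_vec (v : V) : SV (vec v).
Proof. by exists (lin v). Qed.

Lemma RV_vec (v : V) : v != 0 -> RV (vec v)^-1.
Proof. by move=> ?; apply: sub_gen_alg; exists v. Qed.

Definition incP : lhom (OmegaV V) (PV V) :=
  immersion (sg := 1) (mulr1 1) (@SV_subalg k V) SV_RSV (SV_vec v0) (hdeg_vec v0)
    (vec_neq0 v0_neq0) (RV_RSV (RV_vec v0_neq0)) (@SV_dec k V).

Lemma RSV_vecVV : RSV (vec v0)^-1^-1.
Proof. by rewrite invrK; apply: SV_RSV; exact: SV_vec. Qed.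

Definition incQ : lhom (OmegaV V) (QV V) :=
  immersion (sg := -1) (mulrNN 1 1) (@RV_subalg k V) RV_RSV (RV_vec v0_neq0)
    (hdeg_V (hdeg_vec v0)) (invr_neq0 (vec_neq0 v0_neq0)) RSV_vecVV (@RV_dec k V).

End Inclusions.

Section ConstSection.
Variables (k K : fieldType) (i : {rmorphism k -> K}) (G : gring i).
Variables (Q : set (set K)) (m : nat) (a : K) (ha : gH G m a).

Lemma zlocal_hom (U : opens (zpt G Q)) :
  zlocal m (fun _ : {x | oset U x} => a).
Proof.
move=> x; exists (otop _); split=> //; exists 0%N, a, 1; split=> //.
- exact: gH_1.
- move=> y _; split; last by rewrite divr1.
  exact: pi_1 (zp_prime (sval y)).
Qed.

Definition hom_section : msec (twist G Q m) (otop _) :=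
  ZSec (asboolT (@zlocal_hom (otop _))).
End ConstSection.

(* The universal pairs (O(1), v |-> v) on P and (O(1), v |-> 1/v) on Q. *)
Section Universal.
Variables (k : fieldType) (V : vectType k).

Lemma univP_deg (v : V) : gH (Sgr V) 1 (vec v).
Proof. by split; [exists (lin v)|rewrite mulr1; exact: hdeg_vec]. Qed.

Lemma univQ_deg (v : V) : gH (Rgr V) 1 (vec v)^-1.
Proof.
split; last by rewrite mulr1; apply: hdeg_V; exact: hdeg_vec.
have [->|v0] := eqVneq v 0; last by apply: sub_gen_alg; exists v.
rewrite /vec /lin big1 ?tofrac0 ?invr0 => [|j _]; first exact: (sa_0 (RV_subalg V)).
by rewrite linear0 scale0r.
Qed.

Definition O1P : omod (PV V) := twist (Sgr V) (proj_prime (Sgr V)) 1.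
Definition O1Q : omod (QV V) := twist (Rgr V) (proj_prime (Rgr V)) 1.

Definition univP (v : V) : msec O1P (otop _) :=
  hom_section (proj_prime (Sgr V)) (univP_deg v).
Definition univQ (v : V) : msec O1Q (otop _) :=
  hom_section (proj_prime (Rgr V)) (univQ_deg v).
End Universal.

Section Moduli.
Variables (k : finFieldType).
Notation "'Gamma' L" := (msec L (otop _)) (at level 10).

(* The isomorphism class of (L, lam) is the S-valued point x of the moduli
   functor represented by P_V, i.e. the pullback of the universal pair; and
   likewise for (L, rho) and Q_V. *)
Definition pointP (V : vectType k) (S : lrs k) (L : omod S)
    (x : lhom S (PV V)) (lam : V -> Gamma L) : Prop :=
  is_pullback x (M := O1P V) setT (@univP k V) lam.

Definition pointQ (V : vectType k) (S : lrs k) (L : omod S)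
    (x : lhom S (QV V)) (rho : V -> Gamma L) : Prop :=
  is_pullback x (M := O1Q V) [set v | v != 0] (@univQ k V) rho.

Lemma dual_gt0 (V : nzvect k) : (0 < \dim {: 'Hom(V, k^o)})%N.
Proof. by rewrite dimvf /dim /= muln1 -dimvf; exact: nzvP. Qed.

Definition dual (V : nzvect k) : nzvect k := NZVect (@dual_gt0 V).

Lemma sub_gt0 (V : vectType k) (V' : {vspace V}) : V' != 0%VS ->
  (0 < \dim {: subvs_of V'})%N.
Proof. by move=> V'0; rewrite dimvf /dim /= lt0n dimv_eq0. Qed.

Definition sub_nzvect (V : vectType k) (V' : {vspace V}) (hV' : V' != 0%VS) :
  nzvect k := NZVect (sub_gt0 hV').

Definition g_map (V : nzvect k) (S : lrs k) (L : omod S) (rho : V -> Gamma L)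
    (l : dual V) : Gamma L :=
  \sum_(v : finvect_type V | (v != 0) && ((l : 'Hom(V, k^o)) v == 1)) rho v.

(* The exponent q^(r-1) is the number of l in V^* with <l, v> = 1. *)
Definition f_exp (V : vectType k) : nat := (#|k| ^ (\dim {: V}).-1)%N.

Definition f_index (V : nzvect k) (v : V) : seq (dual V) :=
  enum [pred l : finvect_type (dual V) | (l : 'Hom(V, k^o)) v == 1].

Definition f_map (V : nzvect k) (S : lrs k) (L M : omod S)
    (mu : forall U : opens S, ('I_(f_exp V) -> msec L U) -> msec M U)
    (lam : dual V -> Gamma L) (v : V) : Gamma M :=
  mu _ (fun j => lam (nth 0 (f_index v) j)).

(* is_gV, is_fV, ... characterize the morphisms by their effect on S-valued
   points, for all schemes S over k.  Each of them determines at most one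
   morphism, since the identity of the source is such a point. *)
Definition is_gV (V : nzvect k) (g : lhom (QV V) (PV (dual V))) : Prop :=
  forall (S : lrs k) (L : omod S) (rho : V -> Gamma L) (x : lhom S (QV V)),
    is_scheme S -> invertible L ->
    reciprocal_map rho -> rec_fiberwise_nonzero rho ->
    pointQ x rho -> pointP (lcomp g x) (g_map rho).

Definition is_fV (V : nzvect k) (f : lhom (PV (dual V)) (QV V)) : Prop :=
  forall (S : lrs k) (L M : omod S) mu (lam : dual V -> Gamma L)
    (x : lhom S (PV (dual V))),
    is_scheme S -> invertible L -> @tensor_power k S (f_exp V) L M mu ->
    linear_map lam -> lin_fiberwise_nonzero lam ->
    pointP x lam -> pointQ (lcomp f x) (f_map mu lam).

Definition is_gOmega (V : nzvect k) (g : lhom (OmegaV V) (OmegaV (dual V))) :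
    Prop :=
  forall (S : lrs k) (L : omod S) (rho : V -> Gamma L)
    (x : lhom S (OmegaV V)),
    is_scheme S -> invertible L ->
    reciprocal_map rho -> rec_fiberwise_invertible rho ->
    pointQ (lcomp (incQ V) x) rho ->
    pointP (lcomp (incP (dual V)) (lcomp g x)) (g_map rho).

Definition is_fOmega (V : nzvect k) (f : lhom (OmegaV (dual V)) (OmegaV V)) :
    Prop :=
  forall (S : lrs k) (L M : omod S) mu (lam : dual V -> Gamma L)
    (x : lhom S (OmegaV (dual V))),
    is_scheme S -> invertible L -> @tensor_power k S (f_exp V) L M mu ->
    linear_map lam -> lin_fiberwise_injective lam ->
    pointP (lcomp (incP (dual V)) x) lam ->
    pointQ (lcomp (incQ V) (lcomp f x)) (f_map mu lam).

Section Sub.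
Variables (V : nzvect k) (V' : {vspace V}) (hV' : V' != 0%VS).
Notation W := (sub_nzvect hV').

Definition extend0 (S : lrs k) (L : omod S) (rho : W -> Gamma L) (v : V) :
    Gamma L :=
  if v \in V' then rho (vsproj V' v) else 0.

Definition dual_proj (l : dual V) : dual W :=
  ((l : 'Hom(V, k^o)) \o linfun (@vsval k V V'))%VF.

Definition is_istar (i_ : lhom (QV W) (QV V)) : Prop :=
  forall (S : lrs k) (L : omod S) (rho : W -> Gamma L) (x : lhom S (QV W)),
    is_scheme S -> invertible L ->
    reciprocal_map rho -> rec_fiberwise_nonzero rho ->
    pointQ x rho -> pointQ (lcomp i_ x) (extend0 rho).

Definition is_pistar (pi_ : lhom (PV (dual W)) (PV (dual V))) : Prop :=
  forall (S : lrs k) (L : omod S) (lam : dual W -> Gamma L)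
    (x : lhom S (PV (dual W))),
    is_scheme S -> invertible L ->
    linear_map lam -> lin_fiberwise_nonzero lam ->
    pointP x lam -> pointP (lcomp pi_ x) (lam \o dual_proj).
End Sub.

End Moduli.

(* Main.v *)
Require Import Defs.
From HB Require Import structures.
From mathcomp Require Import all_boot all_order all_fingroup all_solvable.
From mathcomp Require Import all_algebra all_field.
From mathcomp Require Import boolp classical_sets functions topology_structure.
From mathcomp Require Import mpoly ring.

Set Implicit Arguments.
Unset Strict Implicit.
Unset Printing Implicit Defensive.

Import GRing.Theory FinRing.Theory.
Local Open Scope classical_set_scope.
Local Open Scope ring_scope.

(** All morphisms in the diagram are known through their effect on pairs, so each
    square is checked on one pair: the universal one on the source.  There O(1)
    is an invertible sheaf on a scheme, its universal sections are v or 1/v, and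
    both ways around a square yield a pair formed from them.  If the two pairs
    have the same sections, then the two morphisms agree, because a morphism
    to P or Q is determined by the pullback of the universal pair
    (pullback_inj).  What remains are identities between sections, that is,
    between elements of the function field K_V.

    Geometry.  P and Q are Proj of a graded algebra generated by its elements
    t_j of degree 1, inside a field.  Sections of O(m) are functions with values
    in this field, so the stalk of O(m) at x consists of fractions (zfrac), and
    a section generates O(m) if and only if it does so in every stalk.  The sets
    D(t_j) are affine (chart_affine): the ring of functions on D(t_j) is the
    degree 0 part of A[1/t_j], since the denominators of a function that is
    everywhere locally a fraction are not all contained in one prime ideal
    (chart_frac), and every prime ideal of this ring lifts to a homogeneous one
    (proj_lift).

    Algebra.  The pairs are only admissible after one has shown that g_V maps
    reciprocal maps to linear maps, that f_V maps linear maps to reciprocal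
    maps, and that neither creates common zeros; for the universal pairs:
    - g_V(rho)(l) is minus the sum of l(v) rho(v) over all non-zero v
      (sum_level1), which is linear in l.  It does not vanish at x for all l,
      because contracting it with a basis of the subspace of all v with
      rho(v) <> 0 at x gives a sum of q^d - 1 ones (g_univ_fiberwise).
    - The polynomial that takes the value l(v) at every l in V^* and has degree
      q^(r-1) has leading coefficient 1/f_V(v).  It is unique, hence linear in v,
      so 1/f_V is additive (f_univ_invD), and f_V is reciprocal.

    The lower squares then amount to this.  For g, the sum over v in V of the
    extension by zero is a sum over V' (g_map_extend0).  For f, the product of
    the restrictions to V' of all l with l(v) = 1 is zero if v is outside of V',
    because some such l vanishes on V'; and otherwise each l' on V' with
    l'(v) = 1 is the restriction of q^r'' such l, which accounts for the
    Frobenius (prod_dual_proj).  The upper squares compare two morphisms on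
    Omega whose effects on pairs are given by the same formula. *)

(** * Stalks of the twisting sheaves *)

Section Stalks.
Variables (k K : fieldType) (i : {rmorphism k -> K}) (G : gring i).
Variable Q : set (set K).
Notation T := (zpt G Q).
Notation dom U := {x : T | oset U x}.

Lemma zD_open d f : gH G d f -> open (zD f : set T).
Proof. by move=> fd; rewrite zopenE => x fx; exists d, f; split. Qed.

Definition zDo d f (fd : gH G d f) : opens T := Opens (zD_open fd).

(** The fractions in K that make up the stalk of O(m) at x, its generators,
    and its elements that vanish in the fibre. *)
Definition zfrac m (x : T) (c : K) := exists d a b,
  [/\ gH G (d + m) a, gH G d b, zD b x & c = a / b].
Definition zgenr m (x : T) (c : K) := exists d a b,
  [/\ gH G (d + m) a, gH G d b, zD b x, zD a x & c = a / b].
Definition zvan m (x : T) (c : K) := exists d a b,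
  [/\ gH G (d + m) a, gH G d b, zD b x, zp x a & c = a / b].

Lemma pi_D A (p : set K) a b : @prime_ideal K A p -> p a -> p b -> p (a + b).
Proof.
move=> pP pa pb; rewrite -[b]opprK; apply: (pi_B pP) => //.
by rewrite -sub0r; apply: (pi_B pP) => //; apply: (pi_0 pP).
Qed.

Lemma gH_D d a b : gH G d a -> gH G d b -> gH G d (a + b).
Proof.
move=> ha hb; rewrite -[b]opprK; apply: gH_B => //.
by rewrite -sub0r; apply: gH_B => //; apply: gH_0.
Qed.

Lemma gH_X d a n : gH G d a -> gH G (n * d) (a ^+ n).
Proof.
move=> ha; elim: n => [|n IH]; first exact: gH_1.
by rewrite mulSn exprS; apply: gH_M.
Qed.

Lemma gH_X1 a n : gH G 1 a -> gH G n (a ^+ n).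
Proof. by move=> /(gH_X n); rewrite muln1. Qed.

Lemma zD1 x : zD (G := G) (Q := Q) 1 x.
Proof. exact: pi_1 (zp_prime x). Qed.

Lemma zDX (x : T) d a n : gH G d a -> zD a x -> zD (a ^+ n) x.
Proof.
move=> ad ax; elim: n => [|n IH]; first exact: zD1.
by rewrite exprS; apply: zDM ad (gH_X n ad) ax IH.
Qed.

Lemma zvan_num m (x : T) d a b : gH G (d + m) a -> gH G d b -> zD b x ->
  zvan m x (a / b) -> zp x a.
Proof.
move=> ad bd bx [e [a' [b' [ae be bx' ax' E]]]].
apply: contrapT => ax; have := zDM ad be ax bx'; apply.
move/eqP: E; rewrite eqr_div ?(zD_neq0 bx) ?(zD_neq0 bx') // => /eqP ->.
by rewrite mulrC; apply: (pi_M (zp_prime x)) => //; exact: gH_A bd.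
Qed.

Lemma zgenr_num m (x : T) d a b : gH G (d + m) a -> gH G d b -> zD b x ->
  zgenr m x (a / b) -> zD a x.
Proof.
move=> ad bd bx [e [a' [b' [ae be bx' ax' E]]]].
have := zDM ae bd ax' bx.
move/eqP: E; rewrite eqr_div ?(zD_neq0 bx) ?(zD_neq0 bx') // => /eqP <-.
exact: zDMl ad be.
Qed.

Lemma zvanM n (x : T) c c' : zvan 0 x c -> zfrac n x c' -> zvan n x (c * c').
Proof.
move=> [d [a [b [ad bd bx ax ->]]]] [e [a' [b' [ae be bx' ->]]]].
exists (d + e)%N, (a * a'), (b * b'); rewrite mulf_div; split=> //.
- by rewrite addn0 in ad; rewrite -addnA; apply: gH_M.
- exact: gH_M.
- exact: zDM bd be bx bx'.
- by rewrite mulrC; apply: (pi_M (zp_prime x)) => //; exact: gH_A ae.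
Qed.

Lemma zvanD m (x : T) c c' : zvan m x c -> zvan m x c' -> zvan m x (c + c').
Proof.
move=> [d [a [b [ad bd bx ax ->]]]] [e [a' [b' [ae be bx' ax' ->]]]].
rewrite addf_div ?(zD_neq0 bx) ?(zD_neq0 bx') //.
exists (d + e)%N, (a * b' + a' * b), (b * b'); split=> //.
- apply: gH_D; first by rewrite addnAC; apply: gH_M.
  by rewrite -addnA mulrC; apply: gH_M.
- exact: gH_M.
- exact: zDM bd be bx bx'.
- apply: (pi_D (zp_prime x)); rewrite mulrC; apply: (pi_M (zp_prime x)) => //.
    exact: gH_A be.
  exact: gH_A bd.
Qed.

Lemma zvan0 m (x : T) : zvan m x 0.
Proof.
exists 0%N, 0, 1; split; rewrite ?mul0r //; [exact: gH_0|exact: gH_1|exact: zD1|].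
exact: pi_0 (zp_prime x).
Qed.

Lemma zgenrM m n (x : T) c c' : zgenr m x c -> zgenr n x c' ->
  zgenr (m + n) x (c * c').
Proof.
move=> [d [a [b [ad bd bx ax ->]]]] [e [a' [b' [ae be bx' ax' ->]]]].
exists (d + e)%N, (a * a'), (b * b'); rewrite mulf_div; split=> //.
- by rewrite addnACA; apply: gH_M.
- exact: gH_M.
- exact: zDM bd be bx bx'.
- exact: zDM ad ae ax ax'.
Qed.

Lemma zgenr1 (x : T) : zgenr 0 x 1.
Proof.
exists 0%N, 1, 1; rewrite divr1; split=> //; try exact: gH_1; exact: zD1.
Qed.

Lemma zgenrX m (x : T) c n : zgenr m x c -> zgenr (n * m) x (c ^+ n).
Proof.
move=> gc; elim: n => [|n IH]; first exact: zgenr1.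
by rewrite mulSn exprS; apply: zgenrM.
Qed.

Lemma zgenr_neq0 m (x : T) c : zgenr m x c -> c != 0.
Proof.
move=> [d [a [b [_ _ bx ax ->]]]].
by rewrite mulf_neq0 ?invr_neq0 ?(zD_neq0 ax) ?(zD_neq0 bx).
Qed.

Lemma zgenr_frac m (x : T) c : zgenr m x c -> zfrac m x c.
Proof. by move=> [d [a [b [? ? ? ? ->]]]]; exists d, a, b. Qed.

Lemma zgenr_hom m (x : T) a : gH G m a -> zD a x -> zgenr m x a.
Proof.
by move=> am ax; exists 0%N, a, 1; rewrite divr1; split=> //;
  [exact: gH_1|exact: zD1].
Qed.

Lemma zgenr_Nvan m (x : T) c : zgenr m x c -> ~ zvan m x c.
Proof. by move=> [d [a [b [ad bd bx ax ->]]]] /(zvan_num ad bd bx). Qed.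

Lemma zfracP m (x : T) c : zfrac m x c -> zgenr m x c \/ zvan m x c.
Proof.
move=> [d [a [b [ad bd bx ->]]]].
by case: (pselect (zp x a)) => ax; [right|left]; exists d, a, b.
Qed.

Section Sections.
Variables (m : nat) (U : opens T).
Implicit Types s : zsec m U.

Lemma zval_frac s (x : dom U) : zfrac m (sval x) (s x).
Proof.
have [Z [Zx [d [a [b [ad bd Zs]]]]]] := asboolW (zval_in s) x.
by have [bx sx] := Zs x Zx; exists d, a, b.
Qed.

Lemma zlocal_cst c : (forall x, oset U x -> zfrac m x c) ->
  zlocal m (fun _ : dom U => c).
Proof.
move=> fc x; have [d [a [b [ad bd bx ->]]]] := fc _ (svalP x).
by exists (zDo bd); split=> //; exists d, a, b; split.
Qed.

Definition zcst c fc : zsec m U := ZSec (asboolT (@zlocal_cst c fc)).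

Lemma zval_sum I (r : seq I) (P : pred I) (F : I -> zsec m U) x :
  (\sum_(j <- r | P j) F j) x = \sum_(j <- r | P j) F j x.
Proof. by elim/big_rec2: _ => // j y1 y2 _ <-. Qed.

End Sections.

Lemma zunit_genr (U : opens T) (s : zsec 0 U) (x : dom U) :
  @unit_at k (zrspace G Q) (sval x) U s <-> zgenr 0 (sval x) (s x).
Proof.
have [Z [Zx [d [a [b [ad bd Zs]]]]]] := asboolW (zval_in s) x.
have [bx sx] := Zs x Zx; have ad' := ad; rewrite addn0 in ad'.
rewrite (zunitP (svalP x) ad' bd Zx Zs) sx; split=> [ax|].
  by exists d, a, b.
exact: (zgenr_num ad bd bx).
Qed.

Lemma zero_at_van m U (s : zsec m U) (x : dom U) :
  @zero_at k (zspace G Q) (twist G Q m) (sval x) U s -> zvan m (sval x) (s x).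
Proof.
move=> [W [h [n [a [t [Wx aN E]]]]]].
have /zsec_app/(_ (exist _ (sval x) Wx)) := E.
rewrite zval_sum /= (_ : zsub h _ = x); last exact: dom_ext.
move=> ->; apply: big_ind => [||j _]; [exact: zvan0|exact: zvanD|].
apply: (@zvanM _ _ (a j (exist _ _ Wx)) (t j (exist _ _ Wx))).
  2: exact: (zval_frac (t j) (exist _ _ Wx)).
have [ga|//] := zfracP (zval_frac (a j) (exist _ _ Wx)).
by case: (aN j); apply/(@zunit_genr W (a j) (exist _ _ Wx)).
Qed.

(** Near x the divisor e is a constant fraction a'/b' with a' outside of x, so
    that s / e is a constant fraction near x as well. *)
Lemma zlocal_div m U (s e : dom U -> K) : zlocal m s -> zlocal m e ->
  (forall x, zgenr m (sval x) (e x)) -> zlocal 0 (fun x => s x / e x).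
Proof.
move=> sl el eg x.
have [W [Wx [d [a [b [ad bd Ws]]]]]] := sl x.
have [Z [Zx [d' [a' [b' [ad' bd' Ze]]]]]] := el x.
have [bx sx] := Ws x Wx; have [bx' ex] := Ze x Zx.
have ax' : zD a' (sval x) by apply: (zgenr_num ad' bd' bx'); rewrite -ex; apply: eg.
exists (ocap (ocap W Z) (zDo ad')); split=> //.
exists (d + d' + m)%N, (a * b'), (b * a'); split.
- by rewrite addn0 addnAC; apply: gH_M.
- by rewrite -addnA; apply: gH_M.
- move=> y [[/Ws [by_ ->] /Ze [b'y ->]] a'y]; split; first exact: zDM bd ad' by_ a'y.
  by rewrite invf_div mulf_div.
Qed.

Lemma zgenr_generates m U (e : zsec m U) :
  (forall x : dom U, zgenr m (sval x) (e x)) ->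
  @generates k (zspace G Q) (twist G Q m) U e.
Proof.
move=> eg W h s.
have el : zlocal m (e \o zsub h) by exact: zlocal_res (asboolW (zval_in e)).
have eg' x : zgenr m (sval x) (e (zsub h x)) by apply: (eg (zsub h x)).
exists (ZSec (asboolT (zlocal_div (asboolW (zval_in s)) el eg'))); split.
  apply: zsec_ext => x; rewrite [RHS]zvalZ /=.
  by rewrite divfK // (zgenr_neq0 (eg' x)).
move=> t st; apply: zsec_ext => x /=; rewrite st [X in X / _]zvalZ /=.
by rewrite mulfK // (zgenr_neq0 (eg' x)).
Qed.

Hypothesis deg1 : forall x : T, exists2 t, gH G 1 t & zD t x.

(** Choose t of degree 1 outside of x.  The generator t^m of the stalk is a
    multiple of e x, which therefore cannot vanish in the fibre. *)
Lemma generates_zgenr m U (e : zsec m U) (x : dom U) :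
  @generates k (zspace G Q) (twist G Q m) U e -> zgenr m (sval x) (e x).
Proof.
move=> ge; have [t t1 tx] := deg1 (sval x).
have tm := gH_X1 m t1.
pose W := ocap U (zDo t1); have h : W `<=` U by move=> y [].
have Wx : oset W (sval x) by split=> //; apply: svalP.
have tf y : oset W y -> zfrac m y (t ^+ m).
  by move=> [_ ty]; apply/zgenr_frac/zgenr_hom => //; apply: zDX t1 ty.
have [c [/zsec_app/(_ (exist _ _ Wx)) ce _]] := ge W h (zcst tf).
rewrite zvalZ /= (_ : zsub h _ = x) in ce; last exact: dom_ext.
have [d [a [b [ad bd bx cE]]]] := zval_frac c (exist _ _ Wx).
have [//|ev] := zfracP (zval_frac e x).
have : zgenr m (sval x) (t ^+ m) by apply: zgenr_hom => //; apply: zDX t1 tx.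
move/zgenr_Nvan; case; rewrite ce mulrC.
have [d' [a' [b' [ad' bd' bx' ax' ->]]]] := ev.
rewrite cE mulf_div addn0 in ad *.
exists (d' + d)%N, (a' * a), (b' * b); split=> //.
- by rewrite addnAC; apply: gH_M.
- exact: gH_M.
- exact: zDM bd' bd bx' bx.
- by rewrite mulrC; apply: (pi_M (zp_prime (sval x))) => //; exact: gH_A ad.
Qed.

Lemma twist_invertible m : @invertible k (zspace G Q) (twist G Q m).
Proof.
move=> x; have [t t1 tx] := deg1 x.
have tg y : oset (zDo t1) y -> zgenr m y (t ^+ m).
  by move=> ty; apply: zgenr_hom; [exact: gH_X1|apply: zDX t1 ty].
exists (zDo t1), (zcst (fun y ty => zgenr_frac (tg y ty))); split=> //.
by apply: zgenr_generates => y; apply: tg; apply: svalP.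
Qed.

Lemma zlocal_prod m U N (f : 'I_N -> dom U -> K) :
  (forall j, zlocal m (f j)) -> zlocal (N * m) (fun x => \prod_j f j x).
Proof.
elim: N f => [|N IH] f fl.
  have -> : (fun x => \prod_j f j x) = fun=> 1.
    by apply/funext => x; rewrite big_ord0.
  exact: zlocal1.
have -> : (fun x => \prod_j f j x) =
    fun x => f ord0 x * \prod_j f (lift ord0 j) x.
  by apply/funext => x; rewrite big_ord_recl.
by rewrite mulSn; apply: zlocalM => //; apply: IH.
Qed.

(** The target degree is any m' equal to N * m, so that products of different
    shapes can have values in the same sheaf. *)
Section Product.
Variables (m m' N : nat) (Nm : m' = (N * m)%N).

Lemma zprod_local (U : opens T) (f : 'I_N -> zsec m U) : zlocal m' (fun x => \prod_j f j x).
Proof. by rewrite Nm; apply: zlocal_prod => j; exact: asboolW (zval_in (f j)). Qed.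

Definition zprod (U : opens T) (f : 'I_N -> zsec m U) : zsec m' U :=
  ZSec (asboolT (zprod_local f)).

Lemma zprod_tensor :
  @tensor_power k (zspace G Q) N (twist G Q m) (twist G Q m') zprod.
Proof.
split=> [U j f a s t|U W h f|U e ge].
- have E (v : zsec m U) x : zprod (fun l => if l == j then v else f l) x =
      v x * \prod_(l < N | l != j) f l x.
    rewrite [LHS](bigD1 j) //= eqxx; congr (_ * _).
    by apply: eq_bigr => l /negbTE ->.
  by apply: zsec_ext => x; rewrite [LHS]E [LHS]mulrDl -mulrA -!E.
- exact: zsec_ext.
- apply: zgenr_generates => x /=; rewrite prodr_const card_ord Nm.
  exact/zgenrX/generates_zgenr.
Qed.

End Product.
End Stalks.

(** * Affine charts *)

Section PrimeAvoiding.
Variables (K : fieldType) (B I : set K) (b : K).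
Hypotheses (B1 : B 1) (BB : forall x y, B x -> B y -> B (x - y))
  (BM : forall x y, B x -> B y -> B (x * y)) (Bb : B b).

Let avoiding (J : set K) := [/\ J `<=` B, J 0,
  forall x y, J x -> J y -> J (x - y), forall x y, B x -> J y -> J (x * y) &
  forall n, ~ J (b ^+ n)].

(** An ideal of B maximal among those that contain I and no power of b is
    prime. *)
Lemma prime_avoiding : avoiding I ->
  exists q, [/\ prime_ideal B q, I `<=` q & ~ q b].
Proof.
move=> avI; have [IB I0 IS IM Ib] := avI.
have [q [[qB q0 qS qM qb] Iq qmax]] : exists q, [/\ avoiding q, I `<=` q &
    forall J, avoiding J -> q `<=` J -> J `<=` q].
  have [F Fsub Ftot|S [avS Smax]] := @Zorn_bigcup _ [set S | avoiding (I `|` S)].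
    2: {
    exists (I `|` S); split; [exact: avS|by move=> x; left|].
    move=> J avJ SJ x Jx; apply: contrapT => Sx; apply: (Smax J).
      split; first by move=> y Sy; apply: SJ; right.
      by move=> /(_ x Jx) Sx'; apply: Sx; right.
    rewrite /= (_ : I `|` J = J) //; apply: setUidr => y Iy; by apply: SJ; left. }
  set U := \bigcup_(X in F) X.
  (* Any two elements of the union lie in a single member of the chain. *)
  have common x y : (I `|` U) x -> (I `|` U) y ->
      exists J, [/\ avoiding J, J `<=` I `|` U, J x & J y].
    have FU X : F X -> I `|` X `<=` I `|` U.
      by move=> FX z [Iz|Xz]; [left|right; exists X].
    move=> [Ix|[X FX Xx]] [Iy|[Y FY Yy]].
    - by exists I; split=> // z; left.
    - by exists (I `|` Y); split; [exact: Fsub|exact: FU|left|right].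
    - by exists (I `|` X); split; [exact: Fsub|exact: FU|right|left].
    - have [XY|YX] := Ftot _ _ FX FY.
      + by exists (I `|` Y); split; [exact: Fsub|exact: FU|right; apply: XY|right].
      + by exists (I `|` X); split; [exact: Fsub|exact: FU|right|right; apply: YX].
  split; [|by left| | |].
  - by move=> x Jx; have [J [[JB _ _ _ _] _ Jx' _]] := common x x Jx Jx; exact: JB.
  - move=> x y Ix Iy; have [J [[_ _ JS _ _] JU Jx Jy]] := common x y Ix Iy.
    by apply: JU; apply: JS.
  - move=> x y Bx Iy; have [J [[_ _ _ JM _] JU Jy _]] := common y y Iy Iy.
    by apply: JU; apply: JM.
  - move=> n Jn; have [J [[_ _ _ _ Jb] _ Jn' _]] := common _ _ Jn Jn.
    exact: Jb Jn'.
have qN x : q x -> q (- x) by move=> qx; rewrite -sub0r; apply: qS.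
have qD x y : q x -> q y -> q (x + y).
  by move=> qx qy; rewrite -[y]opprK; apply: qS => //; apply: qN.
(* By maximality, adding a new element a to q produces a power of b. *)
have grow a : B a -> ~ q a -> exists n x r, [/\ q x, B r & b ^+ n = x + r * a].
  move=> Ba qa; pose J := [set z | exists x r, [/\ q x, B r & z = x + r * a]].
  have qJ : q `<=` J.
    move=> x qx; exists x, 0; split=> //; last by rewrite mul0r addr0.
    by rewrite -(subrr 1); apply: BB.
  apply: contrapT => noJ; apply: qa; apply: (qmax J) => //; last first.
    by exists 0, 1; split=> //; rewrite mul1r add0r.
  split.
  - move=> _ [x [r [qx Br ->]]]; rewrite -[r * a]opprK; apply: (BB (qB _ qx)).
    have B0 : B 0 by exact: qB.
    by rewrite -sub0r; apply: BB => //; apply: BM.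
  - exact: qJ.
  - move=> _ _ [x [r [qx Br ->]]] [y [s [qy Bs ->]]].
    exists (x - y), (r - s); split; [exact: qS|exact: BB|].
    by rewrite mulrBl opprD addrACA.
  - move=> c _ Bc [x [r [qx Br ->]]].
    by exists (c * x), (c * r); split; [exact: qM|exact: BM|rewrite mulrDr mulrA].
  - by move=> n [x [r [qx Br E]]]; apply: noJ; exists n, x, r.
exists q; split=> //; last by have := qb 1%N.
split=> //.
  exact: qb 0%N.
move=> a c Ba Bc qac; apply: contrapT => /not_orP [qa qc].
have [n [x [r [qx Br nE]]]] := grow a Ba qa.
have [m [y [s [qy Bs mE]]]] := grow c Bc qc.
apply: (qb (n + m)%N); rewrite exprD nE mE mulrDl; apply: (qD).
  rewrite mulrC; apply: qM => //; rewrite -mE.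
  by elim: (m) => [//|l IH]; rewrite exprS; apply: BM.
rewrite mulrDr; apply: qD; first by apply: qM => //; apply: BM.
by rewrite mulrACA; apply: qM => //; apply: BM.
Qed.

End PrimeAvoiding.

Section Chart.
Variables (k K : fieldType) (i : {rmorphism k -> K}) (G : gring i).
Variables (Q : set (set K)) (u : K) (u1 : gH G 1 u) (u0 : u != 0).
Notation T := (zpt G Q).
Notation dom U := {x : T | oset U x}.
Let U : opens T := zDo Q u1.

(** The degree 0 part of the localization of the graded ring at u. *)
Definition chart : set K := [set c | exists d a, gH G d a /\ c = a / u ^+ d].

(** These two hypotheses identify D(u) with the prime spectrum of the chart. *)
Hypothesis lift : forall q, prime_ideal chart q -> exists2 x : T, zD u x &
  forall d a, gH G d a -> zp x a <-> q (a / u ^+ d).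
Hypothesis inj : forall x y : T, zD u x -> zD u y ->
  (forall d a, gH G d a -> zp x a <-> zp y a) -> x = y.

Lemma chart1 : chart 1.
Proof. by exists 0%N, 1; split; [exact: gH_1|rewrite divr1]. Qed.

Lemma chartB c c' : chart c -> chart c' -> chart (c - c').
Proof.
move=> [d [a [ad ->]]] [e [b [be ->]]].
exists (d + e)%N, (a * u ^+ e - b * u ^+ d); split.
  apply: gH_B; first by apply: gH_M => //; exact: gH_X1.
  by rewrite addnC; apply: gH_M => //; exact: gH_X1.
by rewrite -!mulNr addf_div ?expf_neq0 // exprD mulNr.
Qed.

Lemma chartM c c' : chart c -> chart c' -> chart (c * c').
Proof.
move=> [d [a [ad ->]]] [e [b [be ->]]]; exists (d + e)%N, (a * b).
by split; [exact: gH_M|rewrite mulf_div exprD].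
Qed.

Lemma chart0 : chart 0.
Proof. by rewrite -(subrr 1); apply: chartB chart1 chart1. Qed.

Lemma chart_prime0 : prime_ideal chart [set 0].
Proof.
split=> //.
- by move=> _ ->; exact: chart0.
- by move=> _ _ -> ->; rewrite /= subrr.
- by move=> a _ _ ->; rewrite /= mulr0.
- by move=> /eqP; rewrite oner_eq0.
- by move=> a b _ _ /eqP; rewrite mulf_eq0 => /orP [] /eqP; [left|right].
Qed.

(** The zero ideal gives a generic point, which lies in every non-empty open
    set; so a section, being locally constant as a function with values in K,
    is constant. *)
Lemma zsec_const (W : opens T) (x0 : T) (s : zsec 0 W) : oset W x0 ->
  exists2 c, (forall x, s x = c) & forall x, oset W x -> zfrac 0 x c.
Proof.
move=> Wx0; have [eta _ etaP] := lift chart_prime0.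
have etaD d f : gH G d f -> f != 0 -> zD f eta.
  move=> fd f0 /(etaP _ _ fd) /eqP.
  by rewrite mulf_eq0 invr_eq0 (negbTE f0) (negbTE (expf_neq0 _ u0)).
have eta_in (Z : opens T) x : oset Z x -> oset Z eta.
  move=> Zx; have := oset_open Z; rewrite zopenE => /(_ x Zx).
  move=> [d [f [fd fx]]]; apply; apply: etaD fd (zD_neq0 fx).
have We := eta_in W _ Wx0.
have sE x : s x = s (exist _ eta We).
  have [Z [Zx [d [a [b [_ _ Zs]]]]]] := asboolW (zval_in s) x.
  have [_ ->] := Zs x Zx.
  by have [_ ->] := Zs (exist _ eta We) (eta_in Z _ Zx).
exists (s (exist _ eta We)) => // x Wx.
by rewrite -(sE (exist _ x Wx)); apply: (zval_frac s (exist _ x Wx)).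
Qed.

(** The denominators of c form an ideal of the chart; if no power of b were
    among them then a prime of the chart would avoid b and contain them all,
    although c is a fraction at the corresponding point. *)
Lemma chart_frac (d : nat) (a c : K) : gH G d a ->
  (forall x : T, zD u x -> zD a x -> zfrac 0 x c) ->
  exists n, chart (c * (a / u ^+ d) ^+ n).
Proof.
move=> ad fc; set b := a / u ^+ d; have cb : chart b by exists d, a.
apply: contrapT => nb.
have [|q [qP Iq qb]] := @prime_avoiding K chart
    [set e | chart e /\ chart (c * e)] b chart1 chartB chartM cb.
  split.
  - by move=> e [].
  - by split; rewrite ?mulr0; exact: chart0.
  - by move=> x y [? ?] [? ?]; split; rewrite ?mulrBr; apply: chartB.
  - by move=> x y ? [? ?]; split; rewrite 1?mulrCA; apply: chartM.
  - by move=> n [_ ?]; apply: nb; exists n.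
have [x ux xq] := lift qP.
have ax : zD a x by move=> /(xq _ _ ad).
have [e [a' [b' [ae be bx cE]]]] := fc x ux ax; rewrite addn0 in ae.
have := bx; apply; apply/(xq _ _ be)/Iq; split; first by exists e, b'.
exists e, a'; split=> //; rewrite cE mulrA divfK //.
exact: zD_neq0 bx.
Qed.

Lemma chart_zfrac c (x : T) : chart c -> oset U x -> zfrac 0 x c.
Proof.
move=> [d [a [ad ->]]] ux; exists d, a, (u ^+ d); rewrite addn0; split=> //.
  exact: gH_X1.
exact: zDX u1 ux.
Qed.

Definition chart_sec c (cc : chart c) : zsec 0 U :=
  zcst (fun x => @chart_zfrac c x cc).

Lemma chart_unit c (cc : chart c) d a (x : T) : gH G d a -> c = a / u ^+ d ->
  oset U x -> @unit_at k (zspace G Q) x U (chart_sec cc) <-> zD a x.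
Proof.
move=> ad cE ux; rewrite (zunit_genr (chart_sec cc) (exist _ x ux)) /=.
have ux' := zDX (n := d) u1 ux; have ud := gH_X1 d u1; split=> [|ax].
  by rewrite cE; apply: (@zgenr_num _ _ _ _ _ 0 x d a _ _ ud ux'); rewrite addn0.
by exists d, a, (u ^+ d); rewrite addn0.
Qed.

Lemma sec_chart (x0 : T) (s : zsec 0 U) : oset U x0 ->
  exists c (cc : chart c), s = chart_sec cc.
Proof.
move=> Ux0; have [c sc cf] := zsec_const s Ux0.
have [|n] := chart_frac (c := c) (@gH_1 _ _ _ G).
  by move=> x ux _; apply: cf.
rewrite divr1 expr1n mulr1 => cc; exists c, cc.
by apply: zsec_ext => x; rewrite sc.
Qed.

(** The functions on D(u) are the chart itself, so that their prime ideals are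
    those of the chart; and the basic open set D(f) inside D(u) is the locus
    where f / u^d is invertible. *)
Lemma chart_affine : @affine_open k (zspace G Q) U.
Proof.
have [x0 ux0] : exists x : T, zD u x.
  by have [x ux _] := lift chart_prime0; exists x.
have secP (b : zsec 0 U) : exists d a (cc : chart (a / u ^+ d)),
    gH G d a /\ b = chart_sec cc.
  have [c [cc ->]] := sec_chart b (ux0 : oset U x0).
  by have [d [a [ad cE]]] := cc; move: cc; rewrite cE => cc; exists d, a, cc.
have mkc d a : gH G d a -> chart (a / u ^+ d) by exists d, a.
split.
- move=> p [p0 pD pM p1 pp].
  pose q : set K := [set c | exists cc : chart c, p (chart_sec cc)].
  have sec_eq c (cc : chart c) (s : zsec 0 U) : (forall x, s x = c) ->
      p s -> p (chart_sec cc).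
    by move=> sE; rewrite (_ : s = chart_sec cc) //; apply: zsec_ext => x; rewrite sE.
  have [|x ux xq] := @lift q.
    split.
    - by move=> c [].
    - by exists chart0; apply: (sec_eq _ _ 0).
    - move=> a b [ca pa] [cb pb]; exists (chartB ca cb).
      apply: (sec_eq _ _ (chart_sec ca + (-1) * chart_sec cb)).
        by move=> x; rewrite zvalD zvalM mulN1r.
      by apply: pD => //; apply: pM.
    - move=> a b ca [cb pb]; exists (chartM ca cb).
      by apply: (sec_eq _ _ (chart_sec ca * chart_sec cb)) => //; apply: pM.
    - move=> [c1 pc1]; apply: p1; rewrite (_ : 1 = chart_sec c1) //.
      exact: zsec_ext.
    - move=> a b ca cb [cab pab].
      have : p (chart_sec ca * chart_sec cb).
        by rewrite (_ : _ * _ = chart_sec cab) //; apply: zsec_ext.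
      by move=> /pp [pa|pb]; [left; exists ca|right; exists cb].
  exists x => //; apply/seteqP; split=> b /=.
    have [d [a [cc [ad ->]]]] := secP b; rewrite (chart_unit cc ad) //.
    by move=> pa; apply; apply/(xq _ _ ad); exists cc.
  have [d [a [cc [ad ->]]]] := secP b; rewrite (chart_unit cc ad) //.
  move=> /contrapT /(xq _ _ ad) [cc' pc].
  by rewrite (_ : cc = cc') //; apply: Prop_irrelevance.
- move=> x y ux uy xy; apply: inj => // d a ad.
  have := xy (chart_sec (mkc d a ad)); rewrite !(chart_unit _ ad) // => H.
  by split=> ax; apply: contrapT => ay; [case: (H.2 ay)|case: (H.1 ay)].
- move=> W x WU Wx; have := oset_open W; rewrite zopenE => /(_ x Wx).
  move=> [d [f [fd fx fW]]]; exists (chart_sec (mkc d f fd)).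
    by apply/(chart_unit _ fd) => //; apply: WU.
  move=> y uy; apply: fW; apply/(chart_unit (mkc d f fd) fd) => //.
  by case: uy => Z [ZU [_ [Zy _]]]; apply: ZU.
- move=> b W h WE s.
  have [[x1 Wx1]|W0] := pselect (exists x, oset W x); last first.
    by exists 0, 0%N; apply: zsec_ext => -[x Wx]; case: W0; exists x.
  have [d [a [cc [ad bE]]]] := secP b.
  have [c sc cf] := zsec_const s Wx1.
  have [|n cn] := chart_frac (c := c) ad.
    by move=> x ux ax; apply: cf; apply/WE; rewrite bE (chart_unit cc ad).
  exists (chart_sec cn), n; apply: zsec_ext => x; rewrite zvalM sc bE /=.
  congr (_ * _); elim: n {cn} => [|n IH]; first by rewrite expr0.
  by rewrite !exprS zvalM -IH.
- move=> b W h WE c.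
  have [d [a [cc [ad bE]]]] := secP b; have [d' [a' [cc' [ad' cE]]]] := secP c.
  have [[x1 Wx1] c0|W0 _] := pselect (exists x, oset W x).
    exists 0%N; rewrite expr0 mul1r; have /zsec_app/(_ (exist _ x1 Wx1)) := c0.
    by rewrite cE /= => e; apply: zsec_ext.
  exists 1%N; rewrite expr1; apply: zsec_ext => x; rewrite zvalM bE /=.
  have [->|a0] := eqVneq a 0; first by rewrite !mul0r.
  have [y uy yq] := lift chart_prime0.
  case: W0; exists y; apply/WE; rewrite bE; apply/(chart_unit cc ad) => //.
  move=> /(yq _ _ ad) /eqP.
  by rewrite mulf_eq0 invr_eq0 (negbTE a0) (negbTE (expf_neq0 _ u0)).
Qed.

End Chart.

(** * Graded algebras generated in degree 1 *)

Lemma coef_comp_scaleX (R : comNzRingType) (c : R) (p : {poly R}) d :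
  (p \Po (c *: 'X))`_d = p`_d * c ^+ d.
Proof.
rewrite comp_polyE coef_sum; under eq_bigr => j _ do
  rewrite exprZn coefZ coefZ coefXn.
have [dp|pd] := ltnP d (size p).
  rewrite (bigD1 (Ordinal dp)) //= eqxx mulr1 big1 ?addr0 // => j /eqP jd.
  by case: eqP => [dj|]; [case: jd; apply: val_inj|rewrite !mulr0].
rewrite nth_default // mul0r big1 // => j _; case: eqP => [dj|]; rewrite ?mulr0 //.
by have := ltn_ord j; rewrite -dj ltnNge pd.
Qed.

Section PrimeSums.
Variables (K : fieldType) (B q : set K) (qP : prime_ideal B q).

Lemma prime_big (I : Type) (r : seq I) (P : pred I) (F : I -> K) :
  (forall j, P j -> q (F j)) -> q (\sum_(j <- r | P j) F j).
Proof. by move=> qF; apply: big_ind qF; [exact: pi_0 qP|move=> *; exact: (pi_D qP)]. Qed.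

(** Gauss: polynomials with coefficients in a prime ideal form a prime ideal;
    otherwise the product of the lowest bad coefficients would be in q. *)
Lemma prime_coef (p r : {poly K}) : (forall d, B p`_d) -> (forall d, B r`_d) ->
  (forall d, q (p * r)`_d) -> (forall d, q p`_d) \/ (forall d, q r`_d).
Proof.
move=> pB rB prq; apply: contrapT => /not_orP [/existsNP [d0 pd] /existsNP [e0 re]].
have lowest (s : {poly K}) d1 : ~ q s`_d1 ->
    exists2 d, ~ q s`_d & forall j, (j < d)%N -> q s`_j.
  move=> sd; have ex : exists d, `[< ~ q s`_d >] by exists d1; exact/asboolP.
  case: (ex_minnP ex) => d /asboolP qd dmin; exists d => // j jd.
  by apply: contrapT => /asboolP /dmin; rewrite leqNgt jd.
have [d qd pmin] := lowest p d0 pd; have [e qe rmin] := lowest r e0 re.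
(* All other terms of the coefficient of degree d + e have a factor in q. *)
have := prq (d + e)%N; rewrite coefM.
have dd : (d < (d + e).+1)%N by rewrite ltnS leq_addr.
rewrite (bigD1 (Ordinal dd)) //= addKn => qs.
have rest : q (\sum_(j < (d + e).+1 | j != Ordinal dd) p`_j * r`_(d + e - j)).
  apply: prime_big => j jd; have [lt|gt|eq] := ltngtP j d.
  - by rewrite mulrC; apply: (pi_M qP) => //; exact: pmin.
  - apply: (pi_M qP) => //; apply: rmin.
    by rewrite ltn_subLR ?ltn_add2r // -ltnS.
  - by case/eqP: jd; apply: val_inj.
by have := pi_B qP qs rest; rewrite addrK => /(pi_prime qP) [].
Qed.

End PrimeSums.

Section DegreeOne.
Variables (k : fieldType) (V : vectType k).
Variables (sg : int) (sg2 : sg * sg = 1) (A : set (KV V)).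
Variable (sA : subalg (@KV_const k V) A).
Variables (J : Type) (D : set J) (t : J -> KV V).
Hypothesis tH : forall j, gpart sg A 1 (t j).
Hypothesis Agen : A `<=` gen_alg (@KV_const k V) [set t j | j in D].
Notation K := (KV V).
Notation G := (graded sg sA).
Notation Q := (proj_prime G).
Notation X := (Proj G).
Notation hom := (gpart sg A).

Lemma hom_poly a : A a -> exists2 p, gpoly sg A p & a = p.[1].
Proof.
move=> /Agen Aa; apply: (Aa [set b | exists2 p, gpoly sg A p & b = p.[1]]).
  exact: gdec_subalg.
move=> _ [j _ <-]; exists (t j *: 'X^1); last by rewrite hornerZ hornerXn expr1n mulr1.
by apply: (gpolyZXn sA); exact: tH.
Qed.

Lemma hom_polyZ d a : hom d a -> gpoly sg A (a *: 'X^d).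
Proof. exact: (gpolyZXn sA). Qed.

Lemma hornerZ1 (d : nat) (a : K) : (a *: 'X^d).[1] = a.
Proof. by rewrite hornerZ hornerXn expr1n mulr1. Qed.

Lemma hom_poly_inj p q : gpoly sg A p -> gpoly sg A q -> p.[1] = q.[1] -> p = q.
Proof.
move=> pA qA; apply: (hdeg_inj sg2) => d; first by have [] := pA d.
by have [] := qA d.
Qed.

Lemma gpolyA p : gpoly sg A p -> A p.[1].
Proof.
move=> pA; rewrite horner_coef; apply: big_ind => [||j _]; first exact: (sa_0 sA).
  by move=> *; apply: (sa_D sA).
by rewrite expr1n mulr1; have [] := pA j.
Qed.

(** The elements of A whose homogeneous components, divided by powers of t j0,
    are polynomials in the t j / t j0 form a subalgebra containing all t j. *)
Lemma chart_gen j0 d a : D j0 -> t j0 != 0 -> hom d a ->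
  gen_alg (@KV_const k V) [set t j / t j0 | j in D] (a / t j0 ^+ d).
Proof.
move=> Dj0; set u := t j0 => u0 ad; set B := gen_alg _ _.
have sB : subalg (@KV_const k V) B by exact: gen_alg_subalg.
pose H d a := hom d a /\ B (a / u ^+ d).
have H0 e : H e 0.
  by split; [exact: (gpart_0 sg sA)|rewrite mul0r; exact: (sa_0 sB)].
have HB e b c : H e b -> H e c -> H e (b - c).
  move=> [bA bB] [cA cB]; split; first exact: (gpart_B sA).
  by rewrite mulrBl; apply: (sa_B sB).
have HD e b c : H e b -> H e c -> H e (b + c).
  by move=> hb hc; rewrite -[c]opprK; apply: (HB) => //; rewrite -sub0r; apply: (HB).
have HM e f b c : H e b -> H f c -> H (e + f)%N (b * c).
  move=> [bA bB] [cA cB]; split; first exact: (gpart_M sA).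
  by rewrite exprD -mulf_div; apply: (sa_M sB).
have HZ e b : H e b -> forall f, H f (b *: 'X^e)`_f.
  move=> hb f; rewrite coefZ coefXn; case: eqP => [->|_]; rewrite ?mulr1 ?mulr0 //.
pose S := [set b | exists2 p : {poly K}, (forall e, H e p`_e) & b = p.[1]].
have [p pH pE] : S a.
- apply: (Agen ad.1); first split.
  + move=> c; exists (KV_const V c *: 'X^0); last by rewrite hornerZ1.
    apply: HZ; split; first exact: (gpart_k sg sA).
    by rewrite expr0 divr1; apply: (sa_k sB).
  + move=> _ _ [p pH ->] [r rH ->]; exists (p - r); last by rewrite hornerD hornerN.
    by move=> e; rewrite coefB; apply: HB.
  + move=> _ _ [p pH ->] [r rH ->]; exists (p * r); last by rewrite hornerM.
    move=> e; rewrite coefM; apply: big_ind => [||l _]; [exact: H0|exact: HD|].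
    by rewrite -[in H e](subnKC (ltnSE (ltn_ord l))); apply: HM.
  + move=> _ [j Dj <-]; exists (t j *: 'X^1); last by rewrite hornerZ1.
    apply: HZ; split; first exact: tH.
    by rewrite expr1; apply: sub_gen_alg; exists j.
- have [_] := pH d; rewrite (_ : p`_d = a) //.
  rewrite (_ : p = a *: 'X^d) ?coefZ ?coefXn ?eqxx ?mulr1 //.
  apply: hom_poly_inj; [by move=> e; have [] := pH e|exact: hom_polyZ|].
  by rewrite hornerZ1.
Qed.

(** If all generators were in x then A would be contained in the constants plus
    x, hence x would contain all homogeneous elements of positive degree. *)
Lemma proj_cover (x : X) : exists2 j, D j & zD (t j) x.
Proof.
apply: contrapT => nx; have tx j : D j -> zp x (t j).
  by move=> Dj; apply: contrapT => ?; apply: nx; exists j.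
have xP := zp_prime x; have [xhom] := zp_Q x; apply=> d d0 a ad.
pose S := [set b | exists c, zp x (b - KV_const V c)].
have kA c : A (KV_const V c) := sa_k sA c.
have [c xc] : S a.
  apply: (Agen ad.1); first split.
  - by move=> c; exists c; rewrite subrr; apply: (pi_0 xP).
  - move=> b b' [c xc] [c' xc']; exists (c - c').
    rewrite rmorphB (_ : _ - _ = (b - KV_const V c) - (b' - KV_const V c')).
      exact: (pi_B xP).
    by rewrite !opprB addrACA [- b' + _]addrC addrACA.
  - move=> b b' [c xc] [c' xc'].
    have bA : A b.
      by rewrite -[b](subrK (KV_const V c)); apply: (sa_D sA) => //; apply: (pi_sub xP).
    exists (c * c'); rewrite rmorphM.
    have -> : b * b' - KV_const V c * KV_const V c' =
        b * (b' - KV_const V c') + KV_const V c' * (b - KV_const V c).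
      by rewrite !mulrBr addrA [b * KV_const V c']mulrC subrK [KV_const V c * _]mulrC.
    by apply: (pi_D xP); apply: (pi_M xP).
  - by move=> _ [j Dj <-]; exists 0; rewrite rmorph0 subr0; apply: tx.
have pA e : hom e (a *: 'X^d - KV_const V c *: 'X^0)`_e.
  apply: (gpolyB sA); first exact: hom_polyZ.
  by apply: hom_polyZ; exact: (gpart_k sg sA).
have := xhom d.+1 _ pA; set p : {poly K} := _ - _.
have ps : (size p <= d.+1)%N.
  apply: leq_trans (size_polyD _ _) _; rewrite geq_max size_polyN.
  by rewrite !(leq_trans (size_scale_leq _ _)) ?size_polyXn.
have p1 : \sum_(e < d.+1) p`_e = p.[1].
  rewrite (horner_coef_wide 1 ps); apply: eq_bigr => e _.
  by rewrite expr1n mulr1.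
rewrite p1 hornerD hornerN !hornerZ1 => /(_ xc d (ltnSn d)).
by rewrite coefB !coefZ !coefXn eqxx mulr1 (gtn_eqF d0) mulr0 subr0.
Qed.

Lemma proj_ext (x y : X) :
  (forall d a, hom d a -> zp x a <-> zp y a) -> x = y.
Proof.
suff sub (x' y' : X) : (forall d a, hom d a -> zp x' a -> zp y' a) ->
    zp x' `<=` zp y'.
  by move=> xy; apply: zpt_ext; apply/seteqP; split; apply: sub => d a /xy [].
move=> xy a xa; have [p pA aE] := hom_poly (pi_sub (zp_prime x') xa).
have aS : a = \sum_(d < size p) p`_d.
  by rewrite aE horner_coef; apply: eq_bigr => d _; rewrite expr1n mulr1.
rewrite aS; apply: (prime_big (zp_prime y')) => d _.
have [xhom _] := zp_Q x'; apply: (xy d) (pA d) _.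
by apply: (xhom (size p) _ pA) => //; rewrite -aS.
Qed.

Section Lift.
Variables (u : K) (u1 : hom 1 u) (u0 : u != 0).
Variables (q : set K) (qP : prime_ideal (chart G u) q).

Let good (p : {poly K}) := forall d, q (p`_d / u ^+ d).

Let dil (p : {poly K}) := p \Po (u^-1 *: 'X).

Let dilE p d : (dil p)`_d = p`_d / u ^+ d.
Proof. by rewrite coef_comp_scaleX exprVn. Qed.

Let dil_chart p : gpoly sg A p -> forall d, chart G u (dil p)`_d.
Proof. by move=> pA d; rewrite dilE; exists d, p`_d; split=> //; apply: pA. Qed.

(** The homogeneous prime ideal of A above q. *)
Definition lift_set : set K :=
  [set a | exists p, [/\ gpoly sg A p, good p & a = p.[1]]].

Lemma lift_poly p : gpoly sg A p -> lift_set p.[1] -> good p.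
Proof. by move=> pA [r [rA rg /(hom_poly_inj pA rA) ->]]. Qed.

Lemma lift_hom d a : hom d a -> lift_set a <-> q (a / u ^+ d).
Proof.
move=> ad; split=> [|qa].
  rewrite -[a in lift_set a](hornerZ1 d) => /(lift_poly (hom_polyZ ad)) /(_ d).
  by rewrite coefZ coefXn eqxx mulr1.
exists (a *: 'X^d); split; [exact: hom_polyZ| |by rewrite hornerZ1].
move=> e; rewrite coefZ coefXn; case: eqP => [->|_]; rewrite ?mulr1 //.
by rewrite mulr0 mul0r; apply: (pi_0 qP).
Qed.

Lemma lift_prime : prime_ideal (gA G) lift_set.
Proof.
split.
- by move=> a [p [pA _ ->]]; apply: gpolyA.
- apply/(lift_hom (gpart_0 sg sA 0)); rewrite mul0r; exact: (pi_0 qP).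
- move=> _ _ [p [pA pg ->]] [r [rA rg ->]]; exists (p - r); split.
  + exact: (gpolyB sA).
  + by move=> d; rewrite coefB mulrBl; apply: (pi_B qP).
  + by rewrite hornerD hornerN.
- move=> a _ Aa [r [rA rg ->]]; have [p pA ->] := hom_poly Aa.
  exists (p * r); split; [exact: (gpolyM sA)| |by rewrite hornerM].
  move=> d; rewrite -dilE /dil comp_polyM coefM; apply: (prime_big qP) => j _.
  by apply: (pi_M qP); [exact: dil_chart|rewrite dilE].
- have h1 : hom 0 1 by rewrite -(rmorph1 (KV_const V)); exact: (gpart_k sg sA).
  by move=> /(lift_hom h1); rewrite divr1; exact: (pi_1 qP).
- move=> a b Aa Ab; have [p pA ->] := hom_poly Aa; have [r rA ->] := hom_poly Ab.
  rewrite -hornerM => /(lift_poly (gpolyM sA pA rA)) prg.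
  have prq d : q (dil p * dil r)`_d by rewrite -comp_polyM dilE.
  have [pq|rq] := prime_coef qP (dil_chart pA) (dil_chart rA) prq.
  + by left; exists p; split=> // d; rewrite -dilE.
  + by right; exists r; split=> // d; rewrite -dilE.
Qed.

Lemma lift_proj : Q lift_set.
Proof.
split=> [n c cA xc d dn|/(_ 1%N isT u u1)]; last first.
  by move=> /(lift_hom u1); rewrite expr1 divff //; exact: (pi_1 qP).
have pA e : hom e (\poly_(j < n) c j)`_e.
  by rewrite coef_poly; case: ifP => _; [exact: cA|exact: (gpart_0 sg sA)].
have : lift_set (\poly_(j < n) c j).[1].
  rewrite horner_poly (eq_bigr (fun j : 'I_n => c j)) // => j _.
  by rewrite expr1n mulr1.
move=> /(lift_poly pA) /(_ d); rewrite coef_poly dn => qd.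
exact/(lift_hom (cA d)).
Qed.

Lemma proj_lift : exists2 x : X, zD u x &
  forall d a, hom d a -> zp x a <-> q (a / u ^+ d).
Proof.
exists (ZPt (G := G) lift_prime lift_proj) => [|d a]; last exact: lift_hom.
by move=> /(lift_hom u1); rewrite expr1 divff //; exact: (pi_1 qP).
Qed.

End Lift.

Lemma proj_deg1 (x : X) : exists2 u, gH G 1 u & zD u x.
Proof. by have [j _ tx] := proj_cover x; exists (t j) => //; apply: tH.
Qed.

Lemma proj_scheme : is_scheme X.
Proof.
move=> x; have [u u1 ux] := proj_deg1 x; exists (zDo _ u1) => //.
apply: chart_affine; first exact: zD_neq0 ux.
  by move=> q qP; apply: proj_lift => //; exact: zD_neq0 ux.
by move=> y z _ _; apply: proj_ext.
Qed.

End DegreeOne.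

Section SpecScheme.
Variables (k K : fieldType) (i : {rmorphism k -> K}) (A : set K) (sA : subalg i A).

Lemma spec_deg1 (x : Spec sA) : exists2 u, gH (spec_gring sA) 1 u & zD u x.
Proof. by exists 1; [exact: (sa_1 sA)|exact: zD1]. Qed.

Lemma spec_scheme : is_scheme (Spec sA).
Proof.
have h1 : gH (spec_gring sA) 1 1 by exact: (sa_1 sA).
move=> x; exists (zDo _ h1); first exact: zD1.
have cA c : chart (spec_gring sA) 1 c <-> A c.
  split=> [[d [a [Aa ->]]]|Ac]; first by rewrite expr1n divr1.
  by exists 0%N, c; rewrite divr1.
apply: chart_affine; first exact: oner_neq0.
  move=> q [qA q0 qB qM q1 qp]; have qP : prime_ideal (gA (spec_gring sA)) q.
    split=> //.
    - by move=> a /qA /cA.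
    - by move=> a b /cA ? ?; apply: qM.
    - by move=> a b /cA ? /cA ?; apply: qp.
  exists (ZPt qP (Q := setT) I) => //.
  by move=> d a _; rewrite expr1n divr1.
move=> y z _ _ yz; apply: zpt_ext; apply/seteqP; split=> a ya.
  by apply/(yz 0%N) => //; exact: (pi_sub (zp_prime y)).
by apply/(yz 0%N) => //; exact: (pi_sub (zp_prime z)).
Qed.
End SpecScheme.

(** * Morphisms and pullbacks *)

Section Morphisms.
Variable k : fieldType.
Implicit Types X Y Z : lrs k.

Lemma unit_at_res X (p : X) (U W : opens X) (h : W `<=` U) (s : rO U) :
  oset W p -> unit_at p (rres h s) <-> unit_at p s.
Proof.
move=> Wp; split=> -[Z [hZ [t [Zp e]]]].
  have hU : Z `<=` U by move=> q /hZ /h.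
  by exists Z, hU, t; split=> //; rewrite -e (lrs_res_comp (lspaceP X) _ _ hU).
have hW : ocap Z W `<=` W by move=> q [].
have hZ' : ocap Z W `<=` Z by move=> q [].
have hU : ocap Z W `<=` U by move=> q [/hZ].
exists (ocap Z W), hW, (rres hZ' t); split=> //.
rewrite (lrs_res_comp (lspaceP X) _ _ hU).
by rewrite -(lrs_res_comp (lspaceP X) hZ hZ' hU) -rmorphM e rmorph1.
Qed.

Lemma unit_at_hO X Y (x : lhom X Y) p (U : opens Y) (s : rO U) :
  unit_at p (hO x U s) <-> unit_at (x p) s.
Proof.
split; first exact: hlocal.
move=> [W [h [t [Wx e]]]].
have h' : opre (hcont x) W `<=` opre (hcont x) U by move=> q; apply: h.
exists (opre (hcont x) W), h', (hO x W t); split=> //.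
by rewrite -(hnat x h h') -rmorphM e rmorph1.
Qed.

Lemma lcompA X Y Z T (h : lhom Z T) (g : lhom Y Z) (f : lhom X Y) :
  lcomp (lcomp h g) f = lcomp h (lcomp g f).
Proof.
apply: lhom_ext => // U s W hW hW'; rewrite /= /lcomp_O /=.
have h1 : opre (@lcomp_cont _ _ _ _ h g) U `<=` opre (hcont g) (opre (hcont h) U) by [].
have h2 : opre (hcont f) (opre (@lcomp_cont _ _ _ _ h g) U) `<=`
  opre (hcont f) (opre (hcont g) (opre (hcont h) U)) by [].
rewrite (hnat f _ h2) !(lrs_res_comp (lspaceP X)) //.
Qed.

Section Id.
Variable X : lrs k.

Lemma lid_cont : continuous (id : X -> X).
Proof. by move=> x W. Qed.

Lemma lid_sub (U : opens X) : opre lid_cont U `<=` U.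
Proof. by []. Qed.

Definition lid_O (U : opens X) : {rmorphism rO U -> rO (opre (lid_cont) U)} :=
  @rres _ _ _ _ (@lid_sub U).

Program Definition lid : lhom X X := @LHom k X X id (lid_cont) lid_O _ _ _.
Next Obligation.
by move=> U W h h' s; rewrite /lid_O !(lrs_res_comp (lspaceP X)).
Qed.
Next Obligation. by move=> U a; rewrite /lid_O (lrs_res_str (lspaceP X)). Qed.
Next Obligation.
move=> x U s us; apply/(unit_at_res (@lid_sub U)) => //.
by case: us => W [h [t [Wx _]]]; exact: h.
Qed.
End Id.

Lemma lcomp_lid X Y (f : lhom X Y) : lcomp f (lid X) = f.
Proof.
apply: lhom_ext => // U s W hW hW'; rewrite /= /lcomp_O /= /lid_O.
by rewrite !(lrs_res_comp (lspaceP X)).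
Qed.

Section Pullback.
Variables (X Y : lrs k).
Implicit Types x : lhom X Y.

(** The pullback of a function on U to an open set Z that maps into U; moving
    Z around avoids comparing preimages under different morphisms. *)
Definition pb x (U : opens Y) (Z : opens X) (h : Z `<=` opre (hcont x) U)
  (s : rO U) : rO Z := rres h (hO x U s).

Lemma pb_res x (U W : opens Y) (Z : opens X) (h : W `<=` U)
  (hU : Z `<=` opre (hcont x) U) (hW : Z `<=` opre (hcont x) W) (s : rO U) :
  pb hW (rres h s) = pb hU s.
Proof.
have h' : opre (hcont x) W `<=` opre (hcont x) U by move=> q; apply: h.
by rewrite /pb (hnat x h h') (lrs_res_comp (lspaceP X) _ _ hU).
Qed.

Lemma pb_unit x (U : opens Y) (Z : opens X) (h : Z `<=` opre (hcont x) U) p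
  (s : rO U) : oset Z p -> unit_at p (pb h s) <-> unit_at (x p) s.
Proof. by move=> Zp; rewrite unit_at_res // unit_at_hO. Qed.

Lemma pullback_ext x (M : omod Y) (L : omod X) (J : Type) (D : set J)
    (m : J -> msec M (otop Y)) (l l' : J -> msec L (otop X)) :
  (forall j, D j -> l j = l' j) -> is_pullback x D m l -> is_pullback x D m l'.
Proof.
move=> ll [th [th1 th2 th3 th4]]; exists th; split=> // h j Dj.
by rewrite th4 // ll.
Qed.

Lemma generates_res (L : omod X) (U W : opens X) (h : W `<=` U) (e : msec L U) :
  generates e -> generates (mres L h e).
Proof.
move=> ge Z hZ s; have hU : Z `<=` U by move=> q /hZ /h.
by rewrite (mres_comp h hZ hU); apply: ge.
Qed.

Lemma generates_inj (L : omod X) (U : opens X) (e : msec L U) (a b : rO U) :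
  generates e -> a *: e = b *: e -> a = b.
Proof.
move=> ge ab; have [c [_ cu]] := ge U (@subset_refl _ _) (a *: e).
rewrite -(cu a); last by rewrite mres_id.
by rewrite -(cu b) // mres_id.
Qed.

End Pullback.
End Morphisms.

Section Unique.
Variables (k : fieldType) (V : vectType k).
Variables (sg : int) (sg2 : sg * sg = 1) (A : set (KV V)).
Variable (sA : subalg (@KV_const k V) A).
Variables (J : Type) (D : set J) (t : J -> KV V).
Hypothesis tH : forall j, gpart sg A 1 (t j).
Hypothesis Agen : A `<=` gen_alg (@KV_const k V) [set t j | j in D].
Notation K := (KV V).
Notation G := (graded sg sA).
Notation Q := (proj_prime G).
Notation Y := (Proj G).
Notation M := (twist G Q 1).
Notation m := (fun j => hom_section Q (tH j : gH G 1 (t j))).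
Notation DU j := (zDo Q (tH j : gH G 1 (t j))).

Let top_sub (W : opens Y) : W `<=` otop Y. Proof. by []. Qed.

Let ratio_chart i j : chart G (t j) (t i / t j).
Proof. by exists 1%N, (t i); split=> //; exact: tH. Qed.

Definition ratio i j : zsec 0 (DU j) := chart_sec Q _ (ratio_chart i j).

Variables (X : lrs k) (L : omod X).

Section One.
Variables (x : lhom X Y) (l : J -> msec L (otop X)).
Hypothesis xl : is_pullback x (M := M) D m l.

Lemma pb_generates j (Z : opens X) (hZ : Z `<=` otop X) : D j ->
  Z `<=` opre (hcont x) (DU j) -> generates (mres L hZ (l j)).
Proof.
move=> Dj hx; have [th [thl thr thg thm]] := xl.
have h' : opre (hcont x) (DU j) `<=` opre (hcont x) (otop Y) by [].
have ht : otop X `<=` opre (hcont x) (otop Y) by [].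
have g : generates (mres M (@top_sub (DU j)) (m j)).
  apply: zgenr_generates => y; apply: zgenr_hom; first exact: tH.
  exact: svalP.
have := generates_res hx (thg _ _ g).
rewrite (thr _ _ _ h') -(thm ht j Dj).
have hZ' : Z `<=` opre (hcont x) (otop Y) by [].
by rewrite (mres_comp h' hx hZ') (mres_comp ht hZ hZ').
Qed.

Lemma pb_ratio i j (Z : opens X) (hZ : Z `<=` otop X)
    (hx : Z `<=` opre (hcont x) (DU j)) : D i -> D j ->
  mres L hZ (l i) = pb hx (ratio i j) *: mres L hZ (l j).
Proof.
move=> Di Dj; have [th [thl thr thg thm]] := xl.
have h' : opre (hcont x) (DU j) `<=` opre (hcont x) (otop Y) by [].
have ht : otop X `<=` opre (hcont x) (otop Y) by [].
have hZ' : Z `<=` opre (hcont x) (otop Y) by [].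
have E : mres M (@top_sub (DU j)) (m i) =
    (ratio i j : rO (r := Y) (DU j)) *: mres M (@top_sub (DU j)) (m j) + 0.
  apply: zsec_ext => y; rewrite zvalD addr0 /=.
  by rewrite divfK // (zD_neq0 (svalP y)).
have th0 U : th U 0 = 0.
  by have := thl U (-1) 0 0; rewrite scaler0 addr0 rmorphN1 scaleN1r addNr.
have := congr1 (fun s => mres L hx (th _ s)) E.
rewrite /= thl th0 addr0 mresZ !(thr _ _ _ h') !(mres_comp h' hx hZ').
by rewrite -!(mres_comp ht hZ hZ') !thm.
Qed.

End One.

Section Two.
Variables (x y : lhom X Y) (l : J -> msec L (otop X)).
Hypotheses (xl : is_pullback x (M := M) D m l) (yl : is_pullback y (M := M) D m l).

(** On the common preimage of D(t_i) and D(t_j) both l i and l j generate L, so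
    their ratio, the pullback of t_i / t_j, is invertible. *)
Lemma pullback_zD i p : D i -> zD (t i) (x p) -> zD (t i) (y p).
Proof.
move=> Di xi; have [j Dj yj] := proj_cover Agen (y p).
pose Z := ocap (opre (hcont x) (DU i)) (opre (hcont y) (DU j)).
have Zp : oset Z p by [].
have hZ : Z `<=` otop X by [].
have hx : Z `<=` opre (hcont x) (DU i) by move=> q [].
have hy : Z `<=` opre (hcont y) (DU j) by move=> q [].
have gi := pb_generates xl hZ Di hx; have gj := pb_generates yl hZ Dj hy.
have [c [cE _]] := gi Z (@subset_refl _ _) (mres L hZ (l j)).
rewrite mres_id (pb_ratio yl hZ hy Di Dj) scalerA in cE.
have c1 : c * pb hy (ratio i j) = 1.
  by apply: (generates_inj gj); rewrite -cE scale1r.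
have : unit_at p (pb hy (ratio i j)).
  exists Z, (@subset_refl _ _), c; split=> //.
  by rewrite (lrs_res_id (lspaceP X)) mulrC.
rewrite (pb_unit hy _ Zp).
by rewrite (@chart_unit _ _ _ _ _ _ _ _ _ 1 (t i)) //; exact: tH.
Qed.

(** The chart is generated by the functions t_i / t_j, which pull back to the
    ratios of l i and l j. *)
Lemma pullback_chart j (Z : opens X) (hx : Z `<=` opre (hcont x) (DU j))
    (hy : Z `<=` opre (hcont y) (DU j)) c (cc : chart G (t j) c) : D j ->
  (exists p, oset Z p) ->
  pb hx (chart_sec Q _ cc : zsec 0 (DU j)) = pb hy (chart_sec Q _ cc : zsec 0 (DU j)).
Proof.
move=> Dj [p0 Zp0]; have tj0 : t j != 0 by exact: zD_neq0 (hx _ Zp0).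
pose sec b (cb : chart G (t j) b) : rO (r := Y) (DU j) := chart_sec Q (tH j : gH G 1 (t j)) cb.
pose S := [set b | exists cb : chart G (t j) b, pb hx (sec b cb) = pb hy (sec b cb)].
suff [cc' E] : S c by rewrite (_ : cc = cc') //; apply: Prop_irrelevance.
have [d [a [ad ->]]] := cc.
have hZ : Z `<=` otop X by [].
apply: (chart_gen sg2 sA tH Agen Dj tj0 ad); first split.
- move=> b; have cb : chart G (t j) (KV_const V b).
    by exists 0%N, (KV_const V b); rewrite divr1; split=> //; exact: (gpart_k sg sA).
  exists cb; rewrite (_ : sec _ cb = rstr (X := Y) (DU j) b); last exact: zsec_ext.
  by rewrite /pb !hstr !(lrs_res_str (lspaceP X)).
- move=> b b' [cb E] [cb' E'].
  have cB : chart G (t j) (b - b') by exact: (chartB (G := G) (tH j) tj0 cb cb').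
  exists cB; rewrite (_ : sec _ cB = sec _ cb - sec _ cb'); last exact: zsec_ext.
  by rewrite /pb !rmorphB; congr (_ - _); [exact: E|exact: E'].
- move=> b b' [cb E] [cb' E'].
  have cM : chart G (t j) (b * b') by exact: (chartM (G := G) cb cb').
  exists cM; rewrite (_ : sec _ cM = sec _ cb * sec _ cb'); last exact: zsec_ext.
  by rewrite /pb !rmorphM; congr (_ * _); [exact: E|exact: E'].
- move=> _ [i Di <-]; exists (ratio_chart i j).
  apply: (generates_inj (pb_generates xl hZ Dj hx)).
  by rewrite -(pb_ratio xl hZ hx Di Dj) -(pb_ratio yl hZ hy Di Dj).
Qed.

Lemma pullback_pt_sub (hxy : forall i p, D i -> zD (t i) (x p) -> zD (t i) (y p))
  p d a : gpart sg A d a -> zp (x p) a <-> zp (y p) a.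
Proof.
move=> ad; have [j Dj xj] := proj_cover Agen (x p); have yj := hxy j p Dj xj.
pose Z := ocap (opre (hcont x) (DU j)) (opre (hcont y) (DU j)).
have Zp : oset Z p by [].
have hx : Z `<=` opre (hcont x) (DU j) by move=> q [].
have hy : Z `<=` opre (hcont y) (DU j) by move=> q [].
have ca : chart G (t j) (a / t j ^+ d) by exists d, a.
have E := pullback_chart hx hy ca Dj (ex_intro _ p Zp).
have := pb_unit hx (chart_sec Q _ ca) Zp; rewrite E (pb_unit hy _ Zp).
rewrite !(@chart_unit _ _ _ _ _ _ _ _ _ d a) // => H.
by split=> ax; apply: contrapT => ay; [case: (H.1 ay)|case: (H.2 ay)].
Qed.

End Two.

Variables (x y : lhom X Y) (l : J -> msec L (otop X)).
Hypotheses (xl : is_pullback x (M := M) D m l) (yl : is_pullback y (M := M) D m l).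

(** The pullbacks of the functions on the charts D(t_j) are known, by the ratios
    of the sections.  Points are determined by which functions on a chart vanish
    there; and every section of the structure sheaf is locally a quotient
    of two functions on a chart. *)
Lemma pullback_inj : x = y.
Proof.
have xy p : x p = y p.
  apply: (proj_ext tH Agen) => d a ad; apply: (pullback_pt_sub xl yl) ad => i q Di.
  exact: (pullback_zD xl yl).
apply: lhom_ext => // U s W hW hW'.
apply: (lrs_sep (lspaceP X)) => p Wp.
have Ux : oset U (x p) by exact: hW.
have [j Dj xj] := proj_cover Agen (x p).
have [N [Nx [d [a [b [ad bd Ns]]]]]] := asboolW (zval_in (s : zsec 0 U)) (exist _ (x p) Ux).
have [bx _] := Ns _ Nx; rewrite addn0 in ad.
pose E : opens Y := ocap (ocap N U) (ocap (DU j) (zDo Q bd)).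
have hE : E `<=` U by move=> q [[]].
have hEj : E `<=` DU j by move=> q [_ []].
pose Z := ocap W (opre (hcont x) E).
have ZW : Z `<=` W by move=> q [].
have hx : Z `<=` opre (hcont x) E by move=> q [].
have hy : Z `<=` opre (hcont y) E by move=> q [_ ?]; rewrite /= -xy.
have Zp : oset Z p by split=> //; split; split.
exists Z, ZW; split=> //.
have hxU : Z `<=` opre (hcont x) U by move=> q /hx /hE.
have hyU : Z `<=` opre (hcont y) U by move=> q /hy /hE.
have hxj : Z `<=` opre (hcont x) (DU j) by move=> q /hx /hEj.
have hyj : Z `<=` opre (hcont y) (DU j) by move=> q /hy /hEj.
rewrite !(lrs_res_comp (lspaceP X) _ _ hxU) !(lrs_res_comp (lspaceP X) _ _ hyU).
rewrite -[LHS]/(pb hxU s) -[RHS]/(pb hyU s) -(pb_res hE hxU hx) -(pb_res hE hyU hy).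
have ca : chart G (t j) (a / t j ^+ d) by exists d, a.
have cb : chart G (t j) (b / t j ^+ d) by exists d, b.
have tZ (c : K) (cc : chart G (t j) c) :
    pb hx (rres hEj (chart_sec Q (tH j : gH G 1 (t j)) cc : rO (r := Y) _)) =
    pb hy (rres hEj (chart_sec Q (tH j : gH G 1 (t j)) cc : rO (r := Y) _)).
  rewrite (pb_res hEj hxj hx) (pb_res hEj hyj hy).
  by apply: (pullback_chart xl yl) => //; exists p.
have := tZ _ ca; have := tZ _ cb.
set sa := rres hEj (chart_sec _ _ ca); set sb := rres hEj (chart_sec _ _ cb).
have EP q : oset E q -> [/\ oset N q, zD (t j) q & zD b q].
  by move=> [[? ?] [? ?]].
have tE q : oset E q -> t j ^+ d != 0.
  by move=> /EP [_ jq _]; apply: expf_neq0 (zD_neq0 jq).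
have sE : sa = rres hE s * sb.
  apply: zsec_ext => q; rewrite [RHS]zvalM /=.
  have [Nq _ bq] := EP _ (svalP q).
  have [_ ->] := Ns (zsub hE q) Nq.
  by rewrite mulrA divfK // (zD_neq0 bq).
have tbE q : oset E q -> zfrac 0 q (t j ^+ d / b).
  move=> /EP [_ _ bq]; exists d, (t j ^+ d), b; rewrite addn0; split=> //.
  exact: (gH_X1 (G := G) d (tH j)).
have cE : sb * (zcst tbE : rO (r := Y) E) = 1.
  apply: zsec_ext => q; rewrite [LHS]zvalM /=.
  have [_ _ bq] := EP _ (svalP q); have b0 := zD_neq0 bq.
  have K1 : b / t j ^+ d * (t j ^+ d / b) = 1.
    by rewrite mulrA (divfK (tE _ (svalP q))) (divff b0).
  exact: K1.
set c : rO (r := Y) E := zcst tbE in cE.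
move=> Eb Ea.
have mulE (f : lhom X Y) (hf : Z `<=` opre (hcont f) E) :
    pb hf (rres hE s) = pb hf sa * pb hf c.
  rewrite sE /pb -!rmorphM; congr (rres _ (hO _ _ _)).
  by rewrite -mulrA cE mulr1.
have inv (f : lhom X Y) (hf : Z `<=` opre (hcont f) E) : pb hf sb * pb hf c = 1.
  by rewrite /pb -!rmorphM cE !rmorph1.
rewrite !mulE Ea; congr (_ * _).
by rewrite -[LHS]mul1r -(inv y hy) -Eb mulrAC inv mul1r.
Qed.

End Unique.

Lemma pullback_lid (k : fieldType) (X : lrs k) (M : omod X) (J : Type)
  (D : set J) (m : J -> msec M (otop X)) : is_pullback (lid X) D m m.
Proof.
exists (fun U s => mres M (@lid_sub _ X U) s); split.
- by move=> U a s t; rewrite mresD mresZ.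
- by move=> U W h h' s; rewrite !(mres_comp _ _ (h : opre (lid_cont (X:=X)) W `<=` U)).
- by move=> U e; apply: generates_res.
- by move=> h j _; rewrite (mres_comp _ _ (@subset_refl _ _)) mres_id.
Qed.

Lemma zvalX (k K : fieldType) (i : {rmorphism k -> K}) (G : gring i) Q
  (U : opens (zpt G Q)) (s : zsec 0 U) n x : (s ^+ n) x = s x ^+ n.
Proof. by elim: n => [|n IH]; rewrite ?expr0 // !exprS zvalM IH. Qed.

Section Frobenius.
Variables (k : finFieldType) (K : fieldType) (i : {rmorphism k -> K}).
Variables (G : gring i) (Q : set (set K)).
Hypothesis deg1 : forall x : zpt G Q, exists2 t, gH G 1 t & zD t x.
Notation X := (zspace G Q).
Variables (Y : lrs k) (M : omod Y) (J : Type) (D : set J).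
Variables (m : J -> msec M (otop Y)) (x : lhom X Y).
Variables (n e e' : nat) (ee' : e' = (#|k| ^ n * e)%N).

(** Frobenius raises functions to the power q^n, hence turns a pair (L, l) into
    (L^(q^n), l^(q^n)): the power map is additive and semilinear. *)
Lemma pullback_frob (l : J -> zsec e (otop _)) :
  is_pullback x (L := twist G Q e) D m l ->
  is_pullback (lcomp (frob n Y) x) (L := twist G Q e') D m
    (fun j => zprod ee' (fun=> l j)).
Proof.
move=> [th [thl thr thg thm]].
pose xf := lcomp (frob n Y) x.
have sub (U : opens Y) : opre (hcont xf) U `<=` opre (hcont x) U by [].
pose th' U (s : msec M U) : zsec e' (opre (hcont xf) U) :=
  zres (sub U) (zprod ee' (fun=> th U s)).
have thE U (s : msec M U) (p : {p | oset (opre (hcont xf) U) p}) :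
    th' U s p = zval (th U s) (zsub (sub U) p) ^+ (#|k| ^ n).
  by rewrite /= prodr_const card_ord.
have hOE U (a : rO U) (p : {p | oset (opre (hcont xf) U) p}) :
    zval (hO xf U a) p = zval (hO x U a) (zsub (sub U) p) ^+ (#|k| ^ n).
  have hf : opre (@id_cont k Y) U `<=` U by [].
  have hx : opre (hcont x) (opre (@id_cont k Y) U) `<=` opre (hcont x) U by [].
  rewrite /= /frob_O /= /powq (hnat x _ hx) rmorphXn /= zvalX /=.
  by congr (zval _ _ ^+ _); apply: dom_ext.
exists th'; split.
- move=> U a s t; apply: zsec_ext => p.
  have -> : (hO xf U a *: th' U s + th' U t) p =
    zval (hO xf U a) p * th' U s p + th' U t p by [].
  rewrite !thE hOE thl -exprMn.
  exact: (powq_nmod n i).2.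
- move=> U W h h' s; apply: zsec_ext => p.
  have h1 : opre (hcont x) W `<=` opre (hcont x) U by move=> q; apply: h.
  rewrite thE (thr _ _ h h1); transitivity (th' U s (zsub h' p)); last by [].
  by rewrite thE /=; congr (zval _ _ ^+ _); apply: dom_ext.
- move=> U s gs; apply: zgenr_generates => p.
  rewrite thE ee'; apply: zgenrX.
  exact: (generates_zgenr deg1 (zsub (sub U) p) (thg _ _ gs)).
- move=> h j Dj; apply: zsec_ext => p.
  have h1 : otop X `<=` opre (hcont x) (otop Y) by [].
  transitivity (th' _ (m j) (zsub h p)); first by [].
  rewrite thE /= prodr_const card_ord -(thm h1 j Dj) /=.
  by congr (zval _ _ ^+ _); apply: dom_ext.
Qed.

End Frobenius.

Section PullbackImmersion.
Variables (k : fieldType) (V : vectType k).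
Notation K := (KV V).
Variables (sg : int) (sg2 : sg * sg = 1) (A : set K) (sA : subalg (@KV_const k V) A).
Variable u : K.
Hypotheses (ARS : A `<=` @RSV k V) (Au : A u) (hu : hdeg sg u) (u0 : u != 0)
  (RSu : @RSV k V u^-1).
Hypothesis Adec : forall a, A a ->
  exists2 p : {poly K}, forall d, gpart sg A d p`_d & a = p.[1].
Notation G := (graded sg sA).
Notation S := (spec_gring (@RSV0_subalg k V)).
Variables (J : Type) (D : set J) (t : J -> K).
Hypothesis tH : forall j, gpart sg A 1 (t j).
Hypothesis deg1 : forall y : Proj G, exists2 w, gH G 1 w & zD w y.

Lemma imm_ratio j : gH S 0 (t j / u).
Proof.
rewrite -[u]expr1; apply: (gH_RS0 (sA := sA) ARS hu RSu (d := 1)).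
exact: tH.
Qed.

(** On Omega the homogeneous element u trivializes O(1). *)
Lemma pullback_imm :
  is_pullback (immersion sg2 sA ARS Au hu u0 RSu Adec) (M := twist G _ 1)
    (L := twist S setT 0) D (fun j => hom_section (proj_prime G) (tH j : gH G 1 (t j)))
    (fun j => hom_section setT (imm_ratio j)).
Proof.
set x := immersion _ _ _ _ _ _ _ _.
have tl U (s : zsec (G := G) (Q := proj_prime G) 1 U) :
    zlocal (G := S) (Q := setT) 0 (fun p : {p | oset (opre (hcont x) U) p} =>
      s (exist _ (x (sval p)) (svalP p)) / u).
  move=> p.
  have [W [Wx [d [a [b [ad bd Ws]]]]]] :=
    asboolW (zval_in s) (exist _ (x (sval p)) (svalP p)).
  exists (opre (hcont x) W); split=> //; exists 0%N, (a / u ^+ (d + 1)), (b / u ^+ d).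
  split.
  - exact: (gH_RS0 (sA := sA) ARS hu RSu).
  - exact: (gH_RS0 (sA := sA) ARS hu RSu).
  - move=> q Wq; have [bq sq] := Ws (exist _ (x (sval q)) (svalP q)) Wq; split.
      exact/(imm_pt_zD sg2 ARS Au hu u0 RSu Adec _ bd).
    rewrite sq addn1 exprS invfM mulrA (div_un (V := V) u0).
    by rewrite mulrAC.
pose th U (s : zsec (G := G) (Q := proj_prime G) 1 U) :
   zsec (G := S) (Q := setT) 0 (opre (hcont x) U) := ZSec (asboolT (tl U s)).
exists th; split.
- move=> U a s r; apply: zsec_ext => p.
  pose p' : {y | oset U y} := exist _ (x (sval p)) (svalP p).
  have -> : (hO x U a *: th U s + th U r) p = a p' * (s p' / u) + r p' / u by [].
  have -> : th U (a *: s + r) p = (a p' * s p' + r p') / u by [].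
  by rewrite mulrDl mulrA.
- move=> U W h h' s; apply: zsec_ext => p /=; congr (zval s _ / _).
  exact: dom_ext.
- move=> U s gs; apply: zgenr_generates => p.
  pose p' : {y | oset U y} := exist _ (x (sval p)) (svalP p).
  have [d [a [b [ad bd bx ax sE]]]] := generates_zgenr deg1 p' gs.
  exists 0%N, (a / u ^+ (d + 1)), (b / u ^+ d); split.
  + exact: (gH_RS0 (sA := sA) ARS hu RSu).
  + exact: (gH_RS0 (sA := sA) ARS hu RSu).
  + exact/(imm_pt_zD sg2 ARS Au hu u0 RSu Adec _ bd).
  + exact/(imm_pt_zD sg2 ARS Au hu u0 RSu Adec _ ad).
  + have -> : th U s p = s p' / u by [].
    by rewrite sE addn1 exprS invfM mulrA (div_un (V := V) u0) mulrAC.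
- by move=> h j Dj; apply: zsec_ext.
Qed.
End PullbackImmersion.

(** * Linear and reciprocal maps into twisting sheaves *)

Section Tensor.
Variables (k : fieldType) (X : lrs k) (L M : omod X).
Variable mu : forall U : opens X, ('I_2 -> msec L U) -> msec M U.
Hypothesis muP : tensor_power mu.

Lemma tensor_pair2 (U : opens X) (a b : rO U) (e : msec L U) :
  mu (fun j : 'I_2 => if j == ord0 then a *: e else b *: e) =
  (a * b) *: mu (fun=> e).
Proof.
have mu0 (i : 'I_2) (f : 'I_2 -> msec L U) :
    mu (fun j => if j == i then 0 else f j) = 0.
  have := tp_linear muP i f (-1) 0 0.
  by rewrite scaleN1r oppr0 addr0 scaleN1r addNr.
have muZ (i : 'I_2) (f : 'I_2 -> msec L U) c s :
    mu (fun j => if j == i then c *: s else f j) =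
    c *: mu (fun j => if j == i then s else f j).
  by have := tp_linear muP i f c s 0; rewrite addr0 mu0 addr0.
rewrite (muZ ord0 (fun=> b *: e) a e) -scalerA; congr (_ *: _).
have swap c : (fun j : 'I_2 => if j == ord0 then e else c) =
    (fun j : 'I_2 => if j == ord_max then c else e).
  by apply/funext => j; have [->|->] : j = ord0 \/ j = ord_max
    by case: j => [[|[|//]] jP]; [left|right]; apply: val_inj.
rewrite swap muZ; congr (_ *: mu _).
by apply/funext => j; case: eqP.
Qed.

End Tensor.

Section Maps.
Variables (k : finFieldType) (K : fieldType) (i : {rmorphism k -> K}).
Variables (G : gring i) (Q : set (set K)).
Notation X := (zspace G Q).
Variables (e : nat) (V : vectType k).
Notation L := (twist G Q e).
Notation sec := (zsec (G := G) (Q := Q) e (otop _)).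

Hypothesis deg1 : forall x : zpt G Q, exists2 t, gH G 1 t & zD t x.

(** Locally all sections are multiples of one generator g of L, and the image of
    a g (x) b g in the tensor square depends only on the product a b. *)
Lemma zsec_reciprocal (rho : V -> sec) :
  (forall a v x, a != 0 -> v != 0 -> rho (a *: v) x = i a^-1 * rho v x) ->
  (forall v w x, v != 0 -> w != 0 -> v + w != 0 ->
     rho v x * rho w x = rho (v + w) x * (rho v x + rho w x)) ->
  @reciprocal_map k X L V rho.
Proof.
move=> rZ rM; split=> [a v a0 v0|M mu muP v w v0 w0 vw0].
  by apply: zsec_ext => x; rewrite rZ.
apply: (msep (o := M)) => x _.
have [U [g [Ux gg]]] := twist_invertible deg1 e x.
have hU : U `<=` otop X by [].
exists U, hU; split=> //; rewrite !(tp_res muP).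
have dec (s : sec) : exists a : rO U, mres L hU s = a *: g.
  by have [a [aE _]] := gg U (@subset_refl _ _) (mres L hU s);
     exists a; rewrite aE mres_id.
have [a aE] := dec (rho v); have [b bE] := dec (rho w).
have [c cE] := dec (rho (v + w)).
have pE (s t : sec) (a' b' : rO U) : mres L hU s = a' *: g -> mres L hU t = b' *: g ->
    mu U (fun j => mres L hU (@pair2 k X L s t j)) = (a' * b') *: mu U (fun=> g).
  move=> sE tE; rewrite -(tensor_pair2 muP); congr (mu _ _).
  by apply/funext => j; rewrite /pair2; case: ifP.
rewrite (pE _ _ a b) // (pE _ _ c (a + b)) //; last first.
  by rewrite (mresD (o := L)) aE bE scalerDl.
congr (_ *: _); apply: zsec_ext => y.
have gy := generates_zgenr deg1 y gg.
have E (s : sec) (a' : rO U) : mres L hU s = a' *: g ->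
    s (zsub hU y) = zval a' y * zval g y.
  by move=> /zsec_app/(_ y).
have := rM v w (zsub hU y) v0 w0 vw0.
rewrite (E _ _ aE) (E _ _ bE) (E _ _ cE) -mulrDl mulrACA [RHS]mulrACA.
by move/(mulIf (mulf_neq0 (zgenr_neq0 gy) (zgenr_neq0 gy))).
Qed.

Lemma zsec_linear (lam : V -> sec) :
  (forall a v w x, lam (a *: v + w) x = i a * lam v x + lam w x) ->
  @linear_map k X L V lam.
Proof. by move=> lamE a v w; apply: zsec_ext => x; rewrite lamE. Qed.

Lemma zsec_Nzero_at (s : sec) (x : X) c : (forall p, s p = c) -> zgenr e x c ->
  ~ @zero_at k X L x _ s.
Proof.
move=> sc gc /(@zero_at_van _ _ _ _ _ _ _ _ (exist (fun y => oset (otop (zpt G Q)) y) x I)).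
by rewrite sc; apply: zgenr_Nvan.
Qed.

End Maps.

(** * Finite vector spaces *)

Section FiniteVect.
Variable k : finFieldType.
Notation q := #|k|.

Lemma card_pchar0 (K : fieldType) (i : {rmorphism k -> K}) n : (0 < n)%N ->
  ((q ^ n)%:R : K) = 0.
Proof.
move=> n0; rewrite -(prednK n0) expnS natrM.
have /(congr1 i) : (#|k|%:R : k) = 0.
  have T1 : (1%R : k) \in [set: k]%G by rewrite inE.
  have := expg_cardG T1; rewrite cardsT zmodXgE => ->.
  by [].
by rewrite rmorph_nat rmorph0 => ->; rewrite mul0r.
Qed.

Lemma expf_card_pow (a : k) n : a ^+ (q ^ n) = a.
Proof.
elim: n => [|n IH]; first by rewrite expn0 expr1.
by rewrite expnSr exprM IH expf_card.
Qed.

Lemma card_finvect (A : vectType k) : #|finvect_type A| = (q ^ \dim {: A})%N.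
Proof.
pose b := vbasis {: A}; have bb : basis_of fullv b by exact: vbasisP.
pose f : finvect_type A -> 'rV[k]_(\dim {: A}) := @passmx.rVof _ _ b.
have fb : bijective f.
  by exists (passmx.vecof b); [exact: (passmx.rVofK bb)|exact: (passmx.vecofK bb)].
by rewrite (bij_eq_card fb) card_mx mul1n.
Qed.

Lemma card_subspace (A : vectType k) (U : {vspace A}) :
  #|[pred a : finvect_type A | (a : A) \in U]| = (q ^ \dim U)%N.
Proof.
have -> : \dim U = \dim {: subvs_of U} by rewrite [RHS]dimvf.
rewrite -card_finvect.
pose f : finvect_type (subvs_of U) -> finvect_type A := @vsval k A U.
have fi : injective f := @subvs_inj k A U.
rewrite -(card_image fi predT); apply: eq_card => a.
apply/idP/fintype.imageP => [|[w _ ->]]; last by rewrite inE subvsP.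
by rewrite inE => aU; exists (vsproj U a) => //; rewrite /f vsprojK.
Qed.

(** All fibres of a surjective linear map are translates of each other. *)
Lemma card_fibre (A B : vectType k) (f : A -> B) (b : B) : linear f ->
  (forall c, exists a, f a = c) ->
  #|[pred a : finvect_type A | f a == b]| = (q ^ (\dim {: A} - \dim {: B}))%N.
Proof.
move=> fl fs; pose F b := [pred a : finvect_type A | f a == b].
have fD u v : f (u + v) = f u + f v by have := fl 1 u v; rewrite !scale1r.
have fN u v : f (u - v) = f u - f v.
  by rewrite addrC -scaleN1r fl scaleN1r addrC.
have tr c : #|F c| = #|F b|.
  have [a0 a0E] := fs (c - b).
  rewrite -(card_image (addIr (a0 : finvect_type A)) (F b)).
  apply: eq_card => a; apply/idP/fintype.imageP => [|[d /eqP dF ->]].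
    move=> /eqP ac; exists ((a : A) - a0); last by rewrite subrK.
    by rewrite inE fN ac a0E opprB addrC subrK.
  by rewrite inE fD dF a0E addrC subrK.
have cE : (q ^ \dim {: A} = q ^ \dim {: B} * #|F b|)%N.
  rewrite -!card_finvect -[LHS]sum1_card.
  rewrite (partition_big (fun a => f a : finvect_type B) xpredT) //=.
  rewrite -sum_nat_const; apply: eq_bigr => c _.
  by rewrite -(tr c) -sum1_card; apply: eq_bigl => a; rewrite !inE.
have q1 : (1 < q)%N := finNzRing_gt1 k.
have F0 : (0 < #|F b|)%N.
  by have [a ab] := fs b; apply/card_gt0P; exists a; rewrite inE ab.
have dBA : (\dim {: B} <= \dim {: A})%N.
  by rewrite -(leq_exp2l _ _ q1) cE leq_pmulr.
move/eqP: cE; rewrite -[in X in X == _](subnKC dBA) expnD.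
by rewrite eqn_pmul2l ?expn_gt0 ?(ltnW q1) // => /eqP ->.
Qed.

Lemma closed_vspace (V : vectType k) (P : V -> Prop) : P 0 ->
  (forall v w, P v -> P w -> P (v + w)) -> (forall a v, P v -> P (a *: v)) ->
  exists U : {vspace V}, forall v, v \in U <-> P v.
Proof.
move=> P0 PD PZ.
pose s := [seq v <- enum (finvect_type V) | `[< P v >]].
exists <<s : seq V>>%VS => v; split; last first.
  move=> Pv; apply: memv_span; rewrite mem_filter; apply/andP; split; first exact/asboolP.
  have vs : (v : finvect_type V) \in enum (finvect_type V) by rewrite mem_enum.
  exact: vs.
move=> vs; rewrite (coord_span (X := in_tuple s) vs); apply: big_ind => // j _; apply: PZ.
have /(mem_nth 0) : (j < size s)%N by [].
by rewrite mem_filter => /andP [/asboolP].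
Qed.

Lemma ex_dual1 (V : vectType k) (v : V) : v != 0 ->
  exists l : 'Hom(V, k^o), l v = 1.
Proof.
move=> v0; have [j cj] : exists j, coord (vbasis {: V}) j v != 0.
  apply: contrapT => nj; case/eqP: v0; rewrite (coord_vbasis (memvf v)).
  apply: big1 => j _; have [->|cj] := eqVneq (coord (vbasis {: V}) j v) 0.
    by rewrite scale0r.
  by case: nj; exists j.
exists ((coord (vbasis {: V}) j v)^-1 *: linfun (coord (vbasis {: V}) j : V -> k^o)).
by rewrite scale_lfunE lfunE /= -[_ *: _]/(_ * _) mulVf.
Qed.

(** Evaluation at a basis of U maps V to a space of smaller dimension. *)
Lemma ex_annihilator (V : vectType k) (U : {vspace 'Hom(V, k^o)}) :
  U != fullv -> exists2 v : V, v != 0 & forall l, l \in U -> l v = 0.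
Proof.
move=> Uf; pose n := \dim U; pose bas := vbasis U.
pose f (v : V) : 'rV[k]_n := \row_j (bas`_j : 'Hom(V, k^o)) v.
have fl : linear f.
  by move=> a v w; apply/rowP => j; rewrite !mxE linearP.
pose F := linfun (HB.pack_for {linear V -> 'rV[k]_n} f (GRing.isLinear.Build _ _ _ _ f fl)).
have : (lker F != 0)%VS.
  apply: contra Uf => /eqP kF0; rewrite eqEdim subvf /=.
  have := limg_ker_dim F fullv; rewrite kF0 capv0 dimv0 add0n => dF.
  have : (\dim (limg F) <= n)%N.
    by rewrite (leq_trans (dimvS (subvf _))) // dimvf /dim /= mul1n.
  have -> : \dim {: 'Hom(V, k^o)} = \dim {: V} by rewrite dimvf /dim /= muln1 -dimvf.
  by rewrite dF.
rewrite -subv0 => /subvPn [v vK v0].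
exists v; first by apply: contra v0 => /eqP ->; exact: mem0v.
move=> l lU; rewrite (coord_vbasis lU) sum_lfunE big1 // => j _.
move: vK; rewrite memv_ker lfunE /= => /eqP /rowP /(_ j); rewrite !mxE.
by rewrite scale_lfunE => ->; rewrite scaler0.
Qed.

(** By homogeneity, each of the q - 1 non-zero values of l contributes the same
    amount to the sum on the right, and q - 1 = -1 in K.  The point of the
    formula is that its right-hand side is linear in l. *)
Lemma sum_level1 (K : fieldType) (i : {rmorphism k -> K}) (V : vectType k)
  (rho : V -> K) (l : 'Hom(V, k^o)) :
  (forall a v, a != 0 -> v != 0 -> rho (a *: v) = i a^-1 * rho v) ->
  \sum_(v : finvect_type V | (v != 0) && (l v == 1)) rho v =
  - \sum_(v : finvect_type V | v != 0) i (l v) * rho v.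
Proof.
move=> rZ; set S := LHS.
rewrite (partition_big (fun v : finvect_type V => l v : k) xpredT) //=.
have lev a : a != 0 ->
    \sum_(v : finvect_type V | (v != 0) && (l v == a :> k)) i (l v) * rho v = S.
  move=> a0; have sK : cancel (fun v : finvect_type V => a *: (v : V) : finvect_type V)
      (fun v : finvect_type V => a^-1 *: (v : V) : finvect_type V).
    by move=> v; rewrite scalerA mulVf // scale1r.
  rewrite (reindex_inj (can_inj sK)) /=; apply: eq_big => v.
    have -> : l (a *: (v : V)) = a * l v :> k by rewrite linearZ.
    by rewrite scaler_eq0 (negbTE a0) /= -{2}[a]mulr1 (inj_eq (mulfI a0)).
  rewrite scaler_eq0 (negbTE a0) /= => /andP [v0 /eqP ->].
  by rewrite rZ // mulrA -rmorphM divff // rmorph1 mul1r.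
rewrite (bigD1 (0 : k)) //= big1 ?add0r => [|v /andP [_ /eqP ->]]; last first.
  by rewrite rmorph0 mul0r.
rewrite (eq_bigr (fun=> S)) // sumr_const.
have -> : #|[pred a : k | a != 0]| = q.-1 by rewrite -(cardC1 (0 : k)).
apply/eqP; rewrite eq_sym eqr_oppLR -addr_eq0 -mulrSr prednK; last first.
  exact: ltnW (finNzRing_gt1 k).
have q0 := card_pchar0 i (n := 1) isT; rewrite expn1 in q0.
by rewrite -mulr_natr q0 mulr0.
Qed.

End FiniteVect.

(** * The universal linear and reciprocal maps *)

Section Vec.
Variables (k : fieldType) (V : vectType k).

Lemma vec_linear a (v w : V) : vec (a *: v + w) = KV_const V a * vec v + vec w.
Proof.
rewrite /vec /KV_const /= -tofracM -tofracD; congr tofrac.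
rewrite /lin mulr_sumr -big_split; apply: eq_bigr => j _ /=.
by rewrite linearP scalerDl -scalerA mul_mpolyC.
Qed.

Lemma vec0 : vec (0 : V) = 0.
Proof.
have := vec_linear (-1) (0 : V) 0.
by rewrite scaler0 addr0 rmorphN1 mulN1r addNr.
Qed.

Lemma vecD (v w : V) : vec (v + w) = vec v + vec w.
Proof. by rewrite -[v in LHS]scale1r vec_linear rmorph1 mul1r. Qed.

Lemma vecZ a (v : V) : vec (a *: v) = KV_const V a * vec v.
Proof. by rewrite -[_ *: _]addr0 vec_linear vec0 addr0. Qed.

Lemma vecB (v w : V) : vec (v - w) = vec v - vec w.
Proof. by rewrite vecD -scaleN1r vecZ rmorphN1 mulN1r. Qed.

Lemma vec_inj : injective (@vec k V).
Proof.
move=> v w /eqP; rewrite -subr_eq0 -vecB => vw; apply/eqP; rewrite -subr_eq0.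
by apply: contraTT vw; exact: vec_neq0.
Qed.

Lemma SV_gen : @SV k V `<=` gen_alg (@KV_const k V) [set vec v | v in setT].
Proof.
have sB := gen_alg_subalg (@KV_const k V) [set vec v | v in setT].
move=> _ [f ->]; elim/mpolyind: f => [|c m p _ _ IH].
  by rewrite tofrac0; exact: (sa_0 sB).
rewrite tofracD; apply: (sa_D sB) => //.
rewrite -mul_mpolyC tofracM; apply: (sa_M sB); first exact: (sa_k sB c).
rewrite mpolyXE_id rmorph_prod; apply: big_ind => [||j _]; first exact: (sa_1 sB).
  exact: (sa_M sB).
rewrite rmorphXn; apply: (sa_X sB); apply: sub_gen_alg.
exists ((vbasis {: V})`_j) => //; rewrite /vec /lin; congr tofrac.
rewrite (bigD1 j) //= coord_free ?(basis_free (vbasisP _)) // eqxx scale1r.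
rewrite big1 ?addr0 // => l lj.
by rewrite coord_free ?(basis_free (vbasisP _)) // eq_sym (negbTE lj) scale0r.
Qed.

Lemma RV_gen : @RV k V `<=`
  gen_alg (@KV_const k V) [set (vec v)^-1 | v in [set v | v != 0]].
Proof.
move=> a Ra; apply: Ra; first exact: gen_alg_subalg.
by move=> _ [v v0 ->]; apply: sub_gen_alg; exists v.
Qed.

Lemma sg2N : (-1) * (-1) = 1 :> int. Proof. by []. Qed.
Lemma sg2P : 1 * 1 = 1 :> int. Proof. by []. Qed.

Lemma PV_scheme : is_scheme (PV V).
Proof. exact: (proj_scheme sg2P (@univP_deg k V) SV_gen). Qed.
Lemma QV_scheme : is_scheme (QV V).
Proof. exact: (proj_scheme sg2N (@univQ_deg k V) RV_gen). Qed.

Lemma PV_deg1 (x : PV V) : exists2 t, gH (Sgr V) 1 t & zD t x.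
Proof. exact: (proj_deg1 (@univP_deg k V) SV_gen). Qed.
Lemma QV_deg1 (x : QV V) : exists2 t, gH (Rgr V) 1 t & zD t x.
Proof. exact: (proj_deg1 (@univQ_deg k V) RV_gen). Qed.

End Vec.

Lemma inv_reciprocal (F : fieldType) (a b : F) : a != 0 -> b != 0 -> a + b != 0 ->
  a^-1 * b^-1 = (a^-1 + b^-1) * (a + b)^-1.
Proof. by move=> a0 b0 ab0; field; rewrite ab0 b0. Qed.

Section Fiberwise.
Variables (k : finFieldType) (V : vectType k).

(** The relation 1/v * 1/w = 1/(v+w) * (1/v + 1/w), where v + w <> 0, shows that
    if neither 1/v nor 1/w is in the prime ideal x, then 1/(v+w) is not either. *)
Lemma QV_support (x : QV V) : exists2 U : {vspace V}, U != 0%VS &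
  forall v, v != 0 -> v \in U <-> zD (vec v)^-1 x.
Proof.
have xP := zp_prime x.
have RVv (v : V) : gA (Rgr V) (vec v)^-1 := (univQ_deg v).1.
pose P (v : V) := v = 0 \/ zD (vec v)^-1 x.
have PZ a v : P v -> P (a *: v).
  have [->|a0] := eqVneq a 0; first by rewrite scale0r; left.
  move=> [->|vx]; [by left; rewrite scaler0|right=> /=].
  rewrite vecZ invfM -fmorphV => avx; apply: vx.
  rewrite -[_^-1]mul1r -(rmorph1 (KV_const V)) -(divff a0) rmorphM -mulrA.
  by apply: (pi_M xP) => //; exact: (sa_k (RV_subalg V)).
have PD v w : P v -> P w -> P (v + w).
  move=> [->|vx]; first by rewrite add0r.
  move=> [->|wx]; first by rewrite addr0; right.
  have [->|vw0] := eqVneq (v + w) 0; [by left|right=> vwx].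
  have v0 := zD_neq0 vx; have w0 := zD_neq0 wx; rewrite !invr_eq0 in v0 w0.
  have E : (vec v)^-1 * (vec w)^-1 =
      ((vec v)^-1 + (vec w)^-1) * (vec (v + w))^-1.
    by have := vec_neq0 vw0; rewrite vecD => /(inv_reciprocal v0 w0).
  suff : zp x ((vec v)^-1 * (vec w)^-1) by case/(pi_prime xP (RVv v) (RVv w)).
  rewrite E; apply: (pi_M xP) => //.
  exact: (sa_D (RV_subalg V) (RVv v) (RVv w)).
have [|U UP] := closed_vspace _ PD PZ; first by left.
exists U => [|v v0]; last first.
  by rewrite UP; split=> [[/eqP|//]|]; [rewrite (negbTE v0)|right].
have [v v0 vx] := proj_cover (@RV_gen k V) x.
by apply/eqP => U0; have /UP := or_intror vx : P v; rewrite U0 memv0 (negbTE v0).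
Qed.

(** g_V of the universal reciprocal map. *)
Definition g_univ (l : 'Hom(V, k^o)) : KV V :=
  \sum_(v : finvect_type V | (v != 0) && (l v == 1)) (vec (v : V))^-1.

Lemma vecVZ a (v : V) : a != 0 -> v != 0 ->
  (vec (a *: v))^-1 = KV_const V a^-1 * (vec v)^-1.
Proof. by move=> _ _; rewrite vecZ invfM fmorphV. Qed.

Lemma g_univE l :
  g_univ l = - \sum_(v : finvect_type V | v != 0) KV_const V (l v) * (vec (v : V))^-1.
Proof. exact: (sum_level1 (rho := fun v : V => (vec v)^-1) l vecVZ). Qed.

Lemma g_univ_linear a l l' : g_univ (a *: l + l') = KV_const V a * g_univ l + g_univ l'.
Proof.
rewrite !g_univE mulrN -opprD; congr (- _); rewrite mulr_sumr -big_split.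
apply: eq_bigr => v _ /=.
transitivity ((KV_const V a * KV_const V (l v) + KV_const V (l' v)) * (vec (v : V))^-1).
  by congr (_ * _); rewrite -rmorphM -rmorphD add_lfunE scale_lfunE.
by rewrite mulrDl mulrA.
Qed.

Lemma g_univ_deg l : gH (Rgr V) 1 (g_univ l).
Proof.
apply: big_ind => [||v _]; [exact: gH_0|exact: gH_D|exact: univQ_deg].
Qed.

(** If all g_univ l were in x, then so would be the sums of l(v)/v over the
    support U of x.  Contracting them with a basis of U gives the sum of v/v over
    the non-zero v in U, which is #|U| - 1 = -1. *)
Lemma g_univ_fiberwise (x : QV V) : exists l, zD (g_univ l) x.
Proof.
apply: contrapT => nl; have xP := zp_prime x.
have lx l : zp x (g_univ l) by apply: contrapT => ?; apply: nl; exists l.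
have [U U0 UP] := QV_support x.
have sR := RV_subalg V.
have RVv (v : V) : RV (vec v)^-1 := (univQ_deg v).1.
pose N : KV V := \prod_(v : finvect_type V | (v != 0) && ((v : V) \in U)) (vec (v : V))^-1.
have prodR (P : pred (finvect_type V)) :
    RV (\prod_(v : finvect_type V | P v) (vec (v : V))^-1).
  by apply: big_ind => [||v _ //]; [exact: (sa_1 sR)|exact: (sa_M sR)].
have [NR Nx] : RV N /\ ~ zp x N.
  apply: (big_rec (fun c => RV c /\ ~ zp x c)) => [|v c /andP [v0 vU] [cR cx]].
    by split; [exact: (sa_1 sR)|exact: (pi_1 xP)].
  split; first exact: (sa_M sR).
  by move=> /(pi_prime xP (RVv v) cR) [|//]; apply/UP.
pose b j := (vbasis U)`_j; pose c j : 'Hom(V, k^o) := linfun (coord (vbasis U) j : V -> k^o).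
pose y j := \sum_(v : finvect_type V | (v != 0) && ((v : V) \in U))
  KV_const V (c j v) * (vec (v : V))^-1.
have yx j : zp x (y j).
  have : zp x (- g_univ (c j)) by rewrite -sub0r; apply: (pi_B xP); [exact: pi_0 xP|].
  rewrite g_univE opprK (bigID (fun v : finvect_type V => (v : V) \in U)) /=.
  rewrite -/(y j) => sx; rewrite -[y j](addrK (\sum_(v : finvect_type V |
    (v != 0) && ((v : V) \notin U)) KV_const V (c j v) * (vec (v : V))^-1)).
  apply: (pi_B xP) => //; apply: (prime_big xP) => v /andP [v0 vU].
  apply: (pi_M xP); first exact: (sa_k sR).
  by apply: contrapT => /(UP _ v0); apply/negP.
have bN j : RV (vec (b j) * N).
  have [->|b0] := eqVneq (b j) 0; first by rewrite vec0 mul0r; exact: (sa_0 sR).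
  have bU : b j \in U.
    have [jn|nj] := ltnP j (\dim U); last first.
      by case/eqP: b0; rewrite /b nth_default ?size_tuple.
    by apply: (vbasis_mem (v := b j)); apply: mem_nth; rewrite size_tuple.
  rewrite /N (bigD1 (b j : finvect_type V)) /=; last by rewrite b0.
  by rewrite mulrA divff ?mul1r ?vec_neq0 //; apply: prodR.
have : zp x (\sum_(j < \dim U) vec (b j) * N * y j).
  by apply: (prime_big xP) => j _; apply: (pi_M xP); [exact: bN|exact: yx].
have -> : \sum_(j < \dim U) vec (b j) * N * y j = - N; last first.
  by move=> Nx'; apply: Nx; rewrite -[N]opprK -sub0r; apply: (pi_B xP) => //; exact: pi_0 xP.
under eq_bigr => j _ do rewrite mulrAC mulrC /y mulr_sumr.
rewrite -mulr_sumr exchange_big /=.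
have E (v : finvect_type V) : (v != 0) && ((v : V) \in U) ->
    \sum_(j < \dim U) vec (b j) * (KV_const V (c j v) * (vec (v : V))^-1) = 1.
  move=> /andP [v0 vU].
  have vE : vec (v : V) = \sum_(j < \dim U) KV_const V (c j v) * vec (b j).
    have -> : vec (v : V) = vec (\sum_(j < \dim U) coord (vbasis U) j v *: b j).
      by congr vec; exact: coord_vbasis.
    rewrite (big_morph _ (@vecD _ V) (@vec0 _ V)); apply: eq_bigr => j _.
    by rewrite vecZ lfunE.
  transitivity (\sum_(j < \dim U) KV_const V (c j v) * vec (b j) * (vec (v : V))^-1).
    by apply: eq_bigr => j _; rewrite mulrCA mulrA.
  by rewrite -mulr_suml -vE divff // vec_neq0.
rewrite (eq_bigr _ E) sumr_const.
have cU : #|[pred v : finvect_type V | (v != 0) && ((v : V) \in U)]|.+1 = (#|k| ^ \dim U)%N.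
  have cE : #|[pred v : finvect_type V | (v : V) \in U]| = (#|k| ^ \dim U)%N.
    exact: card_subspace.
  have z : (0 : finvect_type V) \in [pred v : finvect_type V | (v : V) \in U].
    by rewrite inE mem0v.
  rewrite -cE [RHS](cardD1 (0 : finvect_type V)) z add1n; congr _.+1.
rewrite -[RHS]mulrN1; congr (_ * _); apply/eqP; rewrite -addr_eq0 -mulrSr cU.
apply/eqP; apply: card_pchar0; first exact: (KV_const V).
by rewrite lt0n dimv_eq0.
Qed.

End Fiberwise.

Lemma reciprocal_inv (F : fieldType) (a b c : F) : a != 0 -> b != 0 -> c != 0 ->
  c^-1 = a^-1 + b^-1 -> a * b = c * (a + b).
Proof.
move=> a0 b0 c0 /(congr1 (fun z => z * (a * b) * c)).
rewrite mulrAC mulVf // mul1r => ->; field; by rewrite b0 a0.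
Qed.

Section DualProduct.
Variables (k : finFieldType) (V : nzvect k).
Notation q := #|k|.
Notation Vd := (finvect_type (dual V)).
Notation K := (KV (dual V)).
Notation cst := (KV_const (dual V)).
Notation N := (f_exp V).
Notation ev l v := ((l : 'Hom(V, k^o)) v).

Lemma dim_dual : \dim {: dual V} = \dim {: V}.
Proof. by rewrite dimvf /dim /= muln1 -dimvf. Qed.

Lemma card_level (v : V) (a : k) : v != 0 -> #|[pred l : Vd | ev l v == a]| = N.
Proof.
move=> v0; have -> : N = (q ^ (\dim {: dual V} - \dim {: k^o}))%N.
  by rewrite /f_exp dim_dual [X in (_ - X)%N]dimvf /dim /= subn1.
apply: (@card_fibre k (dual V) k^o (fun l => ev l v) a); last first.
- move=> c; have [l lv] := ex_dual1 v0; exists (c *: l).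
  by rewrite scale_lfunE lv /= -[_ *: _]/(_ * _) mulr1.
- by move=> b l l'; rewrite add_lfunE scale_lfunE.
Qed.

(** f_V of the universal linear map. *)
Definition f_univ (v : V) : K := \prod_(l : Vd | ev l v == 1) vec (l : dual V).

Lemma f_univ_neq0 v : f_univ v != 0.
Proof.
apply/prodf_neq0 => l /eqP lv; apply: vec_neq0; apply/eqP => l0.
by move/eqP: lv; rewrite l0 zero_lfunE eq_sym oner_eq0.
Qed.

Lemma prod_level (v : V) (a : k) : a != 0 -> v != 0 ->
  \prod_(l : Vd | ev l v == a) vec (l : dual V) = cst a * f_univ v.
Proof.
move=> a0 v0.
have sK : cancel (fun l : Vd => a *: (l : dual V) : Vd)
    (fun l : Vd => a^-1 *: (l : dual V) : Vd).
  by move=> l; rewrite scalerA mulVf // scale1r.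
rewrite (reindex_inj (can_inj sK)) /=.
transitivity (\prod_(l : Vd | ev l v == 1) (cst a * vec (l : dual V))).
  apply: eq_big => l; last by rewrite vecZ.
  have -> : ev (a *: (l : dual V)) v = a * ev l v :> k by rewrite scale_lfunE.
  by rewrite -{2}[a]mulr1 (inj_eq (mulfI a0)).
rewrite big_split prodr_const (card_level _ v0) -rmorphXn.
by rewrite expf_card_pow.
Qed.

Lemma f_univZ (a : k) (v : V) : a != 0 -> v != 0 -> f_univ (a *: v) = cst a^-1 * f_univ v.
Proof.
move=> a0 v0; rewrite -prod_level ?invr_eq0 //; apply: eq_bigl => l.
have -> : ev l (a *: v) = a * ev l v :> k by rewrite linearZ.
by rewrite -(inj_eq (mulfI (invr_neq0 a0))) mulrA mulVf // mul1r mulr1.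
Qed.

(** The polynomial of degree q^(r-1) with leading coefficient 1/f(v) that takes
    the value l(v) at every l of V^*: up to this factor, the product of T - l over
    the hyperplane of all l with l(v) = 0. *)
Definition interp (v : V) : {poly K} := (f_univ v)^-1 *:
  \prod_(l <- enum [pred l : Vd | ev l v == 0]) ('X - (vec (l : dual V))%:P).

Lemma size_interp v : v != 0 -> size (interp v) = N.+1.
Proof.
move=> v0; rewrite size_scale ?invr_eq0 ?f_univ_neq0 //.
by rewrite size_prod_XsubC -cardE (card_level _ v0).
Qed.

Lemma coef_interp v : v != 0 -> (interp v)`_N = (f_univ v)^-1.
Proof.
move=> v0; have := size_interp v0; rewrite coefZ.
set p := \prod_(l <- _) _ => _.
have pN : size p = N.+1 by rewrite size_prod_XsubC -cardE (card_level _ v0).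
have /monicP := monic_prod_XsubC (enum [pred l : Vd | ev l v == 0]) xpredT
  (fun l : Vd => vec (l : dual V)).
by rewrite -/p /lead_coef pN /= => ->; rewrite mulr1.
Qed.

Lemma interpE (v : V) (m : dual V) : v != 0 -> (interp v).[vec m] = cst (ev m v).
Proof.
move=> v0; rewrite hornerZ horner_prod big_enum /=.
transitivity ((f_univ v)^-1 * \prod_(l : Vd | ev l v == ev m v) vec (l : dual V)).
  congr (_ * _).
  have sI : injective (fun l : Vd => m - (l : dual V) : Vd).
    by move=> l l' /addrI /oppr_inj.
  rewrite [RHS](reindex_inj sI) /=; apply: eq_big => l; last first.
    by rewrite hornerXsubC vecB.
  have -> : ev (m - (l : dual V)) v = ev m v - ev l v by rewrite add_lfunE opp_lfunE.
  rewrite inE; apply/eqP/eqP => [->|/eqP]; first by rewrite subr0.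
  by rewrite -subr_eq0 addrAC subrr add0r oppr_eq0 => /eqP.
have [mv0|mv] := eqVneq (ev m v : k) 0; last first.
  by rewrite (prod_level mv v0) mulrCA mulVf ?mulr1 ?f_univ_neq0.
rewrite mv0 rmorph0 (bigD1 (0 : Vd)) /=; last by rewrite zero_lfunE.
by rewrite vec0 mul0r mulr0.
Qed.

(** interp (v + w) - interp v - interp w vanishes at all q^r elements of V^*, but
    has degree at most q^(r-1); so the leading coefficients add up. *)
Lemma f_univ_invD (v w : V) : v != 0 -> w != 0 -> v + w != 0 ->
  (f_univ (v + w))^-1 = (f_univ v)^-1 + (f_univ w)^-1.
Proof.
move=> v0 w0 vw0; pose p := interp (v + w) - (interp v + interp w).
suff p0 : p = 0.
  have := congr1 (fun r : {poly K} => r`_N) p0.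
  by rewrite coef0 coefB coefD !coef_interp // => /eqP; rewrite subr_eq0 => /eqP.
apply/eqP; apply: contraT => pn0.
have := max_poly_roots pn0 (rs := [seq vec (l : dual V) | l <- enum Vd]) _ _.
rewrite map_inj_uniq ?enum_uniq; last exact: (@vec_inj k (dual V)).
have eN : size (enum Vd) = (q ^ \dim {: V})%N by rewrite -dim_dual -card_finvect cardT.
rewrite size_map eN.
have -> : all (root p) [seq vec (l : dual V) | l <- enum Vd].
  apply/allP => _ /mapP [l _ ->]; rewrite /root /p hornerD hornerN hornerD !interpE //.
  by rewrite -rmorphD -rmorphB /= linearD subrr rmorph0.
have ps : (size p <= N.+1)%N.
  apply: leq_trans (size_polyD _ _) _; rewrite geq_max size_polyN size_interp // leqnn.
  by apply: leq_trans (size_polyD _ _) _; rewrite geq_max !size_interp // leqnn.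
move=> /(_ isT (enum_uniq _)) lt; have := leq_trans lt ps; rewrite ltnS /f_exp.
by rewrite leq_exp2l ?finNzRing_gt1 // -ltnS prednK ?ltnn // nzvP.
Qed.

Lemma f_univM (v w : V) : v != 0 -> w != 0 -> v + w != 0 ->
  f_univ v * f_univ w = f_univ (v + w) * (f_univ v + f_univ w).
Proof.
move=> v0 w0 vw0; apply: reciprocal_inv (f_univ_invD v0 w0 vw0); exact: f_univ_neq0.
Qed.

(** The l that vanish at x form a proper subspace of V^*, so some non-zero v is
    annihilated by all of them; then l(v) = 1 excludes that l vanishes at x. *)
Lemma f_univ_fiberwise (x : PV (dual V)) : exists2 v : V, v != 0 & zD (f_univ v) x.
Proof.
have xP := zp_prime x.
have vS (l : dual V) : gA (Sgr (dual V)) (vec l) := (univP_deg l).1.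
have [|||U UP] := @closed_vspace k (dual V) (fun l => zp x (vec l)).
- by rewrite vec0; exact: (pi_0 xP).
- by move=> l l' lx lx'; rewrite vecD; apply: (pi_D xP).
- move=> a l lx; rewrite vecZ; apply: (pi_M xP) => //.
  exact: (sa_k (SV_subalg (dual V))).
have [|v v0 vU] := @ex_annihilator k V U.
  apply/eqP => Uf; have [l _ lx] := proj_cover (@SV_gen k (dual V)) x.
  by apply: lx; apply/UP; rewrite Uf memvf.
exists v => //.
have [] : SV (f_univ v) /\ zD (f_univ v) x; last by [].
apply: (big_rec (fun c => SV c /\ zD c x)) => [|l c /eqP lv [cS cx]].
  by split; [exact: (sa_1 (SV_subalg (dual V)))|exact: zD1].
split; first exact: (sa_M (SV_subalg (dual V)) (vS l) cS).
move=> /(pi_prime xP (vS l) cS) [/UP /vU|//].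
by rewrite lv => /eqP; rewrite oner_eq0.
Qed.

(** The product that defines f_V is indexed by the places of an enumeration. *)
Lemma prod_f_index (R : comPzRingType) (F : dual V -> R) (v : V) : v != 0 ->
  \prod_(j < N) F (nth 0 (f_index v) j) = \prod_(l : Vd | ev l v == 1) F (l : dual V).
Proof.
move=> v0; rewrite -[RHS]big_enum [RHS](big_nth (0 : Vd)).
rewrite -cardE (card_level _ v0) big_mkord.
by [].
Qed.

End DualProduct.

(** * The commuting squares *)

Section UniversalPairs.
Variables (k : finFieldType) (V : nzvect k).

Lemma pointQ_lid : pointQ (lid (QV V)) (@univQ k V).
Proof. exact: pullback_lid. Qed.

Lemma pointP_lid : pointP (lid (PV V)) (@univP k V).
Proof. exact: pullback_lid. Qed.

Lemma univQ_reciprocal : reciprocal_map (@univQ k V).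
Proof.
apply: (zsec_reciprocal (@QV_deg1 k V)) => [a v x a0 v0|v w x v0 w0 vw0] /=.
  exact: vecVZ.
by rewrite mulrC [RHS]mulrC mulrC vecD; apply: inv_reciprocal; rewrite -?vecD vec_neq0.
Qed.

Lemma univQ_nonzero : rec_fiberwise_nonzero (@univQ k V).
Proof.
move=> x; have [v v0 vx] := proj_cover (@RV_gen k V) x; exists v => //.
apply: (zsec_Nzero_at (c := (vec v)^-1)) => //.
exact: (zgenr_hom (univQ_deg v) vx).
Qed.

Lemma univP_linear : linear_map (@univP k V).
Proof. by apply: zsec_linear => a v w x; apply: vec_linear. Qed.

Lemma univP_nonzero : lin_fiberwise_nonzero (@univP k V).
Proof.
move=> x; have [v _ vx] := proj_cover (@SV_gen k V) x; exists v.
apply: (zsec_Nzero_at (c := vec v)) => //.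
exact: (zgenr_hom (univP_deg v) vx).
Qed.

Lemma pointP_inj (X : lrs k) (L : omod X) (x y : lhom X (PV V))
  (lam lam' : V -> msec L (otop X)) :
  (forall v, lam v = lam' v) -> pointP x lam -> pointP y lam' -> x = y.
Proof.
move=> ll xl yl.
have yl' : is_pullback y (M := O1P V) setT (@univP k V) lam.
  by apply: pullback_ext yl => v _; rewrite ll.
exact: (pullback_inj sg2P (@SV_gen k V) xl yl').
Qed.

Lemma pointQ_inj (X : lrs k) (L : omod X) (x y : lhom X (QV V))
  (rho rho' : V -> msec L (otop X)) :
  (forall v, v != 0 -> rho v = rho' v) -> pointQ x rho -> pointQ y rho' -> x = y.
Proof.
move=> rr xr yr.
have yr' : is_pullback y (M := O1Q V) [set v | v != 0] (@univQ k V) rho.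
  by apply: pullback_ext yr => v v0; rewrite rr.
exact: (pullback_inj sg2N (@RV_gen k V) xr yr').
Qed.

End UniversalPairs.

Section Omega.
Variables (k : finFieldType) (V : nzvect k).
Notation Omega := (OmegaV V).
Notation S := (spec_gring (@RSV0_subalg k V)).
Notation O := (twist S setT 0).

Lemma RSV0_ratio (v w : V) : v != 0 -> @RSV0 k V (vec w / vec v).
Proof.
move=> v0; split.
  apply: (sa_M (RSV_subalg V)); first exact: (SV_RSV (SV_vec w)).
  exact: (RV_RSV (RV_vec v0)).
rewrite -(subrr 1); apply: hdeg_M; first exact: hdeg_vec.
exact: (hdeg_V (hdeg_vec v)).
Qed.

Lemma ratio_zD (v w : V) (x : Omega) : v != 0 -> w != 0 -> zD (vec w / vec v) x.
Proof.
move=> v0 w0 wx; apply: (pi_1 (zp_prime x)).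
have <- : vec v / vec w * (vec w / vec v) = 1.
  by rewrite mulrA divfK ?divff ?vec_neq0.
by apply: (pi_M (zp_prime x)) => //; exact: RSV0_ratio.
Qed.

(** On Omega the universal sections of O(1) become functions, by the
    trivializations 1/v0 and v0 of O(1) on Q and on P. *)
Definition omegaQ (v : V) : msec (O : omod Omega) (otop _) :=
  hom_section setT (imm_ratio (RV_subalg V) (@RV_RSV k V)
    (hdeg_V (hdeg_vec (v0 V))) (@RSV_vecVV k V) (@univQ_deg k V) v).

Definition omegaP (v : V) : msec (O : omod Omega) (otop _) :=
  hom_section setT (imm_ratio (SV_subalg V) (@SV_RSV k V)
    (hdeg_vec (v0 V)) (RV_RSV (RV_vec (v0_neq0 V))) (@univP_deg k V) v).

Lemma pointQ_inc : pointQ (incQ V) omegaQ.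
Proof. apply: pullback_imm; exact: QV_deg1. Qed.

Lemma pointP_inc : pointP (incP V) omegaP.
Proof. apply: pullback_imm; exact: PV_deg1. Qed.

Let odeg1 (x : Omega) : exists2 t, gH S 1 t & zD t x.
Proof. exact: spec_deg1. Qed.

Lemma omegaQ_reciprocal : reciprocal_map omegaQ.
Proof.
apply: (zsec_reciprocal odeg1) => [a v x a0 v0|v w x v0 w0 vw0] /=.
  by rewrite vecVZ // mulrA.
rewrite -mulrDl !mulf_div; congr (_ / _); rewrite [RHS]mulrC vecD.
by apply: inv_reciprocal; rewrite -?vecD vec_neq0.
Qed.

Lemma omegaQ_invertible : rec_fiberwise_invertible omegaQ.
Proof.
move=> x v v0; apply: (zsec_Nzero_at (c := (vec v)^-1 / (vec (Defs.v0 V))^-1)) => //.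
rewrite invrK mulrC; apply: zgenr_hom; first exact: RSV0_ratio.
by apply: ratio_zD => //; exact: v0_neq0.
Qed.

Lemma omegaP_linear : linear_map omegaP.
Proof.
by apply: zsec_linear => a v w x /=; rewrite vec_linear mulrDl mulrA.
Qed.

Lemma omegaP_injective : lin_fiberwise_injective omegaP.
Proof.
move=> x v w; apply: contraPP => /eqP vw.
apply: (zsec_Nzero_at (c := vec (v - w) / vec (Defs.v0 V))).
  by move=> p; rewrite zvalD zvalN /= vecB mulrBl.
have vw0 : v - w != 0 by rewrite subr_eq0.
apply: zgenr_hom; first by apply: RSV0_ratio; exact: v0_neq0.
by apply: ratio_zD => //; exact: v0_neq0.
Qed.

Lemma Omega_scheme : is_scheme Omega.
Proof. exact: spec_scheme. Qed.

Lemma twist_Omega_invertible : invertible (O : omod Omega).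
Proof. exact: twist_invertible odeg1 0. Qed.

End Omega.

Section OmegaSquares.
Variables (k : finFieldType) (V : nzvect k).

(** The identity of Omega, seen as a point of Q_V, is incQ.  So both
    characterizations apply to the same pair, and yield the same linear map. *)
Lemma Omega_g (g : lhom (QV V) (PV (dual V)))
  (gO : lhom (OmegaV V) (OmegaV (dual V))) : is_gV g -> is_gOmega gO ->
  lcomp g (incQ V) = lcomp (incP (dual V)) gO.
Proof.
move=> gP gOP; have S := @Omega_scheme k V; have I := @twist_Omega_invertible k V.
have R := omegaQ_reciprocal V; have F := omegaQ_invertible (V := V).
have F' : rec_fiberwise_nonzero (@omegaQ k V).
  by move=> x; exists (v0 V); [exact: v0_neq0|apply: F; exact: v0_neq0].
have P1 := gP _ _ _ _ S I R F' (pointQ_inc V).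
have P2 := gOP _ _ _ (lid _) S I R F.
rewrite !lcomp_lid in P2.
exact: (pointP_inj (fun _ => erefl) P1 (P2 (pointQ_inc V))).
Qed.

Lemma Omega_f (f : lhom (PV (dual V)) (QV V))
  (fO : lhom (OmegaV (dual V)) (OmegaV V)) : is_fV f -> is_fOmega fO ->
  lcomp f (incP (dual V)) = lcomp (incQ V) fO.
Proof.
move=> fP fOP; have S := @Omega_scheme k (dual V).
have I := @twist_Omega_invertible k (dual V).
have R := @omegaP_linear k (dual V); have F := omegaP_injective (V := dual V).
have F' : lin_fiberwise_nonzero (@omegaP k (dual V)).
  move=> x; exists (v0 (dual V)) => z.
  have /F : zero_at x (omegaP (v0 (dual V)) - omegaP 0).
    rewrite (_ : omegaP 0 = 0) ?subr0 //; apply: zsec_ext => p /=.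
    by rewrite vec0 mul0r.
  by apply/eqP; exact: v0_neq0.
have e : 0%N = (f_exp V * 0)%N by rewrite muln0.
have T := zprod_tensor (spec_deg1 (sA := @RSV0_subalg k (dual V))) e.
have P1 := fP _ _ _ _ _ _ S I T R F' (pointP_inc (dual V)).
have P2 := fOP _ _ _ _ _ (lid _) S I T R F.
rewrite !lcomp_lid in P2.
exact: (pointQ_inj (fun _ _ => erefl) P1 (P2 (pointP_inc (dual V)))).
Qed.

End OmegaSquares.

Section UniversalImages.
Variables (k : finFieldType) (V : nzvect k).

Lemma g_mapE (X : lrs k) (L : omod X) (rho : V -> msec L (otop X)) l :
  g_map rho l = \sum_(v : finvect_type V | (v != 0) && ((l : 'Hom(V, k^o)) v == 1)) rho v.
Proof. by []. Qed.

Lemma g_map_univQ (l : dual V) x : zval (g_map (@univQ k V) l : zsec 1 _) x = g_univ l.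
Proof. exact: zval_sum. Qed.

Lemma g_sect_linear : linear_map (g_map (@univQ k V)).
Proof. by apply: zsec_linear => a l l' x; rewrite !g_map_univQ; apply: g_univ_linear. Qed.

Lemma g_sect_nonzero : lin_fiberwise_nonzero (g_map (@univQ k V)).
Proof.
move=> x; have [l lx] := g_univ_fiberwise x; exists l.
apply: (zsec_Nzero_at (c := g_univ l)); first by move=> p; rewrite g_map_univQ.
exact: (zgenr_hom (g_univ_deg l) lx).
Qed.

Notation twistP := (twist (Sgr (dual V)) (proj_prime (Sgr (dual V)))).

Definition f_sect : V -> msec (twistP (f_exp V * 1)) (otop _) :=
  @f_map k V (PV (dual V)) (O1P (dual V)) (twistP (f_exp V * 1))
    (zprod (erefl (f_exp V * 1)%N)) (@univP k (dual V)).

Lemma f_sectE (v : V) x : v != 0 -> zval (f_sect v) x = f_univ v.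
Proof. by move=> v0; apply: (prod_f_index (fun l : dual V => vec l) v0). Qed.

Lemma f_univ_deg (v : V) : v != 0 -> gH (Sgr (dual V)) (f_exp V * 1) (f_univ v).
Proof.
move=> v0; rewrite /f_univ -(prod_f_index (fun l : dual V => vec l) v0).
elim: (f_exp V) => [|n IH]; first by rewrite big_ord0; exact: gH_1.
by rewrite big_ord_recr mulSn addnC; apply: gH_M => //; exact: univP_deg.
Qed.

End UniversalImages.

Section Restriction.
Variables (k : finFieldType) (V : nzvect k) (V' : {vspace V}) (hV' : V' != 0%VS).
Notation W := (sub_nzvect hV').
Notation q := #|k|.
Let r'' := (\dim {: V} - \dim V')%N.

Lemma extend0_neq0 (S : lrs k) (L : omod S) (rho : W -> msec L (otop S)) (w : W) :
  extend0 rho (vsval w) = rho w.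
Proof. by rewrite /extend0 subvsP vsvalK. Qed.

Lemma vsproj_neq0 (v : V) : v \in V' -> v != 0 -> vsproj V' v != 0.
Proof. by move=> vV'; apply: contra => /eqP e; rewrite -(vsprojK vV') e linear0. Qed.

Lemma extend0_univQE (v : V) x : zval (extend0 (@univQ k W) v : zsec 1 _) x =
  if v \in V' then (vec (vsproj V' v : W))^-1 else 0.
Proof. by rewrite /extend0; case: ifP. Qed.

(** Extension by zero preserves the reciprocal relation because V' is a subspace:
    v + w lies outside of V' if exactly one of v and w does. *)
Lemma extend0_reciprocal : reciprocal_map (extend0 (@univQ k W)).
Proof.
apply: (zsec_reciprocal (@QV_deg1 k W)) => [a v x a0 v0|v w x v0 w0 vw0].
  rewrite !extend0_univQE rpredZeq (negbTE a0) /=.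
  case: ifP => vV'; last by rewrite mulr0.
  by rewrite linearZ; apply: vecVZ => //; apply: vsproj_neq0.
rewrite !extend0_univQE; case: ifP => vV'; last first.
  rewrite mul0r add0r; case: ifP => vwV'; last by rewrite mul0r.
  case: ifP => wV'; last by rewrite mulr0.
  by have := memvB vwV' wV'; rewrite addrK vV'.
case: ifP => wV'; last first.
  rewrite mulr0 addr0; case: ifP => vwV'; last by rewrite mul0r.
  by have := memvB vwV' vV'; rewrite addrAC subrr add0r wV'.
have vwV' := memvD vV' wV'; rewrite vwV' linearD /= [RHS]mulrC vecD.
have := vec_neq0 (vsproj_neq0 vwV' vw0); rewrite linearD vecD.
by apply: inv_reciprocal; apply: vec_neq0; apply: vsproj_neq0.
Qed.

Lemma extend0_nonzero : rec_fiberwise_nonzero (extend0 (@univQ k W)).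
Proof.
move=> x; have [w w0 wx] := univQ_nonzero x; exists (vsval w).
  by apply: contra w0 => /eqP e; apply/eqP/subvs_inj; rewrite e linear0.
by rewrite extend0_neq0.
Qed.

Lemma g_map_extend0 (l : dual V) :
  g_map (extend0 (@univQ k W)) l = g_map (@univQ k W) (dual_proj hV' l).
Proof.
rewrite !g_mapE /extend0 -big_mkcondr /=.
rewrite (reindex_onto (fun w : finvect_type W => vsval (w : W) : finvect_type V)
  (fun v : finvect_type V => vsproj V' (v : V) : finvect_type W)) /=; last first.
  by move=> v /andP [_ vV']; rewrite vsprojK.
apply: eq_big => w; last by rewrite vsvalK.
rewrite subvsP vsvalK eqxx !andbT comp_lfunE lfunE /=; congr (_ && _).
Qed.

(** On the universal pair of Q_V', both composites give the linear map
    g_map_extend0. *)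
Lemma square_g (gV' : lhom (QV W) (PV (dual W))) (gV : lhom (QV V) (PV (dual V)))
  (istar : lhom (QV W) (QV V)) (pistar : lhom (PV (dual W)) (PV (dual V))) :
  is_gV gV' -> is_gV gV -> is_istar istar -> is_pistar pistar ->
  lcomp gV istar = lcomp pistar gV'.
Proof.
move=> gP' gP iP pP.
have S := @QV_scheme k W; have I : invertible (O1Q W) := twist_invertible (@QV_deg1 k W) 1.
have R := @univQ_reciprocal k W; have F := @univQ_nonzero k W.
have P1 := gP' _ _ _ _ S I R F (pointQ_lid W).
have P2 := pP _ _ _ _ S I (@g_sect_linear k W) (@g_sect_nonzero k W) P1.
have P3 := iP _ _ _ _ S I R F (pointQ_lid W).
have P4 := gP _ _ _ _ S I extend0_reciprocal extend0_nonzero P3.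
rewrite !lcomp_lid in P2 P4.
exact: (pointP_inj g_map_extend0 P4 P2).
Qed.

Lemma dual_projE (l : dual V) (v : V) : v \in V' ->
  (dual_proj hV' l : 'Hom(W, k^o)) (vsproj V' v) = (l : 'Hom(V, k^o)) v.
Proof. by move=> vV'; rewrite comp_lfunE lfunE /= vsprojK. Qed.

Lemma dual_proj_linear : linear (dual_proj hV').
Proof.
move=> a l l'; apply/lfunP => w.
by rewrite add_lfunE scale_lfunE !comp_lfunE add_lfunE scale_lfunE.
Qed.

Lemma dual_proj_surj (l' : dual W) : exists l, dual_proj hV' l = l'.
Proof.
exists ((l' : 'Hom(W, k^o)) \o linfun (vsproj V'))%VF; apply/lfunP => w.
by rewrite !comp_lfunE !lfunE /= vsvalK.
Qed.

Lemma dim_sub : \dim {: W} = \dim V'.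
Proof. by rewrite dimvf. Qed.

Lemma f_exp_sub : f_exp V = (q ^ r'' * f_exp W)%N.
Proof.
have d0 : (0 < \dim V')%N by rewrite lt0n dimv_eq0.
rewrite /f_exp dim_sub -expnD; congr (_ ^ _)%N.
have := dimvS (subvf V'); rewrite /r''; case: (\dim V') d0 => // d _ dV.
by rewrite -[in LHS](subnK dV) addnS.
Qed.

Lemma extend_dual1 (v : V) : v \notin V' ->
  exists2 l : dual V, (l : 'Hom(V, k^o)) v = 1 & dual_proj hV' l = 0.
Proof.
move=> vV'; have uV : v - projv V' v != 0.
  by rewrite subr_eq0; apply: contra vV' => /eqP ->; exact: memv_proj.
have [m mE] := ex_dual1 uV.
exists (m \o (\1 - projv V'))%VF.
  by rewrite comp_lfunE add_lfunE opp_lfunE id_lfunE.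
apply/lfunP => w; rewrite /dual_proj !comp_lfunE [linfun _ w]lfunE /=.
rewrite add_lfunE opp_lfunE id_lfunE.
by rewrite projv_id ?subvsP // subrr linear0 zero_lfunE.
Qed.

(** For v in V' every l' on V' with l'(v) = 1 extends to V in q^r'' ways, all
    with l(v) = 1; for v outside of V' some l with l(v) = 1 vanishes on V'. *)
Lemma prod_dual_proj (v : V) : v != 0 ->
  \prod_(l : finvect_type (dual V) | (l : 'Hom(V, k^o)) v == 1)
    vec (dual_proj hV' (l : dual V)) =
  if v \in V' then f_univ (vsproj V' v : W) ^+ (q ^ r'') else 0.
Proof.
move=> v0; case: ifP => vV'; last first.
  have [l lv l0] := extend_dual1 (negbT vV').
  rewrite (bigD1 (l : finvect_type (dual V))) /=; last by rewrite lv.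
  by rewrite l0 vec0 mul0r.
rewrite (partition_big (fun l => dual_proj hV' l : finvect_type (dual W))
  (fun l' => (l' : 'Hom(W, k^o)) (vsproj V' v) == 1)) /=; last first.
  by move=> l; rewrite dual_projE.
rewrite /f_univ -prodrXl; apply: eq_bigr => l' /eqP lv'.
transitivity (\prod_(l : finvect_type (dual V) | dual_proj hV' (l : dual V) == l')
    vec (l' : dual W)).
  apply: eq_big => l; last by move=> /andP [_ /eqP ->].
  apply: andb_idl => /eqP pl; rewrite -(dual_projE _ vV').
  by rewrite [dual_proj _ _]pl lv'.
rewrite prodr_const; congr (_ ^+ _).
rewrite (card_fibre (l' : dual W) dual_proj_linear dual_proj_surj).
by rewrite !dim_dual dim_sub.
Qed.

Lemma univP_proj_linear : linear_map (@univP k (dual W) \o dual_proj hV').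
Proof.
by apply: zsec_linear => a l l' x /=; rewrite dual_proj_linear; apply: vec_linear.
Qed.

Lemma univP_proj_nonzero : lin_fiberwise_nonzero (@univP k (dual W) \o dual_proj hV').
Proof.
move=> x; have [l' lx] := univP_nonzero x; have [l lE] := dual_proj_surj l'.
by exists l; rewrite /= lE.
Qed.

Let P' := PV (dual W).
Let e1 := (f_exp W * 1)%N.
Let e2 := (q ^ r'' * e1)%N.
Let L1 : omod P' := twist (Sgr (dual W)) (proj_prime _) e1.
Let L2 : omod P' := twist (Sgr (dual W)) (proj_prime _) e2.

Let e2E : e2 = (f_exp V * 1)%N.
Proof. by rewrite /e2 /e1 f_exp_sub !muln1. Qed.

Definition frob_f_sect (w : W) : msec L2 (otop P') :=
  zprod (erefl e2) (fun=> f_sect w).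

Lemma frob_f_sectE (w : W) x : w != 0 ->
  zval (frob_f_sect w) x = f_univ w ^+ (q ^ r'').
Proof.
move=> w0; transitivity (\prod_(j < q ^ r'') zval (f_sect w) x); first by [].
by rewrite prodr_const card_ord f_sectE.
Qed.

Lemma frob_f_sect_reciprocal : reciprocal_map frob_f_sect.
Proof.
apply: (zsec_reciprocal (@PV_deg1 k (dual W))) => [a v x a0 v0|v w x v0 w0 vw0].
  rewrite !frob_f_sectE ?scaler_eq0 ?negb_or ?a0 // f_univZ // exprMn.
  by rewrite -rmorphXn /= expf_card_pow.
rewrite !frob_f_sectE // -exprMn f_univM // exprMn; congr (_ * _).
exact: (powq_nmod r'' (KV_const (dual W))).2.
Qed.

Lemma frob_f_sect_nonzero : rec_fiberwise_nonzero frob_f_sect.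
Proof.
move=> x; have [w w0 wx] := f_univ_fiberwise x; exists w => //.
apply: (zsec_Nzero_at (c := f_univ w ^+ (q ^ r''))).
  by move=> p; apply: frob_f_sectE.
by apply: zgenrX; apply: zgenr_hom wx; apply: f_univ_deg.
Qed.

(** On the universal pair of P_V'^*, both composites give a reciprocal map to
    O(f_exp V), which prod_dual_proj computes. *)
Lemma square_f (fV' : lhom (PV (dual W)) (QV W)) (fV : lhom (PV (dual V)) (QV V))
  (istar : lhom (QV W) (QV V)) (pistar : lhom (PV (dual W)) (PV (dual V))) :
  is_fV fV' -> is_fV fV -> is_istar istar -> is_pistar pistar ->
  lcomp fV pistar = lcomp (lcomp istar (frob r'' (QV W))) fV'.
Proof.
move=> fP' fP iP pP.
have S := @PV_scheme k (dual W).
have I e : invertible (twist (Sgr (dual W)) (proj_prime _) e) :=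
  twist_invertible (@PV_deg1 k (dual W)) e.
have R := @univP_linear k (dual W); have F := @univP_nonzero k (dual W).
have T1 := zprod_tensor (@PV_deg1 k (dual W)) (erefl e1).
have T2 := zprod_tensor (@PV_deg1 k (dual W)) e2E.
have P1 := pP _ _ _ _ S (I 1%N) R F (pointP_lid (dual W)).
have P2 := fP _ _ _ _ _ _ S (I 1%N) T2 univP_proj_linear univP_proj_nonzero P1.
have P3 := fP' _ _ _ _ _ _ S (I 1%N) T1 R F (pointP_lid (dual W)).
have P4 := pullback_frob (@PV_deg1 k (dual W)) (erefl e2) P3.
have P5 := iP _ _ _ _ S (I e2) frob_f_sect_reciprocal frob_f_sect_nonzero P4.
rewrite !lcomp_lid in P2 P5; rewrite lcompA.
apply: pointQ_inj P2 P5 => v v0; apply: zsec_ext => x.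
transitivity (\prod_(l : finvect_type (dual V) | (l : 'Hom(V, k^o)) v == 1)
    vec (dual_proj hV' (l : dual V))).
  by rewrite -(prod_f_index (fun l => vec (dual_proj hV' l)) v0).
rewrite prod_dual_proj // /extend0; case: ifP => vV' //.
exact: (esym (frob_f_sectE x (vsproj_neq0 vV' v0))).
Qed.

End Restriction.

Theorem theorem9p5 (k : finFieldType) (V : nzvect k) (V' : {vspace V})
  (hV' : V' != 0%VS)
  (gOmegaV' : lhom (OmegaV (sub_nzvect hV')) (OmegaV (dual (sub_nzvect hV'))))
  (fOmegaV' : lhom (OmegaV (dual (sub_nzvect hV'))) (OmegaV (sub_nzvect hV')))
  (gV' : lhom (QV (sub_nzvect hV')) (PV (dual (sub_nzvect hV'))))
  (fV' : lhom (PV (dual (sub_nzvect hV'))) (QV (sub_nzvect hV')))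
  (gV : lhom (QV V) (PV (dual V)))
  (fV : lhom (PV (dual V)) (QV V))
  (istar : lhom (QV (sub_nzvect hV')) (QV V))
  (pistar : lhom (PV (dual (sub_nzvect hV'))) (PV (dual V))) :
  is_gOmega gOmegaV' -> is_fOmega fOmegaV' ->
  is_gV gV' -> is_fV fV' -> is_gV gV -> is_fV fV ->
  is_istar istar -> is_pistar pistar ->
  let r'' := (\dim {: V} - \dim V')%N in
  [/\ lcomp gV' (incQ (sub_nzvect hV')) =
        lcomp (incP (dual (sub_nzvect hV'))) gOmegaV',
      lcomp fV' (incP (dual (sub_nzvect hV'))) =
        lcomp (incQ (sub_nzvect hV')) fOmegaV',
      lcomp gV istar = lcomp pistar gV' &
      lcomp fV pistar =
        lcomp (lcomp istar (frob r'' (QV (sub_nzvect hV')))) fV'].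
Proof.
move=> gO fO gP' fP' gP fP iP pP r''; split.
- exact: Omega_g.
- exact: Omega_f.
- exact: square_g.
- exact: square_f.
Qed.
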